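(* Let $n\ge1$ and let $\alpha\in(0,n+2)$, $\lambda$, $\sigma$ be constants with $\frac{n+2-\alpha}{n}\le\lambda<\frac{n+2}{n}$ and $0\le\sigma<\frac{2(n+2)-\alpha}{n}-\lambda$. Suppose $u$ is a nonnegative function with $u\in C^{2,1}(\mathbb{R}^n\times(0,16))\cap L^\lambda(\mathbb{R}^n\times(0,16))$ satisfying $$0\le u_t-\Delta u\le \Big(\iint_{\mathbb{R}^n\times(0,16)}\Phi(x-y,t-s)^{\alpha/n}u(y,s)^\lambda\,dy\,ds\Big)\,u(x,t)^\sigma\quad\text{in }B_4(0)\times(0,16).$$ Then $\max_{|x|\le1}u(x,t)=O(t^{-n/2})$ as $t\to0^+$.
   Context: $\Phi$ is the heat kernel: $\Phi(x,t)=(4\pi t)^{-n/2}e^{-|x|^2/(4t)}$ for $t>0$ and $\Phi(x,t)=0$ for $t\le0$. $B_r(0)$ is the open ball of radius $r$ centered at the origin of $\mathbb{R}^n$. *)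

(* Defs.v *)
From HB Require Import structures.
From mathcomp Require Import all_boot all_order all_algebra.
From mathcomp Require Import all_classical all_reals all_analysis.
Set Implicit Arguments. Unset Strict Implicit. Unset Printing Implicit Defensive.
Import Order.TTheory GRing.Theory Num.Theory.
Import numFieldNormedType.Exports.
Local Open Scope classical_set_scope.
Local Open Scope ring_scope.

Section Defs.
Variable R : realType.

Definition sqnorm n (x : 'rV[R]_n) : R := \sum_(i < n) x ord0 i ^+ 2.
Definition enorm n (x : 'rV[R]_n) : R := Num.sqrt (sqnorm x).

Definition heat_kernel n (x : 'rV[R]_n) (t : R) : R :=
  if 0 < t then powR (4 * pi * t) (- (n%:R / 2)) * expR (- (sqnorm x / (4 * t)))
  else 0.

Fixpoint iter_int (k : nat) (g : seq R -> \bar R) : \bar R :=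
  match k with
  | 0 => g [::]
  | k.+1 => (\int[@lebesgue_measure R]_y iter_int k (fun s => g (y :: s)))%E
  end.

(* integral over R^n (for nonnegative integrands, = Lebesgue integral by Tonelli) *)
Definition int_Rn n (f : 'rV[R]_n -> \bar R) : \bar R :=
  iter_int n (fun s => f (\row_(i < n) nth 0 s i)).

Definition int_Rn_time n (a b : R) (f : 'rV[R]_n -> R -> \bar R) : \bar R :=
  (\int[@lebesgue_measure R]_(s in `]a, b[) int_Rn (fun y => f y s))%E.

Definition xdir n (i : 'I_n) : 'rV[R]_n * R := ('e_i, 0).
Definition tdir n : 'rV[R]_n * R := (0, 1).

Definition C21_on n (D : set ('rV[R]_n * R)) (u : 'rV[R]_n * R -> R) : Prop :=
  forall z, D z ->
    [/\ {for z, continuous u},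
        derivable u z (tdir n) /\ {for z, continuous ('D_(tdir n) u)},
        (forall i, derivable u z (xdir i) /\ {for z, continuous ('D_(xdir i) u)}) &
        (forall i j, derivable ('D_(xdir i) u) z (xdir j) /\
                     {for z, continuous ('D_(xdir j) ('D_(xdir i) u))})].

Definition laplacian n (u : 'rV[R]_n * R -> R) (z : 'rV[R]_n * R) : R :=
  \sum_(i < n) 'D_(xdir i) ('D_(xdir i) u) z.

End Defs.

(* Main.v *)
Require Import Defs.
From HB Require Import structures.
From mathcomp Require Import all_boot all_order all_algebra.
From mathcomp Require Import all_classical all_reals all_analysis.
From mathcomp Require Import measurable_realfun.
From mathcomp Require Import ring lra.
Set Implicit Arguments. Unset Strict Implicit. Unset Printing Implicit Defensive.
Import Order.TTheory GRing.Theory Num.Theory.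
Import numFieldNormedType.Exports.
Local Open Scope classical_set_scope.
Local Open Scope ring_scope.

(** Let f = u_t - Lap u >= 0.  Testing u against a cutoff times e^(ct), where c
    makes the error term nonnegative, bounds the mass of u at time s near the
    origin, and the mass of f on (0, 8), uniformly in s (no initial trace is
    needed).  Testing against a cutoff times the heat kernel gives
      u(x,t) <= C (1 + int Phi(x-y,t-t0) u(y,t0) dy + iint Phi f).
    Since Phi <= A + A^(1-p) Phi^p for p >= 1, choosing A proportional to u(x,t)
    turns this into the same bound for u^p with Phi^p in place of Phi; Tonelli
    then bounds iint Phi^g u^lambda uniformly as soon as g + lambda < 1 + 2/n.

    Now maximise d^n u, where d is a parabolic distance to {|x| = 2} and to the
    initial time.  At a maximum point put M = u(x,t) and w = k M^(-2/n): if d^n M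
    is large, then u <= 2^n M on the cylinder of size d^2/4 > w.  There the
    nonlinear potential is at most C (1 + M^lambda w^e + w^(-n(a-g)/2)), with
    a = alpha/n, which makes the contribution of f on the cylinder of size w a
    power of M smaller than M; the mass bounds control the rest of the
    representation by C (1 + w^(-n/2)) <= C + M/4.  So d^n u is bounded, and the
    initial time may be taken to be t/2. *)

(** Every bound has to survive an initial time tending to 0, where nothing is known about u; this is
    why only masses, which are uniform, enter. The potential also integrates over all of R^n
    although the inequality is local: far from x the kernel is bounded and u in L^lambda takes over.

    The exponents come from the scale w = k M^(-2/n), at which w^(-n/2) times a bounded mass is
    comparable with M. The two unbounded terms of the potential become M^(lambda + a - 1 - 2/n) and
    M^(a - g), and the second dominates when g + lambda <= 1 + 2/n. Multiplication by u^sigma and by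
    the duration w gives M^(a - g + sigma - 2/n), a power below 1 when g > a + sigma - 1 - 2/n. Such
    a g below 1 + 2/n - lambda exists exactly when sigma < 2(n+2)/n - alpha/n - lambda, and lambda
    >= (n+2-alpha)/n gives g <= a, so that Phi^a splits as Phi^(a-g) Phi^g. The threshold 1 + 2/n is
    the one below which powers of Phi are integrable near the origin of space-time. *)

(** * Sigma-finite products and the point mass *)

Section product_measure_sigma_finite.
Local Open Scope ereal_scope.
Context (R : realType) d1 d2 (T1 : measurableType d1) (T2 : measurableType d2).
Variable m1 : {sigma_finite_measure set T1 -> \bar R}.
Variable m2 : {sigma_finite_measure set T2 -> \bar R}.

(* A fresh key for the sigma-finite instance: [\x] itself carries one only for
   subprobabilities. *)
Definition prodm : set (T1 * T2) -> \bar R := m1 \x m2.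

HB.instance Definition _ := Measure.on prodm.

Let prodm_sigma_finite : sigma_finite setT prodm.
Proof.
have /sigma_finiteP[F [TF ndF Foo]] := sigma_finiteT m1.
have /sigma_finiteP[G [TG ndG Goo]] := sigma_finiteT m2.
exists (fun n => F n `*` G n).
  rewrite -setXTT TF TG predeqE => -[x y]; split.
    move=> [/= [n _ Fnx] [k _ Gky]]; exists (maxn n k) => //; split.
    - by move: x Fnx; exact/subsetPset/ndF/leq_maxl.
    - by move: y Gky; exact/subsetPset/ndG/leq_maxr.
  by move=> [n _ []/= ? ?]; split; exists n.
move=> k; have [? ?] := Foo k; have [? ?] := Goo k.
split; first exact: measurableX.
by rewrite [ltLHS]product_measure1E// lte_mul_pinfty// ge0_fin_numE.
Qed.

HB.instance Definition _ := Measure_isSigmaFinite.Build _ _ _ prodm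
  prodm_sigma_finite.

End product_measure_sigma_finite.

Section unit_measure.
Variable R : realType.

(** Volume of R^0, the base of the recursion that defines [mu]; it is a constant of its own, like
    [prodm], so that sigma-finiteness can be attached to it. *)
Definition mu0 : set unit -> \bar R := @dirac _ unit tt R.

HB.instance Definition _ := Measure.on mu0.

Let mu0_sigma_finite : sigma_finite setT mu0.
Proof.
exists (fun=> setT); first by rewrite bigcup_const//; exists 0%N.
by move=> i; split => //; rewrite /mu0/= /dirac/= indicT ltry.
Qed.

HB.instance Definition _ := Measure_isSigmaFinite.Build _ _ _ mu0
  mu0_sigma_finite.

End unit_measure.

(** * R^n as an iterated product of lines *)

Section euclidean_space.
Variable R : realType.
Local Notation L := (@lebesgue_measure R).
Local Notation line := (measurableTypeR R).

Fixpoint Xdisp (n : nat) : measure_display :=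
  match n with
  | 0 => default_measure_display
  | n.+1 => measure_prod_display ((R.-ocitv.-measurable).-sigma%mdisp, Xdisp n)
  end.

(** The nesting [R * (R * ... * unit)] follows the recursion of [iter_int], which then unfolds by
    one use of Tonelli per coordinate. *)
Fixpoint X (n : nat) : measurableType (Xdisp n) :=
  match n return measurableType (Xdisp n) with
  | 0 => unit : measurableType default_measure_display
  | n.+1 => ((line : measurableType _) * X n)%type
  end.

Fixpoint mu (n : nat) : {sigma_finite_measure set (X n) -> \bar R} :=
  match n return {sigma_finite_measure set (X n) -> \bar R} with
  | 0 => mu0 R
  | n.+1 => prodm L (mu n)
  end.

Fixpoint tos (n : nat) : X n -> seq R :=
  match n return X n -> seq R with
  | 0 => fun=> [::]
  | n.+1 => fun x => (x.1 : R) :: tos x.2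
  end.

Definition vec n (x : X n) : 'rV[R]_n := \row_(i < n) nth 0 (tos x) i.

Lemma vecE n (x : X n) i : vec x ord0 i = nth 0 (tos x) i.
Proof. by rewrite mxE. Qed.

Lemma mu0_integral (f : unit -> \bar R) : (\int[mu0 R]_x f x = f tt)%E.
Proof.
rewrite (eq_integral (fun=> f tt)); last by move=> [].
rewrite [LHS](@integral_dirac _ _ (tt : unit) R setT)//.
by rewrite diracT mul1e.
Qed.

Lemma measurable_nth_tos n (i : nat) :
  measurable_fun setT (fun x : X n => nth 0 (tos x) i : R).
Proof.
elim: n i => [|n IH] i; first by rewrite /= nth_nil; exact: measurable_cst.
case: i => [|i] /=.
  exact: measurable_fst.
exact: (measurableT_comp (IH i) measurable_snd).
Qed.

Local Open Scope ereal_scope.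

(** Tonelli, once per coordinate. The iterated integral of the statement becomes an integral against
    a measure, to which the convergence theorems apply. *)
Lemma iter_intE n (g : seq R -> \bar R) :
  measurable_fun setT (g \o @tos n) -> (forall s, 0 <= g s) ->
  iter_int n g = \int[mu n]_x g (tos x).
Proof.
elim: n g => [|n IH] g mg g0; first by rewrite mu0_integral.
rewrite [RHS](@fubini_tonelli1 _ _ _ _ _ L (mu n)) //=.
apply: eq_integral => y _; rewrite IH//.
exact: (measurableT_comp mg (@measurable_pair1 _ _ _ _ y)).
Qed.

Lemma int_RnE n (f : 'rV[R]_n -> \bar R) :
  measurable_fun setT (f \o @vec n) -> (forall x, 0 <= f x) ->
  int_Rn f = \int[mu n]_x f (vec x).
Proof. by move=> mf f0; rewrite /int_Rn iter_intE. Qed.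

(** Space-time measure, with time as the first coordinate. It is convertible with [mu n.+1], so
    facts about functions on [X n.+1] apply to space-time without transport. *)
Definition nu n : {sigma_finite_measure set (line * X n)%type -> \bar R} :=
  prodm L (mu n).

(** [g] is the extension of [f] by zero outside the time interval: measurability is asked of [g]
    alone, and nothing is asked of [f] at other times. *)
Lemma int_Rn_timeE n a b (f : 'rV[R]_n -> R -> \bar R)
    (g : line * X n -> \bar R) :
  measurable_fun setT g -> (forall p, 0 <= g p) ->
  (forall s x, (a < s < b)%R -> 0 <= f x s) ->
  (forall s x, (a < s < b)%R -> f (vec x) s = g (s, x)) ->
  (forall s x, ~~ (a < s < b)%R -> g (s, x) = 0) ->
  int_Rn_time a b f = \int[nu n]_p g p.
Proof.
move=> mg g0 f0 fg gn.
rewrite [RHS](@fubini_tonelli1 _ _ _ _ _ L (mu n)) //= /int_Rn_time.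
rewrite integral_mkcond; apply: eq_integral => s _.
rewrite patchE /fubini_F /=; case: ifPn => [|].
  rewrite inE/= in_itv/= => sab.
  rewrite int_RnE; first by apply: eq_integral => x _; rewrite fg.
    rewrite (_ : _ \o _ = g \o pair (s : line)); last first.
      by apply/funext => x /=; rewrite fg.
    exact: (measurableT_comp mg (pair1_measurable _)).
  by move=> x; exact: f0.
rewrite notin_setE/= in_itv/= => /negP sab.
by rewrite integral0_eq// => x _; rewrite gn.
Qed.

(** An open set is the union of those of the countably many cubes with rational centre and radius
    1/(k+1) that it contains. This links the topology of ['rV[R]_n * R], in which continuity is
    stated, with the product sigma-algebra. *)
Lemma open_measurable n (O : set ('rV[R]_n * R)) : open O ->
  measurable [set p : line * X n | O (vec p.2, p.1 : R)].
Proof.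
move=> oO.
pose B (c : ('rV[rat]_n * rat) * nat) : set (line * X n) :=
  [set p | (forall i, ball (ratr (c.1.1 ord0 i) : R) (c.2.+1%:R^-1)%R (vec p.2 ord0 i)) /\
   ball (ratr c.1.2 : R) (c.2.+1%:R^-1)%R (p.1 : R)].
pose F c := if `[< B c `<=` [set p : line * X n | O (vec p.2, p.1 : R)] >]
  then B c else set0.
have mB c : measurable (B c).
  rewrite (_ : B c = (\bigcap_(i in [set: 'I_n]) [set p : line * X n |
     ball (ratr (c.1.1 ord0 i) : R) (c.2.+1%:R^-1)%R (vec p.2 ord0 i)]) `&`
     [set p : line * X n | ball (ratr c.1.2 : R) (c.2.+1%:R^-1)%R (p.1 : R)]); last first.
    by apply/seteqP; split => p [H1 H2]; split => // i; [move=> _|]; apply: H1.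
  apply: measurableI.
    apply: fin_bigcap_measurable => // i _.
    rewrite (_ : [set _ | _] = setT `&` (fun p : line * X n => nth 0%R (tos p.2) i) @^-1`
       (ball (ratr (c.1.1 ord0 i) : R) (c.2.+1%:R^-1)%R)); last first.
      by rewrite setTI; apply/seteqP; split => p /=; rewrite vecE.
    apply: (measurableT_comp (measurable_nth_tos i) measurable_snd) => //.
    exact: measurable_ball.
  rewrite (_ : [set _ | _] = setT `&` (fst : line * X n -> line) @^-1`
       (ball (ratr c.1.2 : R) (c.2.+1%:R^-1)%R)); last by rewrite setTI.
  apply: measurable_fst => //.
  exact: measurable_ball.
rewrite (_ : [set _ | _] = \bigcup_c F c).
  apply: countable_bigcupT_measurable => [|c]; first exact: countableP.
  by rewrite /F; case: ifP.
apply/seteqP; split => [p /= Op|p [c _]]; last first.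
  by rewrite /F; case: ifPn => // /asboolP; apply.
have := oO; rewrite openE => /(_ _ Op) /nbhs_ballP[e /= e0 eO].
(* Two points in one ball of radius 1/(k+1) around a rational are less than 2/(k+1) apart, hence the
   factor 2. *)
have [k ke] : exists k : nat, (2 * k.+1%:R^-1 < e)%R.
  have [k] := near_infty_natSinv_lt (PosNum (divr_gt0 e0 (ltr0Sn R 1))) => _ /(_ _ (leqnn k)) /= H.
  by exists k; rewrite mulrC -ltr_pdivlMr.
have k0 : (0 < k.+1%:R^-1 :> R)%R by rewrite invr_gt0.
have qex (r : R) : exists q : rat, ball (ratr q : R) (k.+1%:R^-1)%R r.
  move: (k.+1%:R^-1)%R k0 => d d0.
  have [|q] := @rat_in_itvoo R (r - d) (r + d); first by lra.
  rewrite in_itv/= => /andP[q1 q2]; exists q.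
  by rewrite /ball/= ltr_norml; apply/andP; split; lra.
pose q := \row_(i < n) xget 0%R [set q | ball (ratr q : R) (k.+1%:R^-1)%R (vec p.2 ord0 i)].
have [q0 hq0] := qex p.1.
have hq i : ball (ratr (q ord0 i) : R) (k.+1%:R^-1)%R (vec p.2 ord0 i).
  rewrite [q _ _]mxE; case: xgetP => [x _ //|H].
  by have [y /H] := qex (vec p.2 ord0 i).
exists ((q, q0), k) => //; rewrite /F asboolT; first by split.
move=> p' [/= H1 H2]; apply: eO.
have tr (a b c : R) : ball c (k.+1%:R^-1)%R a -> ball c (k.+1%:R^-1)%R b -> ball a e b.
  move: (k.+1%:R^-1)%R ke => d de.
  rewrite /ball/= !ltr_norml => /andP[? ?] /andP[? ?]; apply/andP; split; lra.
split; last exact: tr hq0 H2.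
split => // i j /=; rewrite (ord1 i).
exact: tr (hq j) (H1 j).
Qed.

(** Zero extension off a time strip: functions known to be continuous only in the strip become
    measurable everywhere. *)
Definition tcut n (a b : R) (g : 'rV[R]_n * R -> R) (p : line * X n) : R :=
  if (a < (p.1 : R) < b)%R then g (vec p.2, p.1 : R) else 0%R.

Lemma measurable_tcut n a b (g : 'rV[R]_n * R -> R) :
  (forall z, (a < z.2 < b)%R -> {for z, continuous g}) ->
  measurable_fun setT (tcut a b g).
Proof.
move=> cg.
have oD : open [set z : 'rV[R]_n * R | (a < z.2 < b)%R].
  rewrite (_ : [set _ | _] = snd @^-1` `]a, b[%classic); last first.
    by apply/seteqP; split => z /=; rewrite in_itv.
  by apply: open_comp => [z _|]; [exact: cvg_snd|exact: interval_open].
have mD := open_measurable oD.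
apply: measurable_fun_if => //.
- by apply: (measurable_fun_bool true); rewrite setTI.
- rewrite setTI; apply: (measurability (@RGenOInfty.G R)).
    exact: RGenOInfty.measurableE.
  move=> _ [_ [x ->] <-].
  rewrite (_ : _ `&` _ = [set p : line * X n | ([set z : 'rV[R]_n * R | (a < z.2 < b)%R] `&` g @^-1` `]x, +oo[) (vec p.2, p.1 : R)]); last by [].
  apply: open_measurable; rewrite openE => z [/= zab gz].
  apply: filterI; first exact: open_nbhs_nbhs.
  apply: (cg _ zab); exact: open_nbhs_nbhs.
Qed.

End euclidean_space.

(** * Bounded integrands of bounded support, and integration along coordinate lines *)

Section boxed.
Variable R : realType.
Local Notation L := (@lebesgue_measure R).
Local Notation line := (measurableTypeR R).
Local Notation X := (X R).
Local Notation mu := (mu R).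

Fixpoint upd n : nat -> R -> X n -> X n :=
  match n return nat -> R -> X n -> X n with
  | 0 => fun _ _ x => x
  | n.+1 => fun i r x => if i is i'.+1 then (x.1, upd i' r x.2) else (r : line, x.2)
  end.

Lemma size_tos n (x : X n) : size (tos x) = n.
Proof. by elim: n x => //= n IH x; rewrite IH. Qed.

Lemma nth_tos_upd n i r (x : X n) j : (i < n)%N ->
  nth 0 (tos (upd i r x)) j = if j == i then r else nth 0 (tos x) j.
Proof.
elim: n i j x => [//|n IH] [|i] [|j] x //= lin.
by rewrite IH// eqSS.
Qed.

Lemma vec_upd n (i : 'I_n) r (x : X n) :
  vec (upd i r x) = vec x + (r - vec x ord0 i) *: 'e_i.
Proof.
apply/rowP => j; rewrite [LHS]vecE nth_tos_upd// !(mxE, vecE) eqxx/=.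
case: eqVneq => [/val_inj ->|ji]; first by rewrite eqxx mulr1 addrC subrK.
by rewrite -val_eqE/= (negbTE ji) mulr0 addr0.
Qed.

Definition box n (l : R) : set (X n) := [set x | all (fun r => `|r| <= l) (tos x)].
Arguments box : clear implicits.

Lemma measure_box n l : measurable (box n l) /\ (mu n (box n l) < +oo)%E.
Proof.
elim: n => [|n [mb bfin]].
  split; first by rewrite (_ : box _ _ = setT)//; apply/seteqP; split.
  by rewrite /= /mu0 /dirac/= ltry.
have -> : box n.+1 l = (`[- l, l]%classic : set line) `*` box n l.
  apply/seteqP; split => [[r x]|[r x]] /=; rewrite /box /= in_itv/= ler_norml.
    by move=> /andP[].
  by move=> [-> ->].
split; first exact: measurableX.
have Lfin : (L `[(- l)%R, l] < +oo)%E.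
  by rewrite lebesgue_measure_itv/=; case: ifP => // _; rewrite -EFinB ltry.
rewrite [ltLHS](@product_measure1E _ _ _ _ _ L (mu n))// lte_mul_pinfty//.
by rewrite ge0_fin_numE.
Qed.

(* Integrands bounded by C and vanishing outside a cube: everything the test
   functions produce, so that no integrability question arises. *)
Definition boxed n (G : X n -> R) : Prop :=
  measurable_fun setT G /\ exists C l : R, forall x, `|G x| <= C /\ (~ box n l x -> G x = 0).

Lemma boxed_integrable n (G : X n -> R) : boxed G ->
  (mu n).-integrable setT (EFin \o G).
Proof.
move=> [mG [C [l Gl]]]; have [mb bfin] := measure_box n l.
apply: (@le_integrable _ _ _ (mu n) setT _ _ (EFin \o (fun x => C * \1_(box n l) x))) => //.
- exact/measurable_EFinP.
- move=> x _; rewrite /= lee_fin.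
  have [GC G0] := Gl x; have C0 : 0 <= C by apply: le_trans GC.
  rewrite indicE; case: (boolP (x \in box n l)) => xb; first by rewrite mulr1 (le_trans GC)// ler_norm.
  by rewrite G0 ?normr0// => /mem_set; rewrite (negbTE xb).
rewrite (_ : _ \o _ = (fun x => C%:E * (\1_(box n l) x)%:E)%E); last first.
  by apply/funext => x /=; rewrite EFinM.
apply: integrableZl => //.
apply/integrableP; split; first exact/measurable_EFinP/measurable_indic.
under eq_integral do rewrite gee0_abs ?lee_fin//.
by rewrite integral_indic// setIT.
Qed.

Lemma boxed_slice n (G : X n.+1 -> R) r : boxed G -> boxed (fun x : X n => G (r, x)).
Proof.
move=> [mG [C [l Gl]]]; split.
  exact: (measurableT_comp mG (pair1_measurable _)).
exists C, l => x; have [? H] := Gl (r, x); split => // bx; apply: H => /=.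
by move=> /andP[_].
Qed.

(** Fubini with the i-th coordinate innermost; the induction peels off the coordinates before it. It
    is the vehicle for integration by parts in space. *)
Lemma integral_line_zero n i (G : X n -> R) : (i < n)%N -> boxed G ->
  (forall x, (\int[L]_r (G (upd i r x))%:E = 0)%E) ->
  (\int[mu n]_x (G x)%:E = 0)%E.
Proof.
elim: n i G => [//|n IH] [|i] G ni bG G0.
  rewrite -[LHS](@integral21_prod_meas1 _ _ _ _ _ L (mu n)); last exact: (boxed_integrable bG).
  by rewrite integral0_eq// => x _; rewrite -[RHS](G0 (0 : line, x)).
rewrite -[LHS](@integral12_prod_meas1 _ _ _ _ _ L (mu n)); last exact: (boxed_integrable bG).
rewrite integral0_eq// => r _; rewrite /fubini_F/=.
apply: (IH i (fun x => G (r, x))) => //; first exact: boxed_slice.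
by move=> x; rewrite -[RHS](G0 (r, x)).
Qed.

Lemma coord_le_sqnorm n (v : 'rV[R]_n) i : v ord0 i ^+ 2 <= sqnorm v.
Proof. by rewrite /sqnorm (bigD1 i)//= lerDl sumr_ge0// => j _; exact: sqr_ge0. Qed.

Definition slab n (s0 s1 : R) (g : 'rV[R]_n * R -> R) (p : line * X n) : R :=
  if s0 <= (p.1 : R) <= s1 then g (vec p.2, p.1 : R) else 0.

Lemma slab_boxed n (a b s0 s1 : R) (g : 'rV[R]_n * R -> R) : a < s0 -> s1 < b ->
  (forall z : 'rV[R]_n * R, a < z.2 < b -> {for z, continuous g}) ->
  (forall z : 'rV[R]_n * R, a < z.2 < b -> 16 <= sqnorm z.1 -> g z = 0) ->
  boxed (slab s0 s1 g : X n.+1 -> R).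
Proof.
move=> as0 s1b cg sg; split.
  rewrite (_ : (slab s0 s1 g : X n.+1 -> R) =
     (fun p : line * X n => \1_(`[s0, s1]) (p.1 : R) * tcut a b g p)); last first.
    apply/funext => -[r x]; rewrite /slab /tcut /= indicE.
    have -> : ((r : R) \in (`[s0, s1]%classic)) = (s0 <= (r : R) <= s1) by rewrite mem_setE in_itv.
    case: ifPn => [/andP[h1 h2]|_]; last by rewrite mul0r.
    by rewrite (lt_le_trans as0 h1) (le_lt_trans h2 s1b) mul1r.
  apply: measurable_funM; last exact: measurable_tcut.
  exact: (measurableT_comp (measurable_indic _) measurable_fst).
pose K : set ('rV[R]_n * R) := [set v : 'rV[R]_n | forall i, `[-4, 4]%classic (v ord0 i)] `*` `[s0, s1]%classic.
have cK : compact K.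
  apply: compact_setX; last exact: segment_compact.
  have := @rV_compact R n (fun=> `[-4, 4]%classic) (fun=> @segment_compact R (-4) 4). by [].
have [C [_ HC]] : bounded_set (g @` K).
  apply: compact_bounded; apply: continuous_compact => //.
  apply: continuous_in_subspaceT => z; rewrite inE => -[_ /=]; rewrite in_itv/= => /andP[h1 h2].
  by apply: cg; rewrite (lt_le_trans as0 h1) (le_lt_trans h2 s1b).
have gC z : s0 <= z.2 <= s1 -> `|g z| <= `|C| + 1.
  move=> /andP[h1 h2]; have zab : a < z.2 < b by rewrite (lt_le_trans as0 h1) (le_lt_trans h2 s1b).
  have [z16|z16] := leP 16 (sqnorm z.1); first by rewrite sg// normr0 addr_ge0.
  apply: HC; first by rewrite (le_lt_trans (ler_norm C))// ltrDl.
  exists z => //; split; last by rewrite /= in_itv/= h1.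
  move=> i /=; rewrite in_itv/= -ler_norml -(@ler_pXn2r _ 2)// ?nnegrE//.
  by rewrite real_normK ?num_real// (le_trans (coord_le_sqnorm _ _))// (le_trans (ltW z16))// -natrX.
(* Time is one of the coordinates of [X n.+1], so the half side of the cube must also exceed the
   times in the slab. *)
exists (`|C| + 1), (4 + `|s0| + `|s1|) => -[r x]; split.
  rewrite /slab /=; case: ifPn => [h|_]; first exact: gC.
  by rewrite normr0 addr_ge0.
rewrite /slab/=; case: ifPn => // /andP[h1 h2] /negP nb.
apply: sg => /=; first by rewrite (lt_le_trans as0 h1) (le_lt_trans h2 s1b).
rewrite leNgt; apply: contra nb => x16; apply/andP; split.
  rewrite ler_norml; apply/andP; split.
    apply: le_trans h1.
    by have := ler_norm (- s0); rewrite normrN; have := normr_ge0 s1; lra.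
  apply: (le_trans h2).
  by have := ler_norm s1; have := normr_ge0 s0; lra.
apply/(all_nthP 0) => i ix.
rewrite size_tos in ix; have := coord_le_sqnorm (vec x) (Ordinal ix); rewrite vecE/= => h.
rewrite -addrA ler_wpDr ?addr_ge0// -(@ler_pXn2r _ 2)// ?nnegrE//.
by rewrite real_normK ?num_real// (le_trans h)// (le_trans (ltW x16))// -natrX.
Qed.

Lemma slice_boxed n (a b s : R) (g : 'rV[R]_n * R -> R) : a < s < b ->
  (forall z : 'rV[R]_n * R, a < z.2 < b -> {for z, continuous g}) ->
  (forall z : 'rV[R]_n * R, a < z.2 < b -> 16 <= sqnorm z.1 -> g z = 0) ->
  boxed (fun x : X n => g (vec x, s)).
Proof.
move=> /andP[sa sb] cg sg; have := boxed_slice s (slab_boxed sa sb cg sg).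
by rewrite /slab/= lexx.
Qed.

End boxed.

(** * Directional derivatives and the fundamental theorem of calculus *)

Section directional.
Variable R : realType.

(** Both sides have literally the same difference quotient; through this, one-variable rules compute
    directional derivatives. *)
Lemma is_derive_line (V : normedModType R) (f : V -> R) (z v : V) (df : R) :
  is_derive z v f df <-> is_derive (0 : R) (1 : R) (fun h => f (h *: v + z)) df.
Proof.
have E : (fun h : R => h^-1 *: ((f \o shift z) (h *: v) - f z)) =
  (fun h : R => h^-1 *: (((fun h => f (h *: v + z)) \o shift 0) (h *: 1) -
      (fun h => f (h *: v + z)) 0)).
  by apply/funext => h /=; rewrite addr0 scale0r add0r [X in f (X *: _ + _)]mulr1.
split=> -[d e]; split.
- by move: d; rewrite /derivable E.
- by move: e; rewrite /derive E.
- by rewrite /derivable E.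
- by rewrite /derive E.
Qed.

Lemma is_derive_line_at (V : normedModType R) (f : V -> R) (z v : V) (r df : R) :
  is_derive (r *: v + z) v f df -> is_derive r (1 : R) (fun h => f (h *: v + z)) df.
Proof.
move=> [d e].
have E : (fun h : R => h^-1 *: ((f \o shift (r *: v + z)) (h *: v) - f (r *: v + z))) =
  (fun h : R => h^-1 *: (((fun h => f (h *: v + z)) \o shift r) (h *: 1) -
      (fun h => f (h *: v + z)) r)).
  by apply/funext => h /=; rewrite [X in f ((X + _) *: _ + _)]mulr1 scalerDl addrA.
split; first by move: d; rewrite /derivable E.
by move: e; rewrite /derive E.
Qed.

(** Written as an integral over the whole line of a truncated integrand, the shape in which [slab]
    presents the integrals in time. *)
Lemma integral_FTC (F g : R -> R) (a b : R) : a < b ->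
  (forall r, a <= r <= b -> is_derive r (1 : R) F (g r)) ->
  (forall r, a <= r <= b -> {for r, continuous g}) ->
  (\int[@lebesgue_measure R]_r (if a <= (r : R) <= b then g r else 0)%:E =
   (F b)%:E - (F a)%:E)%E.
Proof.
move=> ab dF cg.
have cF r : a <= r <= b -> {for r, continuous F}.
  move=> rab; apply/differentiable_continuous/derivable1_diffP.
  by have [] := dF r rab.
rewrite -(@continuous_FTC2 R g F a b)//; first last.
- move=> r; rewrite in_itv/= => /andP[ar rb].
  by rewrite derive1E; have [] := dF r _; rewrite ?ltW.
- split.
  + move=> r; rewrite in_itv/= => /andP[ar rb].
    by have [] := dF r _; rewrite ?ltW.
  + by apply: cvg_at_right_filter; apply: cF; rewrite lexx ltW.
  + by apply: cvg_at_left_filter; apply: cF; rewrite lexx ltW.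
- apply: continuous_in_subspaceT => r; rewrite inE/= in_itv/=; exact: cg.
rewrite [RHS]integral_mkcond; apply: eq_integral => r _.
by rewrite patchE mem_setE in_itv/=; case: ifP.
Qed.

End directional.

(** * Green's identity for the heat operator *)

Section test_identity.
Variables (R : realType) (n : nat).
Local Notation L := (@lebesgue_measure R).
Local Notation V := ('rV[R]_n * R)%type.

(** Exactly what the heat operator sees of f, with continuity: the time derivative and the pure
    derivatives in each direction. They are named functions, so that jets of products and
    exponentials are closed formulas. *)
Definition heat_jet (a b : R) (f ft : V -> R) (f1 f2 : 'I_n -> V -> R) : Prop :=
  forall z : V, a < z.2 < b ->
  [/\ {for z, continuous f},
      is_derive z (tdir R n) f (ft z) /\ {for z, continuous ft},
      forall i, is_derive z (xdir R i) f (f1 i z) /\ {for z, continuous (f1 i)} &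
      forall i, is_derive z (xdir R i) (f1 i) (f2 i z) /\ {for z, continuous (f2 i)}].

Variables (a b : R) (psi psit U Ut : V -> R) (psi1 psi2 U1 U2 : 'I_n -> V -> R).
Hypothesis jpsi : heat_jet a b psi psit psi1 psi2.
Hypothesis jU : heat_jet a b U Ut U1 U2.
Hypothesis spsi : forall z : V, a < z.2 < b -> 16 <= sqnorm z.1 ->
  [/\ psi z = 0, psit z = 0, forall i, psi1 i z = 0 & forall i, psi2 i z = 0].

(** The integrand of [test_identity] equals [G1 - \sum_i H i], where [G1] is the time derivative of
    psi U and [H i] is the derivative in direction i of psi U_i - U psi_i. *)
Let G1 z := psit z * U z + psi z * Ut z.
Let H i z := psi z * U2 i z - U z * psi2 i z.

Let cG1 z : a < z.2 < b -> {for z, continuous G1}.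
Proof.
move=> zab; have [c1 [_ c2] _ _] := jpsi zab; have [d1 [_ d2] _ _] := jU zab.
by apply: cvgD; apply: cvgM.
Qed.

Let cH i z : a < z.2 < b -> {for z, continuous (H i)}.
Proof.
move=> zab; have [c1 _ _ /(_ i)[_ c2]] := jpsi zab.
have [d1 _ _ /(_ i)[_ d2]] := jU zab.
by apply: cvgB; apply: cvgM.
Qed.

Let sG1 z : a < z.2 < b -> 16 <= sqnorm z.1 -> G1 z = 0.
Proof. by move=> zab z16; rewrite /G1; have [-> -> _ _] := spsi zab z16; rewrite !mul0r addr0. Qed.

Let sH i z : a < z.2 < b -> 16 <= sqnorm z.1 -> H i z = 0.
Proof. by move=> zab z16; rewrite /H; have [-> _ _ ->] := spsi zab z16; rewrite mul0r mulr0 subr0. Qed.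

Let line_time (y : 'rV[R]_n) (s : R) : (s *: tdir R n + (y, 0) : V) = (y, s).
Proof. by rewrite /tdir; congr pair; rewrite /= ?scaler0 ?add0r// addr0 [LHS]mulr1. Qed.

Let FTC_time s0 s1 (x : X R n) : a < s0 -> s0 < s1 -> s1 < b ->
  (\int[L]_r (slab s0 s1 G1 (r, x))%:E =
   (psi (vec x, s1) * U (vec x, s1))%:E - (psi (vec x, s0) * U (vec x, s0))%:E)%E.
Proof.
move=> as0 s01 s1b.
apply: (@integral_FTC R (fun r => psi (vec x, r) * U (vec x, r)) (fun r => G1 (vec x, r)) s0 s1) => //.
- move=> r /andP[r0 r1].
  have rab : a < (vec x, r).2 < b by rewrite /= (lt_le_trans as0 r0) (le_lt_trans r1 s1b).
  have [_ [+ _] _ _] := jpsi rab; have [_ [+ _] _ _] := jU rab.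
  rewrite -line_time => dU /is_derive_line_at dp.
  move/is_derive_line_at : dU => dU.
  have -> : (fun r => psi (vec x, r) * U (vec x, r)) =
     ((fun h => psi (h *: tdir R n + (vec x, 0))) *
      (fun h => U (h *: tdir R n + (vec x, 0)))).
    by apply/funext => h; rewrite [RHS]/GRing.mul/= line_time.
  apply: is_derive_eq; rewrite !line_time /G1 /GRing.scale/= addrC.
  by congr (_ + _); rewrite mulrC.
- move=> r /andP[r0 r1].
  have rab : a < (vec x, r).2 < b by rewrite /= (lt_le_trans as0 r0) (le_lt_trans r1 s1b).
  have := cG1 rab => c.
  apply: (@continuous_comp _ _ _ (fun r => (vec x, r))) => //.
  by apply: (@cvg_pair _ _ _ (nbhs r) (nbhs (vec x)) (nbhs r)) => //; exact: cvg_cst.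
Qed.

Let line_space i (x : X R n) (s r : R) :
  (r *: xdir R i + (vec x - vec x ord0 i *: 'e_i, s) : V) = (vec (upd i r x), s).
Proof.
rewrite /xdir; congr pair => /=; last by rewrite scaler0 add0r.
by rewrite vec_upd addrCA -scalerBl.
Qed.

(** [H i] is the derivative of [F] along the i-th line, and both vanish for |r| >= 4; the integral
    over the line is therefore the increment of [F] between -5 and 5, where it is zero. *)
Let FTC_space i s (x : X R n) : a < s < b ->
  (\int[L]_r (H i (vec (upd i r x), s))%:E = 0)%E.
Proof.
move=> sab.
pose F r := psi (vec (upd i r x), s) * U1 i (vec (upd i r x), s) -
            U (vec (upd i r x), s) * psi1 i (vec (upd i r x), s).
have big r : 4 <= `|r| -> 16 <= sqnorm (vec (upd i r x)).
  move=> r4; rewrite (le_trans _ (coord_le_sqnorm _ i))// vecE nth_tos_upd// eqxx.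
  by rewrite -(real_normK (num_real r)) (_ : 16 = 4 ^+ 2) ?ler_pXn2r ?nnegrE// -natrX.
have F0 r : 4 <= `|r| -> F r = 0.
  move=> /big r4; rewrite /F; have [-> _ -> _] := @spsi (vec (upd i r x), s) sab r4.
  by rewrite mul0r mulr0 subr0.
have H0 r : 4 <= `|r| -> H i (vec (upd i r x), s) = 0.
  by move=> /big r4; apply: sH.
have := @integral_FTC R F (fun r => H i (vec (upd i r x), s)) (-5) 5.
have n5 : 4 <= `|5 : R| by rewrite ger0_norm; lra.
rewrite !F0 ?normrN// subee// => H5; apply: etrans (H5 _ _ _).
- apply: eq_integral => r _; case: ifPn => // r5; rewrite H0//.
  by move: r5; rewrite -ler_norml -ltNge => /ltW; apply: le_trans; lra.
- lra.
- move=> r _.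
  have rab : a < (vec (upd i r x), s).2 < b by [].
  have [_ _ /(_ i)[+ _] /(_ i)[+ _]] := jpsi rab.
  have [_ _ /(_ i)[+ _] /(_ i)[+ _]] := jU rab.
  rewrite -line_space.
  move=> /is_derive_line_at d1 /is_derive_line_at d2 /is_derive_line_at d3 /is_derive_line_at d4.
  pose z := (vec x - vec x ord0 i *: 'e_i, s).
  have -> : F = (fun h => psi (h *: xdir R i + z)) * (fun h => U1 i (h *: xdir R i + z))
     - (fun h => U (h *: xdir R i + z)) * (fun h => psi1 i (h *: xdir R i + z)).
    by apply/funext => h; rewrite /F -!line_space.
  apply: is_derive_eq; rewrite /H /GRing.scale/=.
  by rewrite -/z; ring.
- move=> r _.
  have rab : a < (vec (upd i r x), s).2 < b by [].
  have c := @cH i _ rab.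
  apply: (@continuous_comp _ _ _ (fun r => (vec (upd i r x), s))) => //.
  have -> : (fun r => (vec (upd i r x), s)) = (fun r => r *: xdir R i + (vec x - vec x ord0 i *: 'e_i, s)).
    by apply/funext => h; rewrite line_space.
  apply: cvgD; last exact: cvg_cst.
  by apply: cvgZr_tmp; exact: cvg_id.
Qed.

(** Since psi vanishes for |x| >= 4, no boundary terms in space appear and only the two time slices
    remain. *)
Theorem test_identity s0 s1 : a < s0 -> s0 < s1 -> s1 < b ->
  (\int[mu R n]_x (psi (vec x, s1) * U (vec x, s1))%:E =
   \int[mu R n]_x (psi (vec x, s0) * U (vec x, s0))%:E +
   \int[nu R n]_p (slab s0 s1 (fun z => psi z * (Ut z - \sum_i U2 i z) +
                               U z * (psit z + \sum_i psi2 i z)) p)%:E)%E.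
Proof.
move=> as0 s01 s1b.
have bG1 := slab_boxed as0 s1b cG1 sG1.
have bH i := slab_boxed as0 s1b (@cH i) (@sH i).
have bF s : a < s < b -> boxed (fun x : X R n => psi (vec x, s) * U (vec x, s)).
  move=> sab; apply: (slice_boxed (g := fun z => psi z * U z) sab) => z zab.
    by have [c _ _ _] := jpsi zab; have [d _ _ _] := jU zab; apply: cvgM.
  by move=> z16; have [-> _ _ _] := spsi zab z16; rewrite mul0r.
have s0ab : a < s0 < b by rewrite as0 (lt_trans s01 s1b).
have s1ab : a < s1 < b by rewrite s1b (lt_trans as0 s01).
have b0 := boxed_integrable (bF _ s0ab); have b1 := boxed_integrable (bF _ s1ab).
have iG1 : (\int[nu R n]_p (slab s0 s1 G1 p)%:E =
  \int[mu R n]_x (psi (vec x, s1) * U (vec x, s1))%:E -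
   \int[mu R n]_x (psi (vec x, s0) * U (vec x, s0))%:E)%E.
  rewrite -[LHS](@integral21_prod_meas1 _ _ _ _ _ L (mu R n)); last exact: (boxed_integrable bG1).
  rewrite -[RHS]integralB//.
  by apply: eq_integral => x _; exact: FTC_time.
have iH i : (\int[nu R n]_p (slab s0 s1 (H i) p)%:E = 0)%E.
  rewrite -[LHS](@integral12_prod_meas1 _ _ _ _ _ L (mu R n)); last exact: (boxed_integrable (bH i)).
  apply: integral0_eq => r _; rewrite /fubini_F/= /slab/=.
  have [rs|rs] := boolP (s0 <= (r : R) <= s1); last by rewrite integral0.
  have rab : a < (r : R) < b.
    by move/andP: rs => [r0 r1]; rewrite (lt_le_trans as0 r0) (le_lt_trans r1 s1b).
  apply: (@integral_line_zero _ _ i) => //.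
  - exact: (slice_boxed rab (@cH i) (@sH i)).
  - by move=> x; exact: FTC_space.
have -> : (\int[nu R n]_p (slab s0 s1 (fun z => psi z * (Ut z - \sum_i U2 i z) +
     U z * (psit z + \sum_i psi2 i z)) p)%:E = \int[nu R n]_p (slab s0 s1 G1 p)%:E)%E.
  transitivity (\int[nu R n]_p ((slab s0 s1 G1 p)%:E - \sum_(i < n) (slab s0 s1 (H i) p)%:E))%E.
    apply: eq_integral => p _; rewrite sumEFin -EFinB; congr (_%:E).
    rewrite /slab; case: ifP => _; last by rewrite big1_eq subr0.
    rewrite /G1 /H big_split/= -mulr_sumr sumrN -mulr_sumr; ring.
  rewrite integralB//; last 2 first.
  - exact: (boxed_integrable bG1).
  - apply: (@integrable_sum _ _ _ _ setT) => //= i _; exact: (boxed_integrable (bH i)).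
  rewrite integral_sum//; last by move=> i; exact: (boxed_integrable (bH i)).
  by rewrite big1 ?sube0.
rewrite iG1 addeC subeK//.
by apply: integrable_fin_num => //; exact: b0.
Qed.

Lemma test_integrand_boxed s0 s1 : a < s0 -> s1 < b ->
  boxed (slab s0 s1 (fun z => psi z * (Ut z - \sum_i U2 i z) +
                              U z * (psit z + \sum_i psi2 i z)) : X R n.+1 -> R).
Proof.
move=> as0 s1b; apply: (slab_boxed as0 s1b) => z zab.
  have [c1 [_ c2] _ c3] := jpsi zab; have [d1 [_ d2] _ d3] := jU zab.
  have e1 : {for z, continuous (fun z => \sum_i U2 i z)}.
    by apply: cvg_big => [|i _]; [exact: add_continuous|exact: (d3 i).2].
  have e2 : {for z, continuous (fun z => \sum_i psi2 i z)}.
    by apply: cvg_big => [|i _]; [exact: add_continuous|exact: (c3 i).2].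
  apply: cvgD; apply: cvgM => //; [exact: cvgB|exact: cvgD].
move=> z16; have [-> -> _ p2] := spsi zab z16.
by rewrite mul0r !add0r big1 ?mulr0// => i _; exact: p2.
Qed.

End test_identity.

(** * Cutoff functions of class C^2 *)

Section cutoffs.
Variable R : realType.

(** Truncated powers, of class C^(k-1) for k >= 1; cubes are thus the smallest powers that give C^2
    cutoffs. *)
Definition pospow (k : nat) (x : R) : R := (Num.max x 0) ^+ k.

Lemma pospow_ge0 k x : 0 <= pospow k x.
Proof. by rewrite exprn_ge0// le_max lexx orbT. Qed.

Lemma pospow_gtE k x : 0 <= x -> pospow k x = x ^+ k.
Proof. by move=> x0; rewrite /pospow max_l. Qed.

Lemma pospow_ltE k x : x <= 0 -> pospow k.+1 x = 0.
Proof. by move=> x0; rewrite /pospow max_r// expr0n. Qed.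

Lemma continuous_pospow k : continuous (pospow k).
Proof.
move=> x; apply: (@continuous_comp R R R (fun x => Num.max x 0) (fun x => x ^+ k)).
  by apply: continuous_max; [exact: cvg_id|exact: cvg_cst].
exact: exprn_continuous.
Qed.

Lemma is_derive_pospow k x :
  is_derive x (1 : R) (pospow k.+2) (k.+2%:R * pospow k.+1 x).
Proof.
have [x0|x0|->] := ltgtP x 0.
- rewrite (pospow_ltE _ (ltW x0)) mulr0.
  have dc : is_derive x (1 : R) (cst (0 : R)) 0 by exact: is_derive_cst.
  apply: near_eq_is_derive dc.
  near=> y; rewrite /= pospow_ltE//; apply/ltW.
  by near: y; exact: lt_nbhsl.
- rewrite (pospow_gtE _ (ltW x0)).
  have dc : is_derive x (1 : R) (id ^+ k.+2 : R -> R) (k.+2%:R * x ^+ k.+1).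
    by apply: is_derive_eq; rewrite /= [LHS]mulr1.
  apply: near_eq_is_derive dc.
  near=> y; rewrite pospow_gtE ?fctE//; apply/ltW.
  by near: y; exact: lt_nbhsr.
- rewrite (pospow_ltE _ (lexx _)) mulr0.
  suff cv : (fun h : R => h^-1 *: ((pospow k.+2 \o shift (0 : R)) (h *: (1 : R)) - pospow k.+2 0)) @ 0^' --> (0 : R).
    by split; [apply/cvg_ex; exists 0|exact: cvg_lim].
  apply/cvgrPdist_le => e e0; near=> h.
  have h0 : h != 0 by near: h; exact: nbhs_dnbhs_neq.
  rewrite sub0r normrN /= (pospow_ltE _ (lexx _)) subr0 addr0 /GRing.scale/= mulr1.
  have he : `|h| <= e by near: h; apply: dnbhs0_le.
  have h1 : `|h| <= 1 by near: h; apply: dnbhs0_le.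
  have [hle|hge] := leP h 0; first by rewrite pospow_ltE// mulr0 normr0 ltW.
  rewrite pospow_gtE ?(ltW hge)// exprS mulKf// normrX exprS.
  by rewrite (le_trans _ he)// ler_piMr// exprn_ile1.
Unshelve. all: by end_near. Qed.

(** The function is h q = 1 - (1 - (12 - q)_+^3 / 8)_+^3. The inner truncation flattens it at q =
    12, the outer one at q = 10, where (12 - q)^3 = 8. The variable q stands for |x|^2: the
    transition zone lies between 9, the range of the points at which u is represented, and 16, the
    limit of the differential inequality. *)
Lemma cutoff_exists : exists h h1 h2 : R -> R,
  [/\ forall q, is_derive q (1 : R) h (h1 q),
      forall q, is_derive q (1 : R) h1 (h2 q),
      continuous h2,
      forall q, 0 <= h q <= 1 &
      (forall q, q <= 10 -> [/\ h q = 1, h1 q = 0 & h2 q = 0]) /\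
      (forall q, 12 <= q -> [/\ h q = 0, h1 q = 0 & h2 q = 0])].
Proof.
pose p k : R -> R := pospow k \o (fun q => 12 - q).
pose v : R -> R := fun q => 1 - 8^-1 * p 3%N q.
pose v1 : R -> R := fun q => 8^-1 * (3 * p 2%N q).
pose v2 : R -> R := fun q => - (8^-1 * (6 * p 1%N q)).
have dp k q : is_derive q (1 : R) (p k.+2) (- (k.+2%:R * p k.+1 q)).
  have d1 : is_derive q (1 : R) (fun q => 12 - q) (- 1).
    rewrite (_ : (fun q => _) = cst (12 : R) - (id : R -> R)); last by apply/funext.
    by apply: is_derive_eq; rewrite sub0r.
  by have := @is_derive1_comp R (pospow k.+2) (fun q => 12 - q) q _ _ (is_derive_pospow k (12 - q)) d1; rewrite mulrN1.
have dv q : is_derive q (1 : R) v (v1 q).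
  have d := dp 1%N q.
  rewrite (_ : v = cst 1 - 8^-1 *: p 3%N); last by apply/funext.
  by apply: is_derive_eq; rewrite /v1 /GRing.scale/=; ring.
have dv1 q : is_derive q (1 : R) v1 (v2 q).
  have d := dp 0%N q.
  rewrite (_ : v1 = (8^-1 * 3) *: p 2%N); last by apply/funext => x; rewrite /v1/= mulrA.
  by apply: is_derive_eq; rewrite /v2 /GRing.scale/=; ring.
have dpv k q : is_derive q (1 : R) (pospow k.+2 \o v) (k.+2%:R * pospow k.+1 (v q) * v1 q).
  by apply: is_derive1_comp; exact: is_derive_pospow.
have cp k : continuous (p k).
  move=> q; apply: (@continuous_comp R R R (fun q => 12 - q)); last exact: continuous_pospow.
  by apply: cvgB; [exact: cvg_cst|exact: cvg_id].
have cv1 : continuous v1 by move=> q; do 2 (apply: cvgM; first exact: cvg_cst); exact: cp.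
have cv2 : continuous v2.
  by move=> q; apply: cvgN; do 2 (apply: cvgM; first exact: cvg_cst); exact: cp.
have cv : continuous v.
  move=> q; apply: cvgB; first exact: cvg_cst.
  by apply: cvgM; [exact: cvg_cst|exact: cp].
have cpv k : continuous (fun q => pospow k (v q)).
  by move=> q; apply: (@continuous_comp R R R v); [exact: cv|exact: continuous_pospow].
exists (fun q => 1 - pospow 3 (v q)), (fun q => - (3 * pospow 2 (v q) * v1 q)),
  (fun q => - ((6 * pospow 1 (v q) * v1 q) * v1 q + 3 * pospow 2 (v q) * v2 q)).
have pv1 k q : 0 <= pospow k (v q) <= 1.
  rewrite pospow_ge0 exprn_ile1// ?le_max ?lexx ?orbT// ge_max ler01 andbT.
  by rewrite /v gerBl mulr_ge0// ?invr_ge0// pospow_ge0.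
split.
- move=> q; have d := dpv 1%N q.
  rewrite (_ : (fun q => _) = cst 1 - (pospow 3 \o v)); last by apply/funext.
  by apply: is_derive_eq; rewrite sub0r.
- move=> q; have d := dpv 0%N q; have d' := dv1 q.
  rewrite (_ : (fun q => _) = - ((3 *: (pospow 2 \o v)) * v1)); last by apply/funext.
  apply: is_derive_eq; rewrite /GRing.scale/= [in RHS](_ : 6 = 3 * 2) ?fctE; last by rewrite -natrM.
  by rewrite /GRing.scale/=; ring.
- move=> q; apply: cvgN; apply: cvgD.
    apply: cvgM; last exact: cv1.
    apply: cvgM; last exact: cv1.
    by apply: cvgM; [exact: cvg_cst|exact: cpv].
  apply: cvgM; last exact: cv2.
  by apply: cvgM; [exact: cvg_cst|exact: cpv].
- by move=> q; have := pv1 3%N q; move=> /andP[? ?]; apply/andP; split; lra.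
split=> q hq.
- have v0 : v q <= 0.
    rewrite /v /p /= pospow_gtE; last by lra.
    rewrite subr_le0 -ler_pdivrMl ?invr_gt0// mulr1 invrK.
    rewrite (_ : 8 = 2 ^+ 3); last by rewrite -natrX.
    by rewrite ler_pXn2r// ?nnegrE; lra.
  by rewrite !pospow_ltE// !(mulr0, mul0r, addr0, subr0, oppr0).
- have p0 k : p k.+1 q = 0 by rewrite /p/= pospow_ltE//; lra.
  have -> : v q = 1 by rewrite /v p0 mulr0 subr0.
  by rewrite /v1 /v2 !p0 pospow_gtE// expr1n !(mulr0, subrr, oppr0, addr0).
Qed.

End cutoffs.

Lemma is_derive_quad0 (R : realType) (A B C : R) :
  is_derive (0 : R) (1 : R) (fun r => A + B * r + C * r ^+ 2) B.
Proof.
have d := is_deriveD (is_deriveD (is_derive_cst A (0 : R) (1 : R))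
   (is_deriveZ B (is_derive_id (0 : R) (1 : R))))
   (is_deriveZ C (is_deriveX 2 (is_derive_id (0 : R) (1 : R)))).
apply: (is_derive_eq d).
by rewrite /= expr1 /GRing.scale/= mulr1 mulr0 mul0r mulr0 addr0 add0r.
Qed.

(** * Jets of products, exponentials, radial functions and the heat kernel *)

Section jets.
Variables (R : realType) (n : nat).
Local Notation V := ('rV[R]_n * R)%type.
Implicit Types (a b : R) (z : V).

Lemma heat_jetM a b (f ft g gt : V -> R) (f1 f2 g1 g2 : 'I_n -> V -> R) :
  heat_jet a b f ft f1 f2 -> heat_jet a b g gt g1 g2 ->
  heat_jet a b (fun z => f z * g z) (fun z => ft z * g z + f z * gt z)
    (fun i z => f1 i z * g z + f z * g1 i z)
    (fun i z => f2 i z * g z + 2 * (f1 i z * g1 i z) + f z * g2 i z).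
Proof.
move=> jf jg z zab.
have [cf [df cft] Hf1 Hf2] := jf z zab; have [cg [dg cgt] Hg1 Hg2] := jg z zab.
split.
- exact: cvgM.
- split; last by apply: cvgD; apply: cvgM.
  rewrite (_ : (fun z => _) = f * g); last by apply/funext.
  by apply: is_derive_eq; rewrite /GRing.scale/=; ring.
- move=> i; have [df1 cf1] := Hf1 i; have [dg1 cg1] := Hg1 i.
  split; last by apply: cvgD; apply: cvgM.
  rewrite (_ : (fun z => _) = f * g); last by apply/funext.
  by apply: is_derive_eq; rewrite /GRing.scale/=; ring.
- move=> i; have [df1 cf1] := Hf1 i; have [dg1 cg1] := Hg1 i.
  have [df2 cf2] := Hf2 i; have [dg2 cg2] := Hg2 i.
  split; last first.
    apply: cvgD; last exact: cvgM.
    apply: cvgD; first exact: cvgM.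
    by apply: cvgM; [exact: cvg_cst|exact: cvgM].
  apply: (is_derive_eq (is_deriveD (is_deriveM df2 dg1) (is_deriveM df1 dg2))).
  by rewrite /GRing.scale/=; ring.
Qed.

Lemma is_derive_exp_comp (f : V -> R) z v (df : R) : is_derive z v f df ->
  is_derive z v (fun z => expR (f z)) (expR (f z) * df).
Proof.
move=> /is_derive_line d; apply/is_derive_line.
have e : is_derive ((fun h : R => f (h *: v + z)) 0) (1 : R) expR (expR (f z)).
  by rewrite scale0r add0r; exact: is_derive_expR.
exact: (is_derive1_comp e d).
Qed.

Lemma heat_jet_exp a b (f ft : V -> R) (f1 f2 : 'I_n -> V -> R) :
  heat_jet a b f ft f1 f2 ->
  heat_jet a b (fun z => expR (f z)) (fun z => expR (f z) * ft z)
    (fun i z => expR (f z) * f1 i z)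
    (fun i z => expR (f z) * (f1 i z ^+ 2 + f2 i z)).
Proof.
move=> jf z zab; have [cf [df cft] Hf1 Hf2] := jf z zab.
have ce : {for z, continuous (fun z => expR (f z))}.
  by apply: (@continuous_comp _ R R f expR) => //; exact: continuous_expR.
split; first exact: ce.
- by split; [exact: is_derive_exp_comp|exact: cvgM].
- move=> i; have [df1 cf1] := Hf1 i.
  by split; [exact: is_derive_exp_comp|exact: cvgM].
- move=> i; have [df1 cf1] := Hf1 i; have [df2 cf2] := Hf2 i.
  split; last first.
    apply: cvgM => //; apply: cvgD => //.
    by rewrite (_ : (fun z => _) = f1 i * f1 i); [apply: cvgM|apply/funext].
  have d := is_derive_exp_comp df1.
  have de := is_derive_exp_comp (f := f) df1.
  rewrite (_ : (fun z => _) = (fun z => expR (f z)) * f1 i); last by apply/funext.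
  by apply: is_derive_eq; rewrite /GRing.scale/=; ring.
Qed.

Lemma sqnorm_line (y : 'rV[R]_n) i (h : R) :
  sqnorm (h *: 'e_i + y) = sqnorm y + 2 * h * y ord0 i + h ^+ 2.
Proof.
rewrite /sqnorm (bigD1 i)//= [in RHS](bigD1 i)//= !mxE !eqxx mulr1.
under eq_bigr => j ji do rewrite !mxE eqxx/= (negbTE ji) mulr0 add0r.
by ring.
Qed.

Lemma continuous_coord z i : {for z, continuous (fun z : V => z.1 ord0 i)}.
Proof.
apply: (@continuous_comp _ _ _ fst (fun y : 'rV[R]_n => y ord0 i)).
  exact: cvg_fst.
exact: coord_continuous.
Qed.

Lemma continuous_sqnorm_sub (x : 'rV[R]_n) z :
  {for z, continuous (fun z : V => sqnorm (x - z.1))}.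
Proof.
have c i : {for z, continuous (fun z : V => (x - z.1) ord0 i ^+ 2)}.
  rewrite (_ : (fun z : V => _) = (fun z => x ord0 i - z.1 ord0 i) * (fun z => x ord0 i - z.1 ord0 i)); last first.
    by apply/funext => y; rewrite !mxE.
  by apply: cvgM; (apply: cvgB; [exact: cvg_cst|exact: continuous_coord]).
by apply: cvg_big => [|i _]; [exact: add_continuous|exact: c].
Qed.

Lemma sqnormN (y : 'rV[R]_n) : sqnorm (- y) = sqnorm y.
Proof. by apply: eq_bigr => i _; rewrite mxE sqrrN. Qed.

Lemma sqnorm_ge0 (y : 'rV[R]_n) : 0 <= sqnorm y.
Proof. by apply: sumr_ge0 => i _; exact: sqr_ge0. Qed.

Lemma continuous_sqnorm z : {for z, continuous (fun z : V => sqnorm z.1)}.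
Proof.
have := @continuous_sqnorm_sub 0 z; rewrite (_ : (fun z : V => sqnorm (0 - z.1)) = fun z => sqnorm z.1)//.
by apply/funext => y; rewrite sub0r sqnormN.
Qed.

(** Radial functions are written through |x|^2, which is smooth at the origin and quadratic along
    every coordinate line. *)
Lemma heat_jet_radial a b (h h1 h2 : R -> R) :
  (forall q, is_derive q (1 : R) h (h1 q)) ->
  (forall q, is_derive q (1 : R) h1 (h2 q)) -> continuous h2 ->
  heat_jet a b (fun z : V => h (sqnorm z.1)) (fun=> 0)
    (fun i z => 2 * z.1 ord0 i * h1 (sqnorm z.1))
    (fun i z => 2 * h1 (sqnorm z.1) + 4 * z.1 ord0 i ^+ 2 * h2 (sqnorm z.1)).
Proof.
move=> dh dh1 ch2 z _.
have dcont (k : R -> R) (k1 : R -> R) : (forall q, is_derive q (1 : R) k (k1 q)) -> continuous k.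
  by move=> dk q; apply/differentiable_continuous/derivable1_diffP; have [] := dk q.
have cc (k : R -> R) : continuous k -> {for z, continuous (fun z : V => k (sqnorm z.1))}.
  move=> ck; apply: (@continuous_comp _ R R (fun z : V => sqnorm z.1) k).
    exact: continuous_sqnorm.
  exact: ck.
have ch := dcont _ _ dh; have ch1 := dcont _ _ dh1.
have dl (k k1 : R -> R) i : (forall q, is_derive q (1 : R) k (k1 q)) ->
    is_derive z (xdir R i) (fun z : V => k (sqnorm z.1)) (2 * z.1 ord0 i * k1 (sqnorm z.1)).
  move=> dk; apply/is_derive_line => /=.
  pose l (r : R) := sqnorm z.1 + 2 * r * z.1 ord0 i + r ^+ 2.
  rewrite (_ : (fun r : R => _) = k \o l); last first.
    by apply/funext => r; rewrite /= sqnorm_line.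
  have l0 : l 0 = sqnorm z.1 by rewrite /l mulr0 mul0r expr0n !addr0.
  have d : is_derive (0 : R) (1 : R) l (2 * z.1 ord0 i).
    rewrite (_ : l = fun r => sqnorm z.1 + (2 * z.1 ord0 i) * r + 1 * r ^+ 2).
      exact: is_derive_quad0.
    by apply/funext => r; rewrite /l; ring.
  have dk0 := dk (l 0).
  have := is_derive1_comp dk0 d; rewrite l0 => HH.
  by apply: is_derive_eq; rewrite mulrC.
split.
- exact: cc.
- split; last exact: cvg_cst.
  apply/is_derive_line => /=.
  rewrite (_ : (fun _ : R => _) = cst (h (sqnorm z.1))); first exact: is_derive_cst.
  by apply/funext => r; rewrite scaler0 add0r.
- move=> i; split; first exact: dl.
  apply: cvgM; last exact: cc.
  by apply: cvgM; [exact: cvg_cst|exact: continuous_coord].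
- move=> i; split; last first.
    apply: cvgD; first by apply: cvgM; [exact: cvg_cst|exact: cc].
    apply: cvgM; last exact: cc.
    apply: cvgM; first exact: cvg_cst.
    rewrite (_ : (fun z : V => _) = (fun z => z.1 ord0 i) * (fun z => z.1 ord0 i)); last by apply/funext.
    by apply: cvgM; exact: continuous_coord.
  have d2 := dl _ _ i dh1.
  have dx : is_derive z (xdir R i) (fun z : V => z.1 ord0 i) 1.
    apply/is_derive_line => /=.
    rewrite (_ : (fun r : R => _) = (id : R -> R) + cst (z.1 ord0 i)).
      by apply: is_derive_eq; rewrite addr0.
    by apply/funext => r; rewrite !mxE !eqxx mulr1.
  rewrite (_ : (fun z : V => _) = (2 *: (fun z : V => z.1 ord0 i)) * (fun z : V => h1 (sqnorm z.1))); last by apply/funext.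
  by apply: is_derive_eq; rewrite ?fctE /GRing.scale/= ?fctE /GRing.scale/=; ring.
Qed.

(* Logarithm of the heat kernel; the derivatives of the kernel itself then
   follow from [heat_jet_exp]. *)
Definition logheat (x : 'rV[R]_n) (t : R) (z : V) : R :=
  - (n%:R / 2) * ln (4 * pi * (t - z.2)) - sqnorm (x - z.1) / (4 * (t - z.2)).

Lemma heat_kernelE x t z : z.2 < t ->
  heat_kernel (x - z.1) (t - z.2) = expR (logheat x t z).
Proof.
move=> zt; rewrite /heat_kernel subr_gt0 zt /logheat expRD /powR ifF//.
by apply/negbTE; rewrite gt_eqF// mulr_gt0 ?subr_gt0// mulr_gt0 ?pi_gt0.
Qed.

(** With these formulas the time derivative plus the sum over i of (first derivative)^2 + second
    derivative is zero: this is the backward heat equation for the kernel in the variables (y, s).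
    The bound b <= t keeps s before the singularity. *)
Lemma heat_jet_logheat a b x t : b <= t ->
  heat_jet a b (logheat x t)
    (fun z => n%:R / (2 * (t - z.2)) - sqnorm (x - z.1) / (4 * (t - z.2) ^+ 2))
    (fun i z => (x ord0 i - z.1 ord0 i) / (2 * (t - z.2)))
    (fun i z => - (2 * (t - z.2))^-1).
Proof.
move=> bt z /andP[_ zb].
have tz : 0 < t - z.2 by rewrite subr_gt0 (lt_le_trans zb).
have tz0 : t - z.2 != 0 by rewrite gt_eqF.
have p0 : 0 < 4 * pi :> R by rewrite mulr_gt0 ?pi_gt0.
have ct : {for z, continuous (fun z : V => t - z.2)}.
  by apply: cvgB; [exact: cvg_cst|exact: cvg_snd].
have cM (c : R) : {for z, continuous (fun z : V => c * (t - z.2))}.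
  by apply: cvgM => //; exact: cvg_cst.
have c4 : {for z, continuous (fun z : V => (4 * (t - z.2))^-1)}.
  by apply: cvgV; [rewrite mulf_neq0 ?pnatr_eq0|exact: cM].
have c2 : {for z, continuous (fun z : V => (2 * (t - z.2))^-1)}.
  by apply: cvgV; [rewrite mulf_neq0 ?pnatr_eq0|exact: cM].
have cl : {for z, continuous (fun z : V => ln (4 * pi * (t - z.2)))}.
  apply: (@continuous_comp _ R R (fun z : V => 4 * pi * (t - z.2)) (@ln R)); first exact: cM.
  by apply: continuous_ln; rewrite mulr_gt0.
split.
- apply: cvgB; last by apply: cvgM => //; exact: continuous_sqnorm_sub.
  apply: cvgM; first exact: cvg_cst.
  exact: cl.
- split; last first.
    apply: cvgB; first by apply: cvgM => //; exact: cvg_cst.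
    apply: cvgM; first exact: continuous_sqnorm_sub.
    apply: cvgV; first by rewrite mulf_neq0 ?pnatr_eq0 ?expf_neq0.
    apply: cvgM; first exact: cvg_cst.
    rewrite (_ : (fun z : V => _) = (fun z => t - z.2) * (fun z => t - z.2)); last by apply/funext.
    exact: cvgM.
  apply/is_derive_line => /=.
  pose l (h : R) := t - z.2 - h.
  have dl : is_derive (0 : R) (1 : R) l (- 1).
    rewrite (_ : l = cst (t - z.2) - (id : R -> R)); last by apply/funext.
    by apply: is_derive_eq; rewrite sub0r.
  have l0 : l 0 = t - z.2 by rewrite /l subr0.
  have d1 : is_derive (0 : R) (1 : R) (fun h => ln (4 * pi * l h)) (- (t - z.2)^-1).
    have dl4 : is_derive (0 : R) (1 : R) ((4 * pi) *: l) (- (4 * pi)).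
      by apply: is_derive_eq; rewrite /GRing.scale/= mulrN1.
    have := @is_derive1_comp R (@ln R) ((4 * pi) *: l) 0 _ _ (is_derive1_ln _) dl4.
    rewrite /= !fctE /GRing.scale/= l0 => /(_ (mulr_gt0 p0 tz)) HH.
    by apply: is_derive_eq; rewrite invfM mulrN mulrAC mulVf ?mul1r// gt_eqF.
  have d2 : is_derive (0 : R) (1 : R) (fun h => (l h)^-1) ((t - z.2) ^- 2).
    have lz : l 0 != 0 by rewrite l0.
    have dd := is_deriveV lz dl.
    by apply: is_derive_eq; rewrite l0 /GRing.scale/= mulrN1 opprK.
  rewrite (_ : (fun h : R => _) = (- (n%:R / 2)) *: (fun h => ln (4 * pi * l h)) -
     (sqnorm (x - z.1) / 4) *: (fun h => (l h)^-1)); last first.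
    apply/funext => h; rewrite /logheat /= scaler0 add0r (_ : t - (h *: 1 + z.2) = l h).
      by rewrite !fctE /GRing.scale/= invfM mulrA.
    by rewrite /l [h *: 1]mulr1 opprD addrA addrAC.
  by apply: is_derive_eq; rewrite /GRing.scale/=; field.
- move=> i; split; last first.
    apply: cvgM => //; apply: cvgB; [exact: cvg_cst|exact: continuous_coord].
  apply/is_derive_line => /=.
  pose c := - (n%:R / 2) * ln (4 * pi * (t - z.2)) - sqnorm (x - z.1) / (4 * (t - z.2)).
  pose d := (x ord0 i - z.1 ord0 i) / (2 * (t - z.2)).
  rewrite (_ : (fun h : R => _) = fun h => c + d * h + (- (4 * (t - z.2))^-1) * h ^+ 2).
    exact: is_derive_quad0.
  apply/funext => h; rewrite /logheat /= scaler0 add0r.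
  have -> : sqnorm (x - (h *: 'e_i + z.1)) = sqnorm (x - z.1) - 2 * h * (x ord0 i - z.1 ord0 i) + h ^+ 2.
    rewrite opprD addrCA -scaleNr sqnorm_line !mxE; ring.
  by rewrite /c /d; field.
- move=> i; split; last exact: cvgN.
  apply/is_derive_line => /=.
  rewrite (_ : (fun h : R => _) = cst ((x ord0 i - z.1 ord0 i) / (2 * (t - z.2))) - (2 * (t - z.2))^-1 *: (id : R -> R)).
    by apply: is_derive_eq; rewrite /GRing.scale/= mulr1 sub0r.
  apply/funext => h; rewrite /= scaler0 add0r !mxE !eqxx !fctE /GRing.scale/= mulr1.
  by field.
Qed.

End jets.

(** * Measurability of truncations in space and time *)

Section measurability.
Variables (R : realType) (n : nat).
Local Notation line := (measurableTypeR R).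

Lemma measurable_sqnorm_vec : measurable_fun setT (fun x : X R n => sqnorm (vec x)).
Proof.
rewrite /sqnorm; apply: measurable_sum => i.
rewrite (_ : (fun x => _) = (fun x : X R n => nth 0 (tos x) i ^+ 2)); last first.
  by apply/funext => x; rewrite vecE.
by apply: measurable_funX; exact: measurable_nth_tos.
Qed.

Lemma measurable_if_sqnorm (c : R) (g : line * X R n -> R) :
  measurable_fun setT g ->
  measurable_fun setT (fun p : line * X R n => if sqnorm (vec p.2) <= c then g p else 0).
Proof.
move=> mg; apply: measurable_fun_ifT => //.
apply: measurable_fun_ler => //.
exact: (measurableT_comp measurable_sqnorm_vec measurable_snd).
Qed.

Lemma measurable_if_time (s0 s1 : R) (g : line * X R n -> R) :
  measurable_fun setT g ->
  measurable_fun setT (fun p : line * X R n => if s0 <= (p.1 : R) <= s1 then g p else 0).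
Proof.
move=> mg; apply: measurable_fun_ifT => //.
by apply: measurable_and; apply: measurable_fun_ler => //; exact: measurable_fst.
Qed.

End measurability.

(** * Uniform mass bounds for u and for its source *)

Section supertemperature.
Variables (R : realType) (n : nat).
Local Notation line := (measurableTypeR R).
Local Notation V := ('rV[R]_n * R)%type.
Variable u : 'rV[R]_n -> R -> R.
Let U (z : V) := u z.1 z.2.
Hypothesis u_ge0 : forall x t, 0 < t < 16 -> 0 <= u x t.
Hypothesis u_C21 : C21_on [set z | 0 < z.2 < 16] U.

Definition heat_op (z : V) : R := 'D_(tdir R n) U z - laplacian U z.

Hypothesis heat_ge0 : forall x t, enorm x < 4 -> 0 < t < 16 -> 0 <= heat_op (x, t).

Lemma heat_op_ge0 (z : V) : sqnorm z.1 < 16 -> 0 < z.2 < 16 -> 0 <= heat_op z.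
Proof.
case: z => x t /= x16 t16; apply: heat_ge0 => //.
by rewrite /enorm -[4]ger0_norm// -sqrtr_sqr ltr_sqrt// -natrX.
Qed.

Lemma heat_jet_U : heat_jet 0 16 U ('D_(tdir R n) U) (fun i => 'D_(xdir R i) U)
  (fun i => 'D_(xdir R i) ('D_(xdir R i) U)).
Proof.
move=> z z16; have [cu [dt ct] d1 d2] := u_C21 z16; split.
- exact: cu.
- by split; [exact/derivableP|exact: ct].
- by move=> i; have [d c] := d1 i; split; [exact/derivableP|exact: c].
- by move=> i; have [d c] := d2 i i; split; [exact/derivableP|exact: c].
Qed.

Lemma continuous_U z : 0 < z.2 < 16 -> {for z, continuous U}.
Proof. by move=> /heat_jet_U[]. Qed.

Lemma continuous_heat_op z : 0 < z.2 < 16 -> {for z, continuous heat_op}.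
Proof.
move=> /heat_jet_U[_ [_ ct] _ c2]; apply: cvgB => //.
by apply: cvg_big => [|i _]; [exact: add_continuous|exact: (c2 i).2].
Qed.

Definition ubar : line * X R n -> R := tcut 0 16 U.
(** The radius is the outer edge of the cutoff and stays inside |x| < 4, where the source is known
    to be nonnegative. *)
Definition fbar (p : line * X R n) : R :=
  if sqnorm (vec p.2) <= 12 then tcut 0 16 heat_op p else 0.

Lemma measurable_ubar : measurable_fun setT ubar.
Proof. by apply: measurable_tcut => z; exact: continuous_U. Qed.

Lemma measurable_fbar : measurable_fun setT fbar.
Proof.
by apply: measurable_if_sqnorm; apply: measurable_tcut => z; exact: continuous_heat_op.
Qed.

Lemma ubar_ge0 p : 0 <= ubar p.
Proof. by rewrite /ubar /tcut; case: ifP => // p16; exact: u_ge0. Qed.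

Lemma fbar_ge0 p : 0 <= fbar p.
Proof.
rewrite /fbar /tcut; case: ifPn => // p12; case: ifPn => // pt.
by apply: heat_op_ge0 => //=; lra.
Qed.

Definition umass (s : R) := (\int[mu R n]_x (if sqnorm (vec x) <= 12 then ubar (s, x) else 0)%:E)%E.
Definition fmass (s0 s1 : R) := (\int[nu R n]_p (if (s0 <= p.1 <= s1)%R then fbar p else 0)%:E)%E.

(* The test function is e^(ct) (15 - |x|^2)_+^3; with c = (6n + 24)^2 the
   quantity E below, coming from its backward heat operator, is nonnegative. *)
Lemma mass_bound : exists CA : R, 0 <= CA /\
  (forall s : R, 0 < s <= 8 -> (umass s <= CA%:E)%E) /\
  (forall s0 : R, 0 < s0 -> (fmass s0 8%R <= CA%:E)%E).
Proof.
pose B : R := 6 * n%:R + 24.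
pose c : R := B ^+ 2.
pose hw (q : R) := pospow 3 (15 - q).
have dhw k (q : R) : is_derive q (1 : R) (fun q => pospow k.+2 (15 - q)) (- (k.+2%:R * pospow k.+1 (15 - q))).
  have d1 : is_derive q (1 : R) (fun q => 15 - q) (- 1).
    rewrite (_ : (fun q => _) = cst (15 : R) - (id : R -> R)); last by apply/funext.
    by apply: is_derive_eq; rewrite sub0r.
  by have := @is_derive1_comp R (pospow k.+2) (fun q => 15 - q) q _ _ (is_derive_pospow k (15 - q)) d1; rewrite mulrN1.
pose hw1 (q : R) := - (3 * pospow 2 (15 - q)).
pose hw2 (q : R) := 6 * pospow 1 (15 - q).
have dhw1 q : is_derive q (1 : R) hw1 (hw2 q).
  have d := dhw 0%N q.
  rewrite (_ : hw1 = - (3 *: (fun q => pospow 2 (15 - q)))); last by apply/funext.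
  by apply: is_derive_eq; rewrite /hw2 /GRing.scale/=; ring.
have chw2 : continuous hw2.
  move=> q; apply: cvgM; first exact: cvg_cst.
  have cq : {for q, continuous (fun q : R => pospow 1 (15 - q))}.
    apply: (@continuous_comp R R R (fun q => 15 - q)); last exact: continuous_pospow.
    by apply: cvgB; [exact: cvg_cst|exact: cvg_id].
  exact: cq.
have jw := @heat_jet_radial R n 0 16 hw hw1 hw2 (dhw 1%N) dhw1 chw2.
have jl : heat_jet 0 16 (fun z : V => c * z.2) (fun=> c) (fun _ _ => 0) (fun _ _ => 0).
  move=> z _; split.
  - by apply: cvgM; [exact: cvg_cst|exact: cvg_snd].
  - split; last exact: cvg_cst.
    apply/is_derive_line => /=.
    rewrite (_ : (fun h : R => _) = c *: (id : R -> R) + cst (c * z.2)).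
      by apply: is_derive_eq; rewrite addr0 [LHS]mulr1.
    by apply/funext => h; rewrite [h *: 1]mulr1 mulrDr.
  - move=> i; split; last exact: cvg_cst.
    apply/is_derive_line => /=.
    rewrite (_ : (fun h : R => _) = cst (c * z.2)); first exact: is_derive_cst.
    by apply/funext => h; rewrite scaler0 add0r.
  - by move=> i; split; [exact: is_derive_cst|exact: cvg_cst].
have jpsi := heat_jetM (heat_jet_exp jl) jw.
pose psi (z : V) := expR (c * z.2) * hw (sqnorm z.1).
have v0 q : 16 <= q -> [/\ hw q = 0, hw1 q = 0 & hw2 q = 0].
  move=> q16; rewrite /hw /hw1 /hw2 !pospow_ltE ?mulr0 ?oppr0//; lra.
have c0 : 0 <= c by exact: sqr_ge0.
have psi_ge0 z : 0 <= psi z by rewrite mulr_ge0 ?expR_ge0 ?pospow_ge0.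
have psi_ge1 z : 0 < z.2 -> sqnorm z.1 <= 12 -> 1 <= psi z.
  move=> z0 z12.
  have e1 : 1 <= expR (c * z.2) by rewrite -[1]expR0 ler_expR mulr_ge0// ltW.
  have h1 : 1 <= hw (sqnorm z.1).
    by rewrite /hw pospow_gtE; [rewrite exprn_ege1//|]; lra.
  by rewrite /psi -[1]mulr1 ler_pM.
pose E q := c * hw q + 2 * n%:R * hw1 q + 4 * q * hw2 q.
have E_ge0 q : 0 <= E q.
  rewrite /E /hw /hw1 /hw2; have [q15|q15] := leP 15 q.
    by rewrite !pospow_ltE ?mulr0 ?oppr0 ?mulr0 ?addr0//; lra.
  rewrite !pospow_gtE; [|lra..].
  pose v := 15 - q; rewrite -/v (_ : q = 15 - v); last by rewrite /v; ring.
  have v0' : 0 <= v by rewrite /v; lra.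
  (* After q = 15 - v the coefficient of -v^2 in E is B; the choice c = B^2 turns the bracket into a
     quadratic in B v without real roots. *)
  rewrite (_ : _ + _ = v * ((B * v) ^+ 2 - B * v + 24 * 15)).
    have Bv : 0 <= B * v by rewrite mulr_ge0// addr_ge0// mulr_ge0.
    rewrite mulr_ge0//; move: (B * v) Bv => w w0.
    by have := sqr_ge0 (w - 1); lra.
  by rewrite /c /B; ring.
pose T z := psi z * heat_op z + U z * (expR (c * z.2) * E (sqnorm z.1)).
have T_ge z : 0 < z.2 < 16 -> 0 <= T z /\ (sqnorm z.1 <= 12 -> heat_op z <= T z).
  move=> z16.
  have U0 : 0 <= U z * (expR (c * z.2) * E (sqnorm z.1)).
    by rewrite mulr_ge0 ?u_ge0// mulr_ge0 ?expR_ge0.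
  split.
    rewrite /T addr_ge0//; have [q16|q16] := leP 16 (sqnorm z.1).
      by have [h0 _ _] := v0 _ q16; rewrite /psi h0 mulr0 mul0r.
    by rewrite mulr_ge0// heat_op_ge0.
  move=> q12; rewrite /T ler_wpDr// ler_peMl ?psi_ge1 ?heat_op_ge0//.
    by lra.
  by case/andP: z16.
pose I s := (\int[mu R n]_x (psi (vec x, s) * U (vec x, s))%:E)%E.
pose F s0 := (\int[nu R n]_p (slab s0 8 T p)%:E)%E.
have IE s0 : 0 < s0 -> s0 < 8 -> (I 8%R = I s0 + F s0)%E /\
    measurable_fun setT (slab s0 8 T : X R n.+1 -> R).
  move=> s00 s08.
  have s8 : (8 : R) < 16 by lra.
  have := @test_identity R n 0 16 _ _ U _ _ _ _ _ jpsi heat_jet_U _ s0 8 s00 s08 s8.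
  have := @test_integrand_boxed R n 0 16 _ _ U _ _ _ _ _ jpsi heat_jet_U _ s0 8 s00 s8.
  set T' := (fun z => _).
  have TE z : T' z = T z.
    rewrite /T' /T /psi; congr (_ * _ + _ * _).
    set q := sqnorm z.1; set e := expR (c * z.2).
    rewrite (eq_bigr (fun i => e * (2 * hw1 q) + (4 * e * hw2 q) * (z.1 ord0 i) ^+ 2)); last first.
      by move=> i _ /=; rewrite -/e; ring.
    rewrite big_split/= sumr_const card_ord -mulr_sumr -/(sqnorm z.1) -/q -mulr_natr /E.
    by ring.
  have -> : T' = T by apply/funext.
  move=> Hb Hi; split.
    rewrite /I Hi// => z z16 q16; have [h0 h1 h2] := v0 _ q16.
    by split; [| |move=> i|move=> i]; rewrite ?h0 ?h1 ?h2; ring.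
  apply: (Hb _).1 => z z16 q16; have [h0 h1 h2] := v0 _ q16.
  by split; [| |move=> i|move=> i]; rewrite ?h0 ?h1 ?h2; ring.
have bI s : 0 < s < 16 -> (mu R n).-integrable setT (fun x => (psi (vec x, s) * U (vec x, s))%:E).
  move=> s16; apply: boxed_integrable.
  apply: (slice_boxed (g := fun z => psi z * U z) s16) => z z16.
    by have [+ _ _ _] := jpsi _ z16; have cu := continuous_U z16 => cp; exact: cvgM.
  by move=> q16; have [h0 _ _] := v0 _ q16; rewrite /psi h0 mulr0 mul0r.
have I_ge0 s : 0 < s < 16 -> (0 <= I s)%E.
  by move=> s16; apply: integral_ge0 => x _; rewrite lee_fin mulr_ge0// u_ge0.
have F_ge0 s0 : 0 < s0 -> (0 <= F s0)%E.
  move=> s00; apply: integral_ge0 => p _; rewrite lee_fin /slab; case: ifPn => // /andP[p1 p2].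
  by apply: (T_ge _ _).1 => /=; rewrite (lt_le_trans s00 p1)/= (le_lt_trans p2)//; lra.
have e16 : 0 < (8 : R) < 16 by lra.
have I8 : (I 8%R = (fine (I 8%R))%:E)%E.
  by rewrite fineK//; apply: integrable_fin_num => //; exact: bI.
have um s : 0 < s < 16 -> (umass s <= I s)%E.
  move=> s16; apply: ge0_le_integral => //.
  - by move=> x _; rewrite lee_fin; case: ifP => // _; exact: ubar_ge0.
  - apply/measurable_EFinP.
    have mm := measurable_if_sqnorm 12 measurable_ubar.
    exact: (measurableT_comp mm (pair1_measurable (s : line))).
  - by have /integrableP[] := bI _ s16.
  - move=> x _; rewrite lee_fin /ubar /tcut /= s16; case: ifPn => [x12|_].
      by rewrite ler_peMl ?u_ge0 ?psi_ge1//; case/andP: s16.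
    by rewrite mulr_ge0// u_ge0.
have fm s0 : 0 < s0 -> s0 < 8 -> (fmass s0 8%R <= F s0)%E.
  move=> s00 s08; have [_ mT] := IE _ s00 s08; apply: ge0_le_integral => //.
  - by move=> x _; rewrite lee_fin; case: ifP => // _; exact: fbar_ge0.
  - apply/measurable_EFinP; apply: measurable_if_time; exact: measurable_fbar.
  - by apply/measurable_EFinP; exact: mT.
  - move=> p _; rewrite lee_fin /slab /fbar /tcut; case: ifPn => // /andP[p1 p2].
    have p16 : 0 < (p.1 : R) < 16 by rewrite (lt_le_trans s00 p1)/= (le_lt_trans p2)//; lra.
    have [T0 T1] := T_ge (vec p.2, p.1 : R) p16.
    by rewrite p16; case: ifPn => // /T1.
(* Both bounds are the weighted mass at the fixed time 8: I 8 = I s0 + F s0 with nonnegative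
   summands, for every s0 in (0, 8). This is the source of the uniformity as s0 tends to 0. *)
exists (fine (I 8%R)); rewrite -lee_fin -I8 I_ge0//; split => //; split.
  move=> s /andP[s0]; rewrite le_eqVlt => /predU1P[->|s8]; first exact: um.
  have s16 : 0 < s < 16 by rewrite s0 (lt_trans s8)//; lra.
  by rewrite (le_trans (um _ s16))// (IE _ s0 s8).1 leeDl// F_ge0.
have fm8 s0 : 0 < s0 -> s0 < 8 -> (fmass s0 8%R <= I 8%R)%E.
  move=> s00 s08; rewrite (le_trans (fm _ s00 s08))// (IE _ s00 s08).1 leeDr// I_ge0// s00 (lt_trans s08)//.
  by lra.
move=> s0 s00; have [s08|s08] := ltP s0 8; first exact: fm8.
(* For s0 >= 8 the time interval has at most one point, so any earlier start, such as 4, gives a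
   larger integral. *)
apply: le_trans (fm8 4 _ _); [|lra..].
apply: ge0_le_integral => //.
- by move=> x _; rewrite lee_fin; case: ifP => // _; exact: fbar_ge0.
- by apply/measurable_EFinP; apply: measurable_if_time; exact: measurable_fbar.
- by apply/measurable_EFinP; apply: measurable_if_time; exact: measurable_fbar.
- move=> p _; rewrite lee_fin; case: ifPn => [/andP[p1 p2]|_].
    by rewrite p2 (le_trans _ p1)//; lra.
  by case: ifP => // _; exact: fbar_ge0.
Qed.

End supertemperature.

(** * Inequalities for powers and integrals of singular powers *)

Section powers.
Variable R : realType.
Implicit Types (m w t x y p : R).

Lemma powRV x p : 0 <= x -> powR x^-1 p = (powR x p)^-1.
Proof. by move=> x0; rewrite -powR_inv1// -powRrM mulN1r powRN. Qed.

(** Raise x / m <= e^(x/m) to the power m. *)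
Lemma powR_le_expR m x : 0 < m -> 0 <= x -> powR (x / m) m <= expR x.
Proof.
move=> m0 x0.
have : x / m <= expR (x / m) by rewrite (le_trans _ (expR_ge1Dx _))// lerDr.
have xm : 0 <= x / m by rewrite divr_ge0// ltW.
move=> /(ge0_ler_powR (ltW m0)); rewrite !nnegrE expR_ge0 => /(_ xm isT) /le_trans; apply.
by rewrite -expRM divfK// gt_eqF.
Qed.

(** [powR_le_expR] at w / (4t): the Gaussian factor beats the singular power of t, and what is left
    depends on w alone. *)
Lemma exp_pow_bound m w t : 0 < m -> 0 < w -> 0 < t ->
  powR t (- m) * expR (- (w / (4 * t))) <= powR (4 * m) m * powR w (- m).
Proof.
move=> m0 w0 t0.
have wt : 0 <= w / (4 * t) by rewrite divr_ge0// ltW// mulr_gt0.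
have := powR_le_expR m0 wt.
have p0 : 0 < powR (w / (4 * t) / m) m by rewrite powR_gt0// !divr_gt0// mulr_gt0.
rewrite -(lef_pV2 (expR_gt0 _) p0) -expRN => /(ler_wpM2l (powR_ge0 t (- m))) /le_trans; apply.
rewrite -powRN (_ : w / (4 * t) / m = w * (t^-1 * (4 * m)^-1)); last first.
  by rewrite !invfM; ring.
have i1 : 0 <= t^-1 by rewrite invr_ge0 ltW.
have i2 : 0 <= (4 * m)^-1 by rewrite invr_ge0 mulr_ge0// ltW.
rewrite (powRM _ (ltW w0)) ?mulr_ge0// (powRM _ i1 i2).
rewrite (powRV _ (ltW t0)) powRV ?mulr_ge0 ?(ltW m0)// !powRN.
have tn : powR t m != 0 by rewrite gt_eqF// powR_gt0.
have wn : powR w m != 0 by rewrite gt_eqF// powR_gt0.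
have mn : powR (4 * m) m != 0 by rewrite gt_eqF// powR_gt0// mulr_gt0.
by rewrite le_eqVlt; apply/orP; left; apply/eqP; field; rewrite tn wn mn.
Qed.

Lemma powR_le_neg m x y : 0 <= m -> 0 < x -> x <= y -> powR y (- m) <= powR x (- m).
Proof.
move=> m0 x0 xy; have y0 := lt_le_trans x0 xy.
rewrite !powRN lef_pV2 ?posrE ?powR_gt0//.
by apply: (ge0_ler_powR m0) => //; rewrite nnegrE ltW.
Qed.

Lemma powR_itv_le1 x p : 0 <= x -> x <= 1 -> 0 <= p -> powR x p <= 1.
Proof.
move=> x0 x1 p0; have -> : 1 = powR 1 p by rewrite powR1.
by apply: ge0_ler_powR; rewrite ?nnegrE.
Qed.

(** Replace the smaller base by the larger one. For two kernels with different poles this separates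
    their product into integrals that are computed one at a time. *)
Lemma powR_young x y a b : 0 <= x -> 0 <= y -> 0 <= a -> 0 <= b ->
  powR x a * powR y b <= powR x (a + b) + powR y (a + b).
Proof.
move=> x0 y0 a0 b0.
wlog xy : x y a b x0 y0 a0 b0 / x <= y.
  move=> H; have [xy|/ltW yx] := leP x y; first exact: H.
  by rewrite mulrC addrC (addrC a); apply: H.
have [y00|yn] := eqVneq y 0.
  have -> : x = y by apply/eqP; rewrite eq_le xy y00 x0.
  rewrite y00 /powR eqxx; have [->|an] := eqVneq a 0; rewrite ?add0r.
    by case: (b == 0); rewrite ?mul1r ?mulr0 ?addr0 ?lerDl//.
  by rewrite mul0r addr_ge0.
have yg : 0 < y by rewrite lt_neqAle eq_sym yn.
rewrite ler_wpDl ?powR_ge0// (powRD _ (s := b)); last by rewrite yn implybT.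
by rewrite ler_wpM2r ?powR_ge0// ge0_ler_powR.
Qed.

(** [g] may be singular at either endpoint: closed subintervals exhaust (a, b), and only the
    increments of [F] have to be bounded. *)
Lemma integral_FTC_exhaust (F g : R -> R) (a b C : R) :
  measurable_fun setT g ->
  (forall r, a < r < b -> is_derive r (1 : R) F (g r)) ->
  (forall r, a < r < b -> {for r, continuous g}) ->
  (forall r, a < r < b -> 0 <= g r) ->
  (forall r r', a < r -> r < r' -> r' < b -> F r' - F r <= C) -> 0 <= C ->
  (\int[@lebesgue_measure R]_r (if (a < (r : R) < b)%R then g r else 0)%:E <= C%:E)%E.
Proof.
move=> mg dF cg g0 FC C0.
have [ba|ab] := leP b a.
  rewrite integral0_eq ?lee_fin// => r _; case: ifP => // /andP[ar rb].
  by move: (lt_trans ar rb); rewrite ltNge ba.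
(* Starting the denominators at 3 makes every interval [a + eta, b - eta] nondegenerate. *)
pose eta (k : nat) := (b - a) / k.+3%:R.
have eta0 k : 0 < eta k by rewrite divr_gt0 ?subr_gt0.
have eta3 k : 3 * eta k <= b - a.
  rewrite /eta mulrA ler_pdivrMr// mulrC ler_wpM2l ?subr_ge0 ?(ltW ab)// ler_nat.
  by rewrite !ltnS.
pose A k : set R := `[a + eta k, b - eta k]%classic.
have etaS k l : (k <= l)%N -> eta l <= eta k.
  move=> kl; rewrite /eta ler_wpM2l ?subr_ge0 ?(ltW ab)//.
  by rewrite lef_pV2 ?posrE// ler_nat !ltnS.
have ndA : nondecreasing_seq A.
  move=> k l kl; rewrite subsetEset => r; rewrite /A /= !in_itv/= => /andP[h1 h2].
  by have := etaS _ _ kl => ekl; apply/andP; split; lra.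
have UA : \bigcup_k A k = `]a, b[%classic.
  apply/seteqP; split => r.
    move=> [k _]; rewrite /A /= !in_itv/= => /andP[h1 h2].
    by have := eta0 k => ek; apply/andP; split; lra.
  rewrite /= in_itv/= => /andP[ar rb].
  pose d := Num.min (r - a) (b - r).
  have d0 : 0 < d by rewrite lt_min !subr_gt0 ar rb.
  have [k kd] : exists k, eta k < d.
    have [k] := near_infty_natSinv_lt (PosNum (divr_gt0 d0 (ltac:(by rewrite subr_gt0) : 0 < b - a))) => _ /(_ _ (leqnn k)) /= H.
    exists k; rewrite (le_lt_trans _ (_ : (b - a) * k.+1%:R^-1 < d))//.
      by rewrite /eta ler_wpM2l ?subr_ge0 ?(ltW ab)// lef_pV2 ?posrE// ler_nat !ltnS leqW.
    by rewrite mulrC -ltr_pdivlMr ?subr_gt0.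
  exists k => //; rewrite /A /= in_itv/=.
  move: kd; rewrite lt_min => /andP[k1 k2]; apply/andP; split; lra.
have mG : measurable_fun setT (fun r => (g r)%:E) by apply/measurable_EFinP.
rewrite (_ : (\int[_]_r _)%E = (\int[@lebesgue_measure R]_(r in \bigcup_k A k) (g r)%:E)%E); last first.
  rewrite UA [RHS]integral_mkcond; apply: eq_integral => r _.
  by rewrite patchE mem_setE in_itv/=; case: ifP.
have cvA : (\int[@lebesgue_measure R]_(r in A k) (g r)%:E @[k --> \oo] -->
   \int[@lebesgue_measure R]_(r in \bigcup_k A k) (g r)%:E)%E.
  apply: ge0_nondecreasing_set_cvg_integral => //.
  - by move=> k; exact: measurable_itv.
  - by move=> k; apply: measurable_funTS.
  - move=> k r; rewrite /A /= in_itv/= => /andP[h1 h2].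
    by rewrite lee_fin g0//; have := eta0 k => ek; apply/andP; split; lra.
rewrite -(cvg_lim _ cvA)//; apply: lime_le; first by apply/cvg_ex; eexists; exact: cvA.
near=> k.
have k0 := eta0 k; have k3 := eta3 k.
have := @integral_FTC R F g (a + eta k) (b - eta k).
rewrite (_ : (\int[_]_r _)%E = (\int[@lebesgue_measure R]_(r in A k) (g r)%:E)%E); last first.
  rewrite [RHS]integral_mkcond; apply: eq_integral => r _.
  by rewrite patchE mem_setE in_itv/=; case: ifP.
move=> FT.
have h1 : a + eta k < b - eta k by lra.
have h2 r : a + eta k <= r <= b - eta k -> is_derive r (1 : R) F (g r).
  by move=> /andP[r1 r2]; apply: dF; apply/andP; split; lra.
have h3 r : a + eta k <= r <= b - eta k -> {for r, continuous g}.
  by move=> /andP[r1 r2]; apply: cg; apply/andP; split; lra.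
by rewrite (FT h1 h2 h3) -EFinB lee_fin FC//; lra.
Unshelve. all: by end_near. Qed.

Lemma integral_powR_left (th a t : R) : th < 1 -> a < t ->
  (\int[@lebesgue_measure R]_s (if (a < (s : R) < t)%R then powR (t - s) (- th) else 0)%:E
    <= (powR (t - a) (1 - th) / (1 - th))%:E)%E.
Proof.
move=> th1 ta.
have th0 : 0 < 1 - th by rewrite subr_gt0.
have dl (s : R) : is_derive s (1 : R) (fun s => t - s) (- 1).
  rewrite (_ : (fun s => _) = cst t - (id : R -> R)); last by apply/funext.
  by apply: is_derive_eq; rewrite sub0r.
have dp q s : s < t -> is_derive s (1 : R) (fun s => powR (t - s) q) (- (q * powR (t - s) (q - 1))).
  move=> st; have st' : 0 < t - s by rewrite subr_gt0.
  have d0 := is_derive1_powR q st'.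
  by have := @is_derive1_comp R (fun y => powR y q) (fun s => t - s) s _ _ d0 (dl s); rewrite mulrN1.
apply: (@integral_FTC_exhaust (fun s => - (1 - th)^-1 * powR (t - s) (1 - th))).
- apply: (measurableT_comp (measurable_powR _)).
  by apply: measurable_funB.
- move=> r /andP[ar rt]; have d := dp (1 - th) r rt.
  rewrite (_ : (fun s => _) = (- (1 - th)^-1) *: (fun s => powR (t - s) (1 - th))); last by apply/funext.
  apply: is_derive_eq; rewrite /GRing.scale/= mulNr mulrN opprK mulKf ?gt_eqF//.
  by congr (powR _ _); ring.
- move=> r /andP[ar rt]; apply/differentiable_continuous/derivable1_diffP.
  by have [] := dp (- th) r rt.
- by move=> r _; exact: powR_ge0.
- move=> r r' ar rr rt.
  have := powR_ge0 (t - r') (1 - th).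
  have : powR (t - r) (1 - th) <= powR (t - a) (1 - th).
    by apply: (ge0_ler_powR (ltW th0)); rewrite ?nnegrE; lra.
  have c0 : 0 < (1 - th)^-1 by rewrite invr_gt0.
  move: (powR (t - r) _) (powR (t - r') _) (powR (t - a) _) (1 - th)^-1 c0 => x z y c c0 xy z0.
  have h1 := mulr_ge0 (ltW c0) z0.
  have h2 : 0 <= c * (y - x) by rewrite mulr_ge0 ?(ltW c0) ?subr_ge0.
  by rewrite mulrBr in h2; rewrite [leRHS]mulrC !mulNr opprK addrC; lra.
- by rewrite divr_ge0 ?powR_ge0 ?ltW.
Qed.

Lemma integral_powR_right (th a t : R) : th < 1 -> a < t ->
  (\int[@lebesgue_measure R]_s (if (a < (s : R) < t)%R then powR (s - a) (- th) else 0)%:E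
    <= (powR (t - a) (1 - th) / (1 - th))%:E)%E.
Proof.
move=> th1 ta.
have th0 : 0 < 1 - th by rewrite subr_gt0.
have dl (s : R) : is_derive s (1 : R) (fun s => s - a) 1.
  rewrite (_ : (fun s => _) = (id : R -> R) - cst a); last by apply/funext.
  by apply: is_derive_eq; rewrite subr0.
have dp q s : a < s -> is_derive s (1 : R) (fun s => powR (s - a) q) (q * powR (s - a) (q - 1)).
  move=> st; have st' : 0 < s - a by rewrite subr_gt0.
  have d0 := is_derive1_powR q st'.
  by have := @is_derive1_comp R (fun y => powR y q) (fun s => s - a) s _ _ d0 (dl s); rewrite mulr1.
apply: (@integral_FTC_exhaust (fun s => (1 - th)^-1 * powR (s - a) (1 - th))).
- apply: (measurableT_comp (measurable_powR _)).
  by apply: measurable_funB.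
- move=> r /andP[ar rt]; have d := dp (1 - th) r ar.
  rewrite (_ : (fun s => _) = (1 - th)^-1 *: (fun s => powR (s - a) (1 - th))); last by apply/funext.
  apply: is_derive_eq; rewrite /GRing.scale/= mulKf ?gt_eqF//.
  by congr (powR _ _); ring.
- move=> r /andP[ar rt]; apply/differentiable_continuous/derivable1_diffP.
  by have [] := dp (- th) r ar.
- by move=> r _; exact: powR_ge0.
- move=> r r' ar rr rt.
  have := powR_ge0 (r - a) (1 - th).
  have : powR (r' - a) (1 - th) <= powR (t - a) (1 - th).
    by apply: (ge0_ler_powR (ltW th0)); rewrite ?nnegrE; lra.
  move=> h1 h2.
  by rewrite [leRHS]mulrC -mulrBr ler_pM2l ?invr_gt0//; lra.
- by rewrite divr_ge0 ?powR_ge0 ?ltW.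
Qed.

End powers.

(** * Gaussian integrals *)

Section gaussian.
Variable R : realType.
Local Notation L := (@lebesgue_measure R).
Local Notation line := (measurableTypeR R).

(** Normalization of the normal density of mean a and variance 1 / (2c). *)
Lemma integral_gauss1 (a c : R) : 0 < c ->
  (\int[L]_r (expR (- (c * (a - r) ^+ 2)))%:E = (Num.sqrt (pi / c))%:E)%E.
Proof.
move=> c0; pose s := Num.sqrt (2 * c)^-1.
have c2 : 0 < (2 * c)^-1 by rewrite invr_gt0 mulr_gt0.
have s0 : s != 0 by rewrite gt_eqF// sqrtr_gt0.
have s2 : s ^+ 2 = (2 * c)^-1 by rewrite sqr_sqrtr// ltW.
have := integral_normal_pdf a s.
have E r : normal_pdf a s r = normal_peak s * expR (- (c * (a - r) ^+ 2)).
  rewrite /normal_pdf (negbTE s0) /normal_fun; congr (_ * expR _).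
  rewrite s2 -mulr_natr; have cn : c != 0 by rewrite gt_eqF.
  by field.
under eq_integral do rewrite E EFinM.
have mg : measurable_fun setT (fun r : R => (expR (- (c * (a - r) ^+ 2)))%:E).
  apply/measurable_EFinP/measurableT_comp => //; apply: measurable_funN.
  apply: measurable_funM => //; apply: measurable_funX; exact: measurable_funB.
rewrite ge0_integralZl//; last by rewrite lee_fin normal_peak_ge0.
have pk : 0 < normal_peak s by exact: normal_peak_gt0.
have pkE : normal_peak s = (Num.sqrt (pi / c))^-1.
  rewrite /normal_peak s2; congr (Num.sqrt _)^-1; rewrite -mulr_natr.
  have cn : c != 0 by rewrite gt_eqF.
  by field.
move=> H; have := congr1 (fun z => ((Num.sqrt (pi / c))%:E * z)%E) H.
rewrite /= muleA -EFinM pkE mulfV ?mul1e ?mule1//.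
by rewrite gt_eqF// sqrtr_gt0 divr_gt0 ?pi_gt0.
Qed.

(** Tonelli and induction on n; indexing the factors by nat lets the induction step shift the
    family. *)
Lemma integral_prod n (g : nat -> R -> R) (I : nat -> R) :
  (forall i, measurable_fun setT (g i : line -> R)) -> (forall i r, 0 <= g i r) ->
  (forall i, \int[L]_r (g i r)%:E = (I i)%:E)%E ->
  (\int[mu R n]_y (\prod_(i < n) g i (nth 0 (tos y) i))%:E = (\prod_(i < n) I i)%:E)%E.
Proof.
elim: n g I => [|n IH] g I mg g0 gI.
  by rewrite [LHS]mu0_integral /= !big_ord0.
have mp k (h : nat -> R -> R) : (forall i, measurable_fun setT (h i : line -> R)) ->
   measurable_fun setT (fun y : X R k => (\prod_(i < k) h i (nth 0 (tos y) i))).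
  move=> mh; apply: measurable_prod => i _.
  exact: (measurableT_comp (mh i) (measurable_nth_tos i)).
have p0 k (h : nat -> R -> R) (y : X R k) : (forall i r, 0 <= h i r) -> 0 <= \prod_(i < k) h i (nth 0 (tos y) i).
  by move=> h0; apply: prodr_ge0.
rewrite [LHS](@fubini_tonelli1 _ _ _ _ _ L (mu R n)); last 2 first.
- by apply/measurable_EFinP; exact: (mp n.+1).
- by move=> y; rewrite lee_fin; exact: (p0 n.+1).
rewrite /fubini_F.
transitivity (\int[L]_r ((g 0%N r)%:E * (\prod_(i < n) I i.+1)%:E))%E.
  apply: eq_integral => r _.
  rewrite -(IH (fun i => g i.+1) (fun i => I i.+1))//.
  rewrite -ge0_integralZl//.
  - by apply: eq_integral => y _; rewrite -EFinM big_ord_recl.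
  - by apply/measurable_EFinP; exact: (mp n (fun i => g i.+1)).
  - by move=> y _; rewrite lee_fin; exact: (p0 n (fun i => g i.+1)).
  - by rewrite lee_fin.
rewrite ge0_integralZr//; last 3 first.
- by apply/measurable_EFinP.
- by move=> r _; rewrite lee_fin.
- rewrite lee_fin; apply: prodr_ge0 => i _; rewrite -lee_fin -gI.
  by apply: integral_ge0 => r _; rewrite lee_fin.
by rewrite gI -EFinM big_ord_recl.
Qed.

Lemma measurable_vec_coord n i : measurable_fun setT (fun y : X R n => vec y ord0 i).
Proof.
rewrite (_ : (fun y => _) = (fun y : X R n => nth 0 (tos y) i)); last first.
  by apply/funext => y; rewrite vecE.
exact: measurable_nth_tos.
Qed.

Lemma measurable_sqnorm d (T : measurableType d) n (v : T -> 'rV[R]_n) :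
  (forall i, measurable_fun setT (fun w => v w ord0 i)) ->
  measurable_fun setT (fun w => sqnorm (v w)).
Proof. by move=> mv; rewrite /sqnorm; apply: measurable_sum => i; exact: measurable_funX. Qed.

Lemma measurable_heat_kernel d (T : measurableType d) n (v : T -> 'rV[R]_n) (t : T -> R) :
  (forall i, measurable_fun setT (fun w => v w ord0 i)) ->
  measurable_fun setT t ->
  measurable_fun setT (fun w => heat_kernel (v w) (t w)).
Proof.
move=> mv mt.
have m4 (c : R) : measurable_fun setT (fun w => c * t w) by exact: measurable_funM.
(* The division becomes a power with exponent -1, for which measurability is a composition; the two
   agree because t > 0 in this branch. *)
rewrite (_ : (fun w => _) = (fun w => if 0 < t w then
   powR (4 * pi * t w) (- (n%:R / 2)) * expR (- (sqnorm (v w) * powR (4 * t w) (-1))) else 0)).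
  apply: measurable_fun_ifT => //; first exact: measurable_fun_ltr.
  apply: measurable_funM; first exact: (measurableT_comp (measurable_powR _) (m4 _)).
  apply: measurableT_comp => //; apply: measurable_funN; apply: measurable_funM.
    exact: measurable_sqnorm.
  exact: (measurableT_comp (measurable_powR _) (m4 _)).
apply/funext => w; rewrite /heat_kernel; case: ifPn => // t0.
by rewrite powR_inv1 ?mulr_ge0// ltW.
Qed.

Lemma integral_gauss n (x : 'rV[R]_n) (c : R) : 0 < c ->
  (\int[mu R n]_y (expR (- (c * sqnorm (x - vec y))))%:E = (Num.sqrt (pi / c) ^+ n)%:E)%E.
Proof.
(* [integral_prod] takes a family indexed by nat, so the coordinates of x are continued by 0. *)
move=> c0; pose x' i := nth 0 [seq x ord0 j | j <- enum 'I_n] i.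
have x'E (i : 'I_n) : x' i = x ord0 i.
  by rewrite /x' (nth_map i) ?size_enum_ord// nth_ord_enum.
transitivity (\int[mu R n]_y (\prod_(i < n) expR (- (c * (x' i - nth 0 (tos y) i) ^+ 2)))%:E)%E.
  apply: eq_integral => y _; congr (_%:E); rewrite -expR_sum; congr expR.
  rewrite /sqnorm mulr_sumr -sumrN; apply: eq_bigr => i _.
  by rewrite !mxE x'E.
rewrite (@integral_prod n (fun i r => expR (- (c * (x' i - r) ^+ 2))) (fun=> Num.sqrt (pi / c))).
- by rewrite prodr_const card_ord.
- move=> i; apply: measurableT_comp => //; apply: measurable_funN.
  apply: measurable_funM => //; apply: measurable_funX; exact: measurable_funB.
- by move=> i r; exact: expR_ge0.
- by move=> i; exact: integral_gauss1.
Qed.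

(** Phi^p is a multiple of a Gaussian, with mass of order t^(-n(p-1)/2). Integrability of this in
    time is the condition n(p-1)/2 < 1, that is p < 1 + 2/n, which recurs below. *)
Lemma integral_heat_kernel_pow n (x : 'rV[R]_n) (t p : R) : 0 < t -> 0 < p ->
  (\int[mu R n]_y (powR (heat_kernel (x - vec y) t) p)%:E =
    (powR p (- (n%:R / 2)) * powR (4 * pi * t) (- (n%:R / 2 * (p - 1))))%:E)%E.
Proof.
move=> t0 p0.
have pt : 0 < 4 * pi * t by rewrite mulr_gt0// mulr_gt0 ?pi_gt0.
have c0 : 0 < p / (4 * t) by rewrite divr_gt0// mulr_gt0.
transitivity (\int[mu R n]_y ((powR (4 * pi * t) (- (n%:R / 2 * p)))%:E *
   (expR (- ((p / (4 * t)) * sqnorm (x - vec y))))%:E))%E.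
  apply: eq_integral => y _; rewrite -EFinM; congr (_%:E).
  rewrite /heat_kernel t0 powRM ?powR_ge0 ?expR_ge0// -powRrM mulNr; congr (_ * _).
  by rewrite -expRM; congr expR; rewrite mulNr; congr (- _); ring.
rewrite ge0_integralZl//; last 2 first.
- apply/measurable_EFinP; apply: measurableT_comp => //; apply: measurable_funN.
  apply: measurable_funM => //; apply: measurable_sqnorm => i.
  rewrite (_ : (fun y => _) = (fun y : X R n => x ord0 i - vec y ord0 i)); last by apply/funext => y; rewrite !mxE.
  by apply: measurable_funB => //; exact: measurable_vec_coord.
- by rewrite lee_fin powR_ge0.
rewrite integral_gauss// -EFinM; congr (_%:E).
rewrite (_ : pi / (p / (4 * t)) = (4 * pi * t) * p^-1); last first.
  have pn : p != 0 by rewrite gt_eqF.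
  have tn : t != 0 by rewrite gt_eqF.
  by field; rewrite pn tn.
rewrite -powR12_sqrt ?mulr_ge0 ?invr_ge0 ?pi_ge0 ?(ltW t0) ?(ltW p0)//.
rewrite -powR_mulrn ?powR_ge0// -powRrM mulrC powRM ?invr_ge0 ?(ltW pt) ?(ltW p0)//.
rewrite powRV ?(ltW p0)// -powRN.
rewrite mulrAC -powRD; last by rewrite (gt_eqF pt) implybT.
rewrite mulrC [2^-1 * _]mulrC; congr (_ * powR _ _); ring.
Qed.

End gaussian.

(** * Pointwise, integral and lower bounds for the heat kernel *)

Section heat_bounds.
Variables (R : realType) (n : nat).
Hypothesis n_gt0 : (0 < n)%N.
Local Notation L := (@lebesgue_measure R).
Local Notation line := (measurableTypeR R).
Implicit Types (v x : 'rV[R]_n) (t w : R).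

Lemma heat_kernel_ge0 v t : 0 <= heat_kernel v t.
Proof. by rewrite /heat_kernel; case: ifP => // _; rewrite mulr_ge0 ?powR_ge0 ?expR_ge0. Qed.

Lemma heat_kernelN v t : heat_kernel (- v) t = heat_kernel v t.
Proof. by rewrite /heat_kernel sqnormN. Qed.

Lemma pi4_ge1 : 1 <= 4 * pi :> R.
Proof. by have := pi_ge2 R; lra. Qed.

Let hn_gt0 : 0 < n%:R / 2 :> R.
Proof. by rewrite divr_gt0// ltr0n. Qed.

Lemma heat_kernel_le_exp v t w : 0 < t -> w <= sqnorm v ->
  heat_kernel v t <= powR t (- (n%:R / 2)) * expR (- (w / (4 * t))).
Proof.
move=> t0 wv; rewrite /heat_kernel t0 ler_pM ?powR_ge0 ?expR_ge0//.
  by apply: (powR_le_neg (ltW hn_gt0) t0); rewrite ler_peMl ?pi4_ge1// ltW.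
by rewrite ler_expR lerN2 ler_pM2r// invr_gt0 mulr_gt0.
Qed.

(** Here w is a squared parabolic length. If t >= w the prefactor alone suffices; if |v|^2 >= w,
    [exp_pow_bound] with m = n/2 removes t. *)
Lemma heat_kernel_bound : exists K : R, 0 < K /\ forall v t w, 0 < w ->
  w <= t \/ w <= sqnorm v -> heat_kernel v t <= K * powR w (- (n%:R / 2)).
Proof.
pose K : R := 1 + powR (4 * (n%:R / 2)) (n%:R / 2).
have K1 : 1 <= K by rewrite lerDl powR_ge0.
exists K; split=> [|v t w w0]; first by rewrite (lt_le_trans _ K1).
have [t0|t0] := leP t 0.
  by move=> _; rewrite /heat_kernel ltNge t0/= mulr_ge0 ?powR_ge0// (le_trans _ K1).
move=> [wt|wv].
  apply: (le_trans (heat_kernel_le_exp t0 (sqnorm_ge0 v))).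
  rewrite mul0r oppr0 expR0 mulr1 -[leLHS]mul1r ler_pM ?powR_ge0//.
  exact: (powR_le_neg (ltW hn_gt0) w0).
apply: (le_trans (heat_kernel_le_exp t0 wv)).
apply: (le_trans (exp_pow_bound hn_gt0 w0 t0)).
by rewrite ler_wpM2r ?powR_ge0// lerDr.
Qed.

(** The same with m = n/2 + 1. The quotient by t is the size of the gradient term produced when the
    kernel is multiplied by a cutoff. *)
Lemma heat_kernel_div_bound : exists K : R, 0 < K /\ forall v t w, 0 < w -> 0 < t ->
  w <= sqnorm v -> heat_kernel v t / t <= K * powR w (- (n%:R / 2 + 1)).
Proof.
have m0 : 0 < n%:R / 2 + 1 :> R by rewrite addr_gt0.
exists (powR (4 * (n%:R / 2 + 1)) (n%:R / 2 + 1)).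
split=> [|v t w w0 t0 wv]; first by rewrite powR_gt0// mulr_gt0.
apply: le_trans (exp_pow_bound m0 w0 t0).
rewrite opprD powRD; last by rewrite (gt_eqF t0) implybT.
rewrite powR_inv1 ?(ltW t0)// mulrAC ler_wpM2r ?invr_ge0 ?(ltW t0)//.
exact: heat_kernel_le_exp.
Qed.

(** The integral of Phi^p over R^n x (0, 1), when n(p-1)/2 < 1. *)
Definition heat_const (p : R) : R := powR p (- (n%:R / 2)) *
  powR (4 * pi) (- (n%:R / 2 * (p - 1))) / (1 - n%:R / 2 * (p - 1)).

Lemma heat_const_ge0 (p : R) : n%:R / 2 * (p - 1) < 1 -> 0 <= heat_const p.
Proof. by move=> h; rewrite /heat_const divr_ge0 ?mulr_ge0 ?powR_ge0// subr_ge0 ltW. Qed.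

Lemma measurable_vec_sub x i : measurable_fun setT (fun y : X R n => (x - vec y) ord0 i).
Proof.
rewrite (_ : (fun y => _) = (fun y : X R n => x ord0 i - vec y ord0 i)); last by apply/funext => y; rewrite !mxE.
by apply: measurable_funB => //; exact: measurable_vec_coord.
Qed.

Lemma measurable_heat_left x t :
  measurable_fun setT (fun q : line * X R n => heat_kernel (x - vec q.2) (t - (q.1 : R))).
Proof.
apply: measurable_heat_kernel => [i|].
  exact: (measurableT_comp (measurable_vec_sub x i) measurable_snd).
by apply: measurable_funB => //; exact: measurable_fst.
Qed.

Lemma measurable_heat_right x t :
  measurable_fun setT (fun q : line * X R n => heat_kernel (vec q.2 - x) ((q.1 : R) - t)).
Proof.
rewrite (_ : (fun q => _) = (fun q : line * X R n => heat_kernel (x - vec q.2) ((q.1 : R) - t))); last first.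
  by apply/funext => q; rewrite -heat_kernelN opprB.
apply: measurable_heat_kernel => [i|].
  exact: (measurableT_comp (measurable_vec_sub x i) measurable_snd).
by apply: measurable_funB => //; exact: measurable_fst.
Qed.

Lemma measurable_if_time_oo (a b : R) (g : line * X R n -> R) :
  measurable_fun setT g ->
  measurable_fun setT (fun p : line * X R n => if a < (p.1 : R) < b then g p else 0).
Proof.
move=> mg; apply: measurable_fun_ifT => //.
by apply: measurable_and; apply: measurable_fun_ltr => //; exact: measurable_fst.
Qed.

(** [k s] is the time between s and the end of (a, t) at which the kernel is singular; both ends
    occur, since kernels issued from x and kernels arriving at y are integrated. *)
Let integral_heat_aux (g : line * X R n -> R) (k : R -> R) (p a t : R) :
  0 < p -> n%:R / 2 * (p - 1) < 1 -> a < t ->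
  measurable_fun setT g -> (forall q, 0 <= g q) ->
  (forall s, a < s < t -> 0 < k s) ->
  (forall s, a < s < t -> (\int[mu R n]_y (g (s, y))%:E =
    (powR p (- (n%:R / 2)) * powR (4 * pi * k s) (- (n%:R / 2 * (p - 1))))%:E)%E) ->
  measurable_fun setT k ->
  (\int[L]_s (if (a < (s : R) < t)%R then powR (k s) (- (n%:R / 2 * (p - 1))) else 0)%:E
    <= (powR (t - a) (1 - n%:R / 2 * (p - 1)) / (1 - n%:R / 2 * (p - 1)))%:E)%E ->
  (\int[nu R n]_q (if (a < q.1 < t)%R then g q else 0)%:E <=
    (heat_const p * powR (t - a) (1 - n%:R / 2 * (p - 1)))%:E)%E.
Proof.
move=> p0 th1 ta mg g0 k0 gk mk ik.
rewrite [leLHS](@fubini_tonelli1 _ _ _ _ _ L (mu R n)); last 2 first.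
- by apply/measurable_EFinP; exact: measurable_if_time_oo.
- by move=> q; rewrite lee_fin; case: ifP.
rewrite /fubini_F/=.
set th := n%:R / 2 * (p - 1) in th1 gk ik *.
pose C := powR p (- (n%:R / 2)) * powR (4 * pi) (- th).
have C0 : 0 <= C by rewrite mulr_ge0 ?powR_ge0.
rewrite [leLHS](_ : _ = \int[L]_s (C%:E * (if (a < (s : R) < t)%R then powR (k s) (- th) else 0)%:E))%E; last first.
  apply: eq_integral => s _; rewrite -EFinM.
  have [sat|sat] := boolP (a < (s : R) < t); last by rewrite mulr0 integral0.
  rewrite gk// powRM ?mulr_ge0 ?pi_ge0 ?(ltW (k0 _ _))//.
  by rewrite mulrA.
rewrite ge0_integralZl//; last 2 first.
- apply/measurable_EFinP; apply: measurable_fun_ifT => //.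
    by apply: measurable_and; apply: measurable_fun_ltr.
  exact: (measurableT_comp (measurable_powR _) mk).
- by move=> s _; rewrite lee_fin; case: ifP => // _; exact: powR_ge0.
apply: (@le_trans _ _ (C%:E * (powR (t - a) (1 - th) / (1 - th))%:E)%E).
  by rewrite lee_wpmul2l// lee_fin.
by rewrite -EFinM lee_fin /heat_const -/th /C mulrA mulrAC.
Qed.

Lemma integral_heat_left x t (p a : R) : 0 < p -> n%:R / 2 * (p - 1) < 1 -> a < t ->
  (\int[nu R n]_q (if (a < q.1 < t)%R then
       powR (heat_kernel (x - vec q.2) (t - q.1)) p else 0)%:E <=
    (heat_const p * powR (t - a) (1 - n%:R / 2 * (p - 1)))%:E)%E.
Proof.
move=> p0 th1 ta; apply: (integral_heat_aux (k := fun s => t - s)) => //.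
- exact: (measurableT_comp (measurable_powR _) (measurable_heat_left _ _)).
- by move=> q; exact: powR_ge0.
- by move=> s /andP[_ st]; rewrite subr_gt0.
- by move=> s /andP[_ st]; rewrite -(integral_heat_kernel_pow x) ?subr_gt0//.
- by apply: measurable_funB.
- exact: integral_powR_left.
Qed.

Lemma integral_heat_right x t (p a : R) : 0 < p -> n%:R / 2 * (p - 1) < 1 -> a < t ->
  (\int[nu R n]_q (if (a < q.1 < t)%R then
       powR (heat_kernel (vec q.2 - x) (q.1 - a)) p else 0)%:E <=
    (heat_const p * powR (t - a) (1 - n%:R / 2 * (p - 1)))%:E)%E.
Proof.
move=> p0 th1 ta; apply: (integral_heat_aux (k := fun s => s - a)) => //.
- exact: (measurableT_comp (measurable_powR _) (measurable_heat_right _ _)).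
- by move=> q; exact: powR_ge0.
- by move=> s /andP[st _]; rewrite subr_gt0.
- move=> s /andP[st _].
  have st0 : 0 < s - a by rewrite subr_gt0.
  rewrite -(integral_heat_kernel_pow x st0 p0).
  by apply: eq_integral => y _ /=; rewrite -heat_kernelN opprB.
- by apply: measurable_funB.
- exact: integral_powR_right.
Qed.

(* Replaces the convergence of Phi to the Dirac mass: only a lower bound on
   the pairing of Phi with u at time t - eta is needed. *)
Lemma heat_box_lower : exists c : R, 0 < c /\
  forall x (eta m : R) (f : X R n -> R), 0 < eta -> 0 <= m ->
  measurable_fun setT f -> (forall y, 0 <= f y) ->
  (forall y, [forall i, `|x ord0 i - vec y ord0 i| <= Num.sqrt eta] ->
     m * heat_kernel (x - vec y) eta <= f y) ->
  ((c * m)%:E <= \int[mu R n]_y (f y)%:E)%E.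
Proof.
(* On the cube of half side sqrt(eta), |x - y|^2 <= n eta gives Phi >= (4 pi eta)^(-n/2) e^(-n/4);
   the volume (2 sqrt(eta))^n cancels the powers of eta. *)
pose c : R := powR (4 * pi) (- (n%:R / 2)) * expR (- (n%:R / 4)) * 2 ^+ n.
exists c; split=> [|x eta m f eta0 m0 mf f0 mfl].
  by rewrite mulr_gt0 ?exprn_gt0// mulr_gt0 ?expR_gt0// powR_gt0// mulr_gt0 ?pi_gt0.
pose x' i := nth 0 [seq x ord0 j | j <- enum 'I_n] i.
have x'E (i : 'I_n) : x' i = x ord0 i.
  by rewrite /x' (nth_map i) ?size_enum_ord// nth_ord_enum.
pose g i (r : R) : R := \1_(`[x' i - Num.sqrt eta, x' i + Num.sqrt eta]%classic) r.
have mg i : measurable_fun setT (g i : line -> R) by exact: measurable_indic.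
have g0 i r : 0 <= g i r by [].
have gI i : (\int[L]_r (g i r)%:E = (2 * Num.sqrt eta)%:E)%E.
  rewrite integral_indic// setIT.
  suff : (L `[(x' i - Num.sqrt eta)%R, (x' i + Num.sqrt eta)%R] = (2 * Num.sqrt eta)%:E)%E by [].
  rewrite lebesgue_measure_itv/= lte_fin.
  rewrite ifT; last by rewrite ltrD2l gt0_cp// sqrtr_gt0.
  by rewrite -EFinB; congr (_%:E); ring.
pose k := m * (powR (4 * pi * eta) (- (n%:R / 2)) * expR (- (n%:R / 4))).
have k0 : 0 <= k by rewrite mulr_ge0// mulr_ge0 ?powR_ge0 ?expR_ge0.
have -> : ((c * m)%:E = k%:E * (\prod_(i < n) (2 * Num.sqrt eta))%:E)%E.
  rewrite -EFinM; congr (_%:E); rewrite prodr_const card_ord exprMn /c /k.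
  have p40 : 0 <= 4 * pi :> R by rewrite mulr_ge0// pi_ge0.
  rewrite (powRM _ p40 (ltW eta0)).
  have se : powR eta (- (n%:R / 2)) * Num.sqrt eta ^+ n = 1.
    rewrite -powR12_sqrt ?(ltW eta0)// -powR_mulrn ?powR_ge0// -powRrM [2^-1 * _]mulrC powRN mulVf//.
    by rewrite gt_eqF// powR_gt0.
  move: (powR (4 * pi) _) (powR eta _) (expR _) (2 ^+ n) (Num.sqrt eta ^+ n) se => A P E T S se.
  have -> : m * (A * P * E) * (T * S) = A * E * T * m * (P * S) by ring.
  by rewrite se mulr1.
have mpr : measurable_fun setT (fun y : X R n => \prod_(i < n) g i (nth 0 (tos y) i)).
  apply: measurable_prod => i _.
  exact: (measurableT_comp (mg i) (measurable_nth_tos i)).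
rewrite -(integral_prod n mg g0 gI) -ge0_integralZl//; last 2 first.
- exact/measurable_EFinP.
- by move=> y _; rewrite lee_fin prodr_ge0.
have pE (y : X R n) : \prod_(i < n) g i (nth 0 (tos y) i) =
   if [forall i, `|x ord0 i - vec y ord0 i| <= Num.sqrt eta] then 1 else 0.
  have ginE (i : 'I_n) : (nth 0 (tos y) i \in `[x' i - Num.sqrt eta, x' i + Num.sqrt eta]%classic) =
      (`|x ord0 i - vec y ord0 i| <= Num.sqrt eta).
    rewrite mem_setE in_itv/= x'E vecE distrC ler_distl.
    by [].
  case: ifPn => [/forallP H|].
    by rewrite big1// => i _; rewrite /g indicE ginE H.
  rewrite negb_forall => /existsP[i Hi]; rewrite (bigD1 i)//= /g indicE ginE (negbTE Hi).
  by rewrite mul0r.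
apply: ge0_le_integral => //.
- by move=> y _; rewrite -EFinM lee_fin mulr_ge0// prodr_ge0.
- by under eq_fun do rewrite -EFinM; apply/measurable_EFinP; exact: measurable_funM.
- exact/measurable_EFinP.
- move=> y _; rewrite -EFinM lee_fin pE; case: ifPn => [yb|_]; last by rewrite mulr0.
  apply: le_trans (mfl _ yb); move/forallP : yb => H.
  rewrite mulr1 /k /heat_kernel eta0 ler_wpM2l// ler_wpM2l ?powR_ge0// ler_expR lerN2.
  rewrite ler_pdivrMr ?mulr_gt0// (_ : n%:R / 4 * (4 * eta) = \sum_(i < n) eta); last first.
    by rewrite sumr_const card_ord -mulr_natr; field.
  apply: ler_sum => i _; rewrite !mxE -real_normK ?num_real//.
  by rewrite -[leRHS](sqr_sqrtr (ltW eta0)) ler_pXn2r ?nnegrE// -vecE; exact: H.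
Qed.

End heat_bounds.

(** [f] may change sign and need not be integrable: its integral is at most that of its positive
    part, which lies below [g]. The integrands of the test identity are of this kind. *)
Lemma integral_le_ge0 (R : realType) d (T : measurableType d)
    (m : {measure set T -> \bar R}) (f g : T -> \bar R) :
  measurable_fun setT f -> measurable_fun setT g ->
  (forall x, 0 <= g x)%E -> (forall x, f x <= g x)%E ->
  (\int[m]_x f x <= \int[m]_x g x)%E.
Proof.
move=> mf mg g0 fg; rewrite integralE.
have h1 : (\int[m]_x f^\+ x <= \int[m]_x g x)%E.
  apply: ge0_le_integral => //; first exact: measurable_funepos.
  by move=> x _; rewrite funeposE ge_max fg g0.
apply: le_trans h1; rewrite -[leRHS]sube0; apply: leeB => //.
exact: integral_ge0.
Qed.

Lemma heat_jet_sub (R : realType) n (a b a' b' : R) (f ft : 'rV[R]_n * R -> R) f1 f2 :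
  a <= a' -> b' <= b -> heat_jet a b f ft f1 f2 -> heat_jet a' b' f ft f1 f2.
Proof.
move=> aa bb jf z /andP[z1 z2]; apply: jf.
by rewrite (le_lt_trans aa z1) (lt_le_trans z2 bb).
Qed.

(** * The error caused by the cutoff *)

Section error_term.
Variables (R : realType) (n : nat).
Hypothesis n_gt0 : (0 < n)%N.
Implicit Types (x y : 'rV[R]_n).

(** From |y|^2 <= (19/18) |x|^2 + 19 |x - y|^2 one gets 10 <= 19/2 + 19 |x - y|^2, whence 1/38. *)
Lemma sqnorm_far x y : sqnorm x <= 9 -> 10 <= sqnorm y -> 38^-1 <= sqnorm (x - y).
Proof.
move=> x9 y10.
have : sqnorm y <= \sum_(i < n) (19 / 18 * x ord0 i ^+ 2 + 19 * (x - y) ord0 i ^+ 2).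
  apply: ler_sum => i _; rewrite !mxE.
  move: (x ord0 i) (y ord0 i) => a b.
  by have := sqr_ge0 (a - 18 * (b - a)); nra.
rewrite big_split/= -!mulr_sumr -/(sqnorm x) -/(sqnorm (x - y)).
move: (sqnorm x) (sqnorm y) (sqnorm (x - y)) x9 y10 => a b c a9 b10 H.
by lra.
Qed.

(** Each term is at most x_i^2 + (3/2) y_i^2 in absolute value, and 9 + (3/2) 12 = 27. *)
Lemma dot_bound x y : sqnorm x <= 9 -> sqnorm y <= 12 ->
  `|\sum_(i < n) (x ord0 i - y ord0 i) * y ord0 i| <= 27.
Proof.
move=> x9 y12; rewrite (le_trans (ler_norm_sum _ _ _))//.
apply: (@le_trans _ _ (\sum_(i < n) (x ord0 i ^+ 2 + (3 / 2) * y ord0 i ^+ 2))); last first.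
  by rewrite big_split/= -mulr_sumr -/(sqnorm x) -/(sqnorm y); lra.
apply: ler_sum => i _; rewrite ler_norml.
move: (x ord0 i) (y ord0 i) => a b.
have h1 := sqr_ge0 (a + b); have h2 := sqr_ge0 (a - b); have h3 := sqr_ge0 a; have h4 := sqr_ge0 b.
by apply/andP; split; nra.
Qed.

(** The left-hand side is what the backward heat operator leaves of kernel times cutoff. It lives on
    10 <= |y|^2 <= 12, at positive distance from x, where Phi and Phi / t are bounded uniformly in
    t. *)
Lemma cutoff_error (h1 h2 : R -> R) : continuous h1 -> continuous h2 ->
  (forall q, q <= 10 \/ 12 <= q -> h1 q = 0 /\ h2 q = 0) ->
  exists C : R, 0 <= C /\ forall x y t, sqnorm x <= 9 -> 0 < t ->
   heat_kernel (x - y) t * (2 / t * h1 (sqnorm y) * (\sum_(i < n) (x ord0 i - y ord0 i) * y ord0 i)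
      + 2 * n%:R * h1 (sqnorm y) + 4 * sqnorm y * h2 (sqnorm y)) <=
   C * (if sqnorm y <= 12 then 1 else 0).
Proof.
move=> ch1 ch2 hz.
have bd (k : R -> R) : continuous k -> exists H : R, 0 <= H /\ forall q, 10 <= q <= 12 -> `|k q| <= H.
  move=> ck.
  have [C [_ HC]] : bounded_set (k @` `[10, 12]).
    apply: compact_bounded; apply: continuous_compact; last exact: segment_compact.
    by apply: continuous_subspaceT.
  exists (`|C| + 1); split; first by rewrite addr_ge0.
  move=> q q1012; apply: HC; first by rewrite (le_lt_trans (ler_norm C))// ltrDl.
  by exists q => //=; rewrite in_itv.
have [H1 [H10 H1b]] := bd _ ch1; have [H2 [H20 H2b]] := bd _ ch2.
have [K1 [K10 K1b]] := @heat_kernel_bound R n n_gt0.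
have [K2 [K20 K2b]] := @heat_kernel_div_bound R n n_gt0.
pose k1 := K1 * powR 38^-1 (- (n%:R / 2)).
pose k2 := K2 * powR 38^-1 (- (n%:R / 2 + 1)).
have k10 : 0 <= k1 by rewrite mulr_ge0 ?powR_ge0 ?ltW.
have k20 : 0 <= k2 by rewrite mulr_ge0 ?powR_ge0 ?ltW.
pose C := k2 * (2 * H1 * 27) + k1 * (2 * n%:R * H1 + 4 * 12 * H2).
have C0 : 0 <= C by do ![apply: addr_ge0 | apply: mulr_ge0 | exact: ler0n | exact: ltW | by []].
exists C; split => // x y t x9 t0.
have [y10|y10] := leP (sqnorm y) 10.
  have [-> ->] := hz (sqnorm y) (or_introl y10).
  by rewrite !(mulr0, mul0r, addr0); case: ifP; rewrite ?mulr1 ?mulr0.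
have [y12|y12] := leP 12 (sqnorm y).
  have [-> ->] := hz (sqnorm y) (or_intror y12).
  by rewrite !(mulr0, mul0r, addr0); case: ifP; rewrite ?mulr1 ?mulr0.
rewrite (ltW y12) mulr1.
have far := sqnorm_far x9 (ltW y10).
have w0 : 0 < 38^-1 :> R by rewrite invr_gt0.
have b1 := K1b (x - y) t _ w0 (or_intror far).
have b2 := K2b (x - y) t _ w0 t0 far.
have d27 := dot_bound x9 (ltW y12).
have q1012 : 10 <= sqnorm y <= 12 by rewrite !ltW.
have a1 := H1b _ q1012; have a2 := H2b _ q1012.
set S := \sum_(i < n) _ in d27 *; set K := heat_kernel _ _ in b1 b2 *.
have K0 : 0 <= K by exact: heat_kernel_ge0.
set q := sqnorm y in a1 a2 y10 y12 *.
rewrite (_ : _ * _ = (K / t) * (2 * h1 q * S) + K * (2 * n%:R * h1 q + 4 * q * h2 q)); last first.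
  have tn : t != 0 by rewrite gt_eqF.
  by field.
have Kt0 : 0 <= K / t by rewrite divr_ge0// ltW.
apply: lerD.
  apply: (@le_trans _ _ ((K / t) * (2 * H1 * 27))).
    rewrite ler_wpM2l// (le_trans (ler_norm _))// !normrM ger0_norm// ler_pM// ?mulr_ge0//.
    by rewrite ler_wpM2l.
  by rewrite ler_wpM2r// !mulr_ge0.
apply: (@le_trans _ _ (K * (2 * n%:R * H1 + 4 * 12 * H2))).
  rewrite ler_wpM2l// lerD//.
    by rewrite ler_wpM2l ?mulr_ge0// (le_trans (ler_norm _)).
  rewrite (le_trans (ler_norm _))// !normrM ler_pM ?mulr_ge0//.
  rewrite ler_pM// ?ger0_norm//; last by apply: le_trans (ltW y10).
  exact: ltW.
by rewrite ler_wpM2r// addr_ge0// !mulr_ge0.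
Qed.

End error_term.

(** * The representation inequality *)

Section representation.
Variables (R : realType) (n : nat).
Hypothesis n_gt0 : (0 < n)%N.
Local Notation L := (@lebesgue_measure R).
Local Notation line := (measurableTypeR R).
Local Notation V := ('rV[R]_n * R)%type.
Variable u : 'rV[R]_n -> R -> R.
Let U (z : V) := u z.1 z.2.
Hypothesis u_ge0 : forall x t, 0 < t < 16 -> 0 <= u x t.
Hypothesis u_C21 : C21_on [set z | 0 < z.2 < 16] U.
Hypothesis heat_ge0 : forall x t, enorm x < 4 -> 0 < t < 16 -> 0 <= heat_op u (x, t).

Definition uin (s : R) (y : X R n) : R := if sqnorm (vec y) <= 12 then ubar u (s, y) else 0.
Definition fin_from (t0 : R) (q : line * X R n) : R := if t0 <= (q.1 : R) <= 8 then fbar u q else 0.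

Lemma measurable_uin2 : measurable_fun setT (fun q : line * X R n => uin q.1 q.2).
Proof.
have := measurable_if_sqnorm 12 (measurable_ubar u_C21).
by rewrite (_ : (fun q => _) = (fun q : line * X R n => uin q.1 q.2))//; apply/funext => -[].
Qed.

Lemma measurable_uin s : measurable_fun setT (uin s).
Proof. exact: (measurableT_comp measurable_uin2 (pair1_measurable (s : line))). Qed.

Lemma measurable_fin_from t0 : measurable_fun setT (fin_from t0).
Proof. by apply: measurable_if_time; exact: measurable_fbar. Qed.

Lemma uin_ge0 s y : 0 <= uin s y.
Proof. by rewrite /uin; case: ifP => // _; exact: ubar_ge0. Qed.

Lemma fin_from_ge0 t0 q : 0 <= fin_from t0 q.
Proof. by rewrite /fin_from; case: ifP => // _; exact: fbar_ge0. Qed.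

(** Green's identity is stopped at time t - eta, before the pole of the kernel. By continuity u >=
    u(x,t)/2 on a cube of half side sqrt(eta) at that time, so the final slice is at least c
    u(x,t)/2, with c independent of eta. *)
Lemma representation : exists CR : R, 0 < CR /\ forall (x : 'rV[R]_n) (t t0 : R),
  sqnorm x <= 9 -> 0 < t0 -> t0 < t -> t <= 1 ->
  ((u x t)%:E <= CR%:E * (1 +
     \int[mu R n]_y (heat_kernel (x - vec y) (t - t0) * uin t0 y)%:E +
     \int[nu R n]_q (heat_kernel (x - vec q.2) (t - q.1) * fin_from t0 q)%:E))%E.
Proof.
have [h [h1 [h2 [dh dh1 ch2 h01 [hlo hhi]]]]] := cutoff_exists R.
have ch1 : continuous h1.
  by move=> q; apply/differentiable_continuous/derivable1_diffP; have [] := dh1 q.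
have hz q : q <= 10 \/ 12 <= q -> h1 q = 0 /\ h2 q = 0.
  by move=> [/hlo[]|/hhi[]].
have [CE [CE0 HCE]] := cutoff_error n_gt0 ch1 ch2 hz.
have [c [c0 Hc]] := heat_box_lower R n.
have [CA [CA0 [HA _]]] := mass_bound u_ge0 u_C21 heat_ge0.
(* The factor 2 / c undoes the lower bound c u(x,t)/2, and CE CA is the cutoff error integrated over
   a time of length at most 1. *)
pose CR := 2 / c * (1 + CE * CA).
have CEA : 0 <= CE * CA by rewrite mulr_ge0.
have CR0 : 0 < CR by rewrite mulr_gt0 ?divr_gt0// ltr_wpDr.
exists CR; split => // x t t0 x9 t00 t0t t1.
set A := (\int[mu R n]_y _)%E; set B := (\int[nu R n]_q _)%E.
have A0 : (0 <= A)%E.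
  by apply: integral_ge0 => y _; rewrite lee_fin mulr_ge0 ?heat_kernel_ge0 ?uin_ge0.
have B0 : (0 <= B)%E.
  by apply: integral_ge0 => y _; rewrite lee_fin mulr_ge0 ?heat_kernel_ge0 ?fin_from_ge0.
have t16 : 0 < t < 16 by rewrite (lt_trans t00 t0t) (le_lt_trans t1)//; lra.
have [ux0|ux0] := leP (u x t) 0.
  apply: (@le_trans _ _ 0%E); first by rewrite lee_fin.
  apply: mule_ge0; first by rewrite lee_fin ltW.
  by apply: adde_ge0 => //; apply: adde_ge0.
have [eta [eta0 etat Hbox]] : exists eta : R, [/\ 0 < eta, t0 < t - eta &
    forall y : 'rV[R]_n, [forall i, `|x ord0 i - y ord0 i| <= Num.sqrt eta] ->
      sqnorm y <= 10 /\ u x t / 2 <= u y (t - eta)].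
  have n1 : \forall z \near (x, t), u x t / 2 < U z.
    have cU := @continuous_U _ _ _ u_C21 (x, t) t16.
    by apply: (cvgr_gt (u x t) cU); lra.
  have n2 : \forall z \near (x, t), sqnorm z.1 < 10.
    by apply: (cvgr_lt (sqnorm x) (@continuous_sqnorm R n (x, t))); lra.
  have [e /= e0 He] := (nbhs_ballP _ _).1 (filterI n1 n2).
  (* With eta = r^2 the displacement in space is at most r <= e/2 and the one in time is r^2 <= r/2,
     smaller than both e and t - t0. *)
  pose r := Num.min (e / 2) (Num.min (1 / 2) ((t - t0) / 2)).
  have r0 : 0 < r by rewrite !lt_min; apply/and3P; split; lra.
  have [re [r1 rt]] : r <= e / 2 /\ r <= 1 / 2 /\ r <= (t - t0) / 2.
    by rewrite /r !ge_min !lexx/= !orbT.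
  have rr : r ^+ 2 <= r / 2 by rewrite expr2 ler_wpM2l ?(ltW r0)//; lra.
  exists (r ^+ 2); split; first by rewrite exprn_gt0.
    by lra.
  move=> y; rewrite sqrtr_sqr ger0_norm ?(ltW r0)// => /forallP yb.
  have [|h1' h2'] := He (y, t - r ^+ 2).
    split=> /=.
      split => // i j; rewrite (ord1 i) /ball/=.
      by rewrite (le_lt_trans (yb j))//; lra.
    rewrite /ball /= opprB addrC subrK ger0_norm ?sqr_ge0//; lra.
  by split; apply: ltW.
pose s1 := t - eta.
have s1t : s1 < t by rewrite /s1; lra.
pose K z := expR (logheat x t z).
pose psi z := K z * h (sqnorm z.1).
have KE (z : V) : z.2 < t -> K z = heat_kernel (x - z.1) (t - z.2).
  by move=> zt; rewrite heat_kernelE.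
have jpsi := heat_jetM (heat_jet_exp (@heat_jet_logheat R n 0 t x t (lexx t)))
  (@heat_jet_radial R n 0 t _ _ _ dh dh1 ch2).
have jU := heat_jet_sub (lexx 0) (ltW (andP t16).2) (heat_jet_U u_C21).
have := @test_identity R n 0 t _ _ U _ _ _ _ _ jpsi jU _ t0 s1 t00 etat s1t.
have := @test_integrand_boxed R n 0 t _ _ U _ _ _ _ _ jpsi jU _ t0 s1 t00 s1t.
set T' := (fun z => _).
(* The kernel solves the backward heat equation, so only terms with a derivative of the cutoff
   accompany U. *)
have hE z : 0 < z.2 < t -> T' z = psi z * heat_op u z + U z * (K z *
    (2 / (t - z.2) * h1 (sqnorm z.1) * (\sum_(i < n) (x ord0 i - z.1 ord0 i) * z.1 ord0 i)
      + 2 * n%:R * h1 (sqnorm z.1) + 4 * sqnorm z.1 * h2 (sqnorm z.1))).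
  move=> /andP[_ zt]; rewrite /T' /psi; congr (_ * _ + _ * _).
  have tz : t - z.2 != 0 by rewrite gt_eqF// subr_gt0.
  rewrite -/(K z); set q := sqnorm z.1; set k := K z; set S := \sum_(i < n) _ * _.
  rewrite (eq_bigr (fun i => k * h q * ((2 * (t - z.2)) ^- 2) * (x - z.1) ord0 i ^+ 2
     + (2 * k * h1 q / (t - z.2)) * ((x ord0 i - z.1 ord0 i) * z.1 ord0 i)
     + (4 * k * h2 q) * z.1 ord0 i ^+ 2 + k * (2 * h1 q - h q * (2 * (t - z.2))^-1))); last first.
    by move=> i _; rewrite !mxE -/k -/q; field.
  rewrite !big_split/= -!mulr_sumr -/S sumr_const card_ord -[_ *+ n]mulr_natr.
  rewrite -/(sqnorm z.1) -/(sqnorm (x - z.1)) -/q; set w := sqnorm (x - z.1).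
  by field.
move=> bT iT.
have {}bT : boxed (slab t0 s1 T' : X R n.+1 -> R).
  apply: bT => z z0t z16; have [|e0 e1 e2] := hhi (sqnorm z.1); first by lra.
  by split; [| |move=> i|move=> i]; rewrite ?e0 ?e1 ?e2; ring.
have {}iT : (\int[mu R n]_y (psi (vec y, s1) * U (vec y, s1))%:E =
    \int[mu R n]_y (psi (vec y, t0) * U (vec y, t0))%:E + \int[nu R n]_q (slab t0 s1 T' q)%:E)%E.
  rewrite iT// => z z0t z16; have [|e0 e1 e2] := hhi (sqnorm z.1); first by lra.
  by split; [| |move=> i|move=> i]; rewrite ?e0 ?e1 ?e2; ring.
have s1_16 : 0 < s1 < 16 by rewrite (lt_trans t00 etat) (lt_trans s1t (andP t16).2).
have t0_16 : 0 < t0 < 16 by rewrite t00 (lt_trans t0t (andP t16).2).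
have psi_ge0 z : 0 <= psi z by rewrite mulr_ge0 ?expR_ge0//; case/andP: (h01 (sqnorm z.1)).
have mslice s : 0 < s < t -> measurable_fun setT (fun y : X R n => psi (vec y, s) * U (vec y, s)).
  move=> s0t; apply: (slice_boxed (g := fun z => psi z * U z) s0t _ _).1 => z z0t.
    by have [cp _ _ _] := jpsi _ z0t; have [cU _ _ _] := jU _ z0t; exact: cvgM.
  by move=> z16; have [|e0 _ _] := hhi (sqnorm z.1); [lra|rewrite /psi e0 mulr0 mul0r].
have lower : ((c * (u x t / 2))%:E <= \int[mu R n]_y (psi (vec y, s1) * U (vec y, s1))%:E)%E.
  apply: (Hc x eta) => //.
  - by rewrite divr_ge0// ltW.
  - by apply: mslice; rewrite s1t (lt_trans t00 etat).
  - by move=> y; rewrite mulr_ge0 ?u_ge0.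
  - move=> y yb; have [y10 yu] := Hbox _ yb.
    rewrite /psi KE// /=; have [-> _ _] := hlo _ y10.
    rewrite mulr1 (_ : t - s1 = eta); last by rewrite /s1; ring.
    by rewrite mulrC ler_wpM2l ?heat_kernel_ge0.
have upperA : (\int[mu R n]_y (psi (vec y, t0) * U (vec y, t0))%:E <= A)%E.
  apply: integral_le_ge0.
  - by apply/measurable_EFinP; apply: mslice; rewrite t00.
  - apply/measurable_EFinP; apply: measurable_funM; last exact: measurable_uin.
    by apply: measurable_heat_kernel => // i; exact: measurable_vec_sub.
  - by move=> y; rewrite lee_fin mulr_ge0 ?heat_kernel_ge0 ?uin_ge0.
  - move=> y; rewrite lee_fin /psi KE//= /uin /ubar /tcut/= t0_16.
    case: ifPn => [y12|]; last first.
      by rewrite -ltNge => /ltW /hhi[-> _ _]; rewrite !(mulr0, mul0r).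
    rewrite ler_wpM2r ?u_ge0// ler_piMr ?heat_kernel_ge0//.
    by case/andP: (h01 (sqnorm (vec y))).
pose W (q : line * X R n) : R := if t0 <= (q.1 : R) <= 1 then uin q.1 q.2 else 0.
have mW : measurable_fun setT W by apply: measurable_if_time; exact: measurable_uin2.
have W0 q : 0 <= W q by rewrite /W; case: ifP => // _; exact: uin_ge0.
(* The mass bound holds at every time, and the times considered form an interval of length at most
   1. *)
have iW : (\int[nu R n]_q (W q)%:E <= CA%:E)%E.
  rewrite [leLHS](@fubini_tonelli1 _ _ _ _ _ L (mu R n)); last 2 first.
  - exact/measurable_EFinP.
  - by move=> q; rewrite lee_fin.
  apply: (@le_trans _ _ (\int[L]_(s in `[t0, 1%R]) CA%:E)%E).
    rewrite [leRHS]integral_mkcond; apply: ge0_le_integral => //.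
    - by move=> s _; apply: integral_ge0 => y _; rewrite lee_fin.
    - by apply: measurable_fun_fubini_tonelli_F; [exact/measurable_EFinP|move=> q; rewrite lee_fin].
    - by apply/(measurable_restrictT _ _).1 => //; exact: measurable_cst.
    - move=> s _; rewrite patchE mem_setE in_itv/= /fubini_F /W/=.
      have [st|st] := boolP (t0 <= (s : R) <= 1); last by rewrite integral0.
      apply: HA; case/andP: st => s0' s1'.
      by rewrite (lt_le_trans t00 s0') (le_trans s1')//; lra.
  rewrite integral_cst//=.
  have -> : (L `[t0, 1%R] = (1 - t0)%:E)%E.
    rewrite lebesgue_measure_itv/= lte_fin ifT ?EFinB//.
    exact: lt_le_trans t0t t1.
  by rewrite -EFinM lee_fin ler_piMr//; lra.
have mK : measurable_fun setT (fun q : line * X R n => heat_kernel (x - vec q.2) (t - (q.1 : R)) * fin_from t0 q).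
  apply: measurable_funM; first exact: measurable_heat_left.
  exact: measurable_fin_from.
have upperB : (\int[nu R n]_q (slab t0 s1 T' q)%:E <= B + (CE * CA)%:E)%E.
  apply: (@le_trans _ _ (\int[nu R n]_q ((heat_kernel (x - vec q.2) (t - (q.1 : R)) * fin_from t0 q)%:E + (CE * W q)%:E))%E).
    apply: integral_le_ge0.
    - by apply/measurable_EFinP; exact: bT.1.
    - by apply: emeasurable_funD; apply/measurable_EFinP => //; exact: measurable_funM.
    - by move=> q; rewrite -EFinD lee_fin addr_ge0 ?mulr_ge0 ?heat_kernel_ge0 ?fin_from_ge0.
    - move=> q; rewrite -EFinD lee_fin /slab; case: ifPn => [|_]; last first.
        by rewrite addr_ge0 ?mulr_ge0 ?heat_kernel_ge0 ?fin_from_ge0.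
      move=> /andP[q0 q1].
      have qt : (q.1 : R) < t by exact: le_lt_trans q1 s1t.
      have q00 : 0 < (q.1 : R) by exact: lt_le_trans t00 q0.
      have q11 : (q.1 : R) <= 1 by exact: le_trans (ltW qt) t1.
      have q16 : 0 < (q.1 : R) < 16 by rewrite q00 (lt_trans qt (andP t16).2).
      rewrite hE/= ?q00//; apply: lerD.
        rewrite /psi KE//= /fin_from /fbar /tcut /= q16 q0 (le_trans q11) /=; last by lra.
        case: ifPn => [y12|]; last first.
          by rewrite -ltNge => /ltW /hhi[-> _ _]; rewrite !(mulr0, mul0r).
        rewrite ler_wpM2r//.
          by apply: (heat_op_ge0 heat_ge0) => //=; lra.
        by rewrite ler_piMr ?heat_kernel_ge0//; case/andP: (h01 (sqnorm (vec q.2))).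
      rewrite KE//= /W q0 q11 /uin /ubar /tcut /= q16.
      have tq : 0 < t - (q.1 : R) by rewrite subr_gt0.
      have := HCE x (vec q.2) (t - (q.1 : R)) x9 tq.
      have uq : 0 <= U (vec q.2, q.1 : R) by exact: u_ge0.
      move=> /(ler_wpM2l uq) /le_trans; apply.
      by case: ifP => _; rewrite ?mulr1 ?mulr0// mulrC.
  rewrite ge0_integralD//; last 4 first.
  - by move=> q _; rewrite lee_fin mulr_ge0 ?heat_kernel_ge0 ?fin_from_ge0.
  - exact/measurable_EFinP.
  - by move=> q _; rewrite lee_fin mulr_ge0.
  - by apply/measurable_EFinP; exact: measurable_funM.
  apply: leeD => //; under eq_integral do rewrite EFinM.
  rewrite ge0_integralZl//; last 2 first.
  - exact/measurable_EFinP.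
  - by move=> q _; rewrite lee_fin.
  by rewrite EFinM lee_wpmul2l ?lee_fin.
have : ((c * (u x t / 2))%:E <= A + (B + (CE * CA)%:E))%E.
  by apply: (le_trans lower); rewrite iT; exact: leeD.
have CRE : CR = 2 / c * (1 + CE * CA) by [].
move: A B A0 B0 {upperA upperB} => [A| |] [B| |] // A0 B0; last 3 first.
- by move=> _; rewrite addey// gt0_muley ?leey ?lte_fin.
- by move=> _; rewrite addey// addye// gt0_muley ?leey ?lte_fin.
- by move=> _; rewrite !addey// gt0_muley ?leey ?lte_fin.
rewrite !lee_fin in A0 B0; rewrite -!EFinD -EFinM !lee_fin => H.
have H2 : u x t <= 2 / c * (A + (B + CE * CA)).
  by rewrite mulrAC ler_pdivlMr//; lra.
apply: (le_trans H2); rewrite CRE -[leRHS]mulrA ler_wpM2l ?divr_ge0 ?(ltW c0)//.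
by have := mulr_ge0 CEA (addr_ge0 A0 B0); lra.
Qed.

End representation.

(** * Interchange of integrals, and comparison of powers *)

Section kernel_tonelli.
Context (R : realType) d1 d2 (T1 : measurableType d1) (T2 : measurableType d2).
Variable m1 : {sigma_finite_measure set T1 -> \bar R}.
Variable m2 : {sigma_finite_measure set T2 -> \bar R}.
Local Open Scope ereal_scope.

(** Integrate in y first. The inner bound is asked only where [g] is nonzero because a source point
    before the initial time gives no control on the kernels. *)
Lemma kernel_tonelli (k1 : T1 -> R) (k2 : T1 * T2 -> R) (g : T2 -> R) (K : R) :
  measurable_fun setT k1 -> measurable_fun setT k2 -> measurable_fun setT g ->
  (forall y, 0 <= k1 y)%R -> (forall q, 0 <= k2 q)%R -> (forall z, 0 <= g z)%R ->
  (0 <= K)%R ->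
  (forall z, g z != 0%R -> \int[m1]_y (k1 y * k2 (y, z))%:E <= K%:E) ->
  \int[m1]_y ((k1 y)%:E * \int[m2]_z (k2 (y, z) * g z)%:E) <=
  K%:E * \int[m2]_z (g z)%:E.
Proof.
move=> mk1 mk2 mg k10 k20 g0 K0 Hk.
pose F (q : T1 * T2) : R := (k1 q.1 * (k2 q * g q.2))%R.
have mF : measurable_fun setT F.
  apply: measurable_funM; first exact: (measurableT_comp mk1 measurable_fst).
  apply: measurable_funM => //; exact: (measurableT_comp mg measurable_snd).
have F0 q : (0 <= F q)%R by rewrite !mulr_ge0.
rewrite [leLHS](_ : _ = \int[m1]_y \int[m2]_z (F (y, z))%:E); last first.
  apply: eq_integral => y _; rewrite -ge0_integralZl//; last 3 first.
  - apply/measurable_EFinP/measurable_funM => //.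
    exact: (measurableT_comp mk2 (pair1_measurable y)).
  - by move=> z _; rewrite lee_fin mulr_ge0.
  - by rewrite lee_fin.
rewrite (fubini_tonelli (fun q => (F q)%:E)); last 2 first.
- exact/measurable_EFinP.
- by move=> q; rewrite lee_fin.
rewrite -ge0_integralZl//; last 2 first.
- exact/measurable_EFinP.
- by move=> z _; rewrite lee_fin.
apply: ge0_le_integral => //.
- by move=> z _; apply: integral_ge0 => y _; rewrite lee_fin.
- apply: (measurable_fun_fubini_tonelli_G (fun q => (F q)%:E)).
    exact/measurable_EFinP.
  by move=> q; rewrite lee_fin.
- by under eq_fun do rewrite -EFinM; apply/measurable_EFinP; exact: measurable_funM.
- move=> z _; have [gz0|gz0] := eqVneq (g z) 0%R.
    by rewrite gz0 mule0 integral0_eq// => y _; rewrite /F/= gz0 !mulr0.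
  rewrite [leLHS](_ : _ = (g z)%:E * \int[m1]_y (k1 y * k2 (y, z))%:E).
    by rewrite muleC lee_wpmul2r ?lee_fin// Hk.
  rewrite -ge0_integralZl//; last 3 first.
  - apply/measurable_EFinP/measurable_funM => //.
    exact: (measurableT_comp mk2 (pair2_measurable z)).
  - by move=> y _; rewrite lee_fin mulr_ge0.
  - by rewrite lee_fin.
  by apply: eq_integral => y _; rewrite -EFinM /F/=; congr (_%:E); ring.
Qed.

End kernel_tonelli.

(** For a > A write a = a^(1-p) a^p, where the exponent 1 - p is at most 0. *)
Lemma le_split_powR (R : realType) (a A p : R) : 0 <= a -> 0 < A -> 1 <= p ->
  a <= A + powR A (1 - p) * powR a p.
Proof.
move=> a0 A0 p1; have [aA|Aa] := leP a A.
  by rewrite ler_wpDr// mulr_ge0 ?powR_ge0.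
have a0' : 0 < a := lt_trans A0 Aa.
rewrite ler_wpDl ?(ltW A0)//.
rewrite -[leLHS](powRr1 a0) -[X in powR a X <= _](subrK p) powRD; last first.
  by rewrite (gt_eqF a0') implybT.
rewrite ler_wpM2r ?powR_ge0// -[1 - p]opprB.
by apply: powR_le_neg => //; [rewrite subr_ge0|exact: ltW].
Qed.

(** * Uniform bounds for integrals of Phi^g u^p *)

Section integrability.
Variables (R : realType) (n : nat).
Hypothesis n_gt0 : (0 < n)%N.
Local Notation line := (measurableTypeR R).
Local Notation V := ('rV[R]_n * R)%type.
Variable u : 'rV[R]_n -> R -> R.
Let U (z : V) := u z.1 z.2.
Hypothesis u_ge0 : forall x t, 0 < t < 16 -> 0 <= u x t.
Hypothesis u_C21 : C21_on [set z | 0 < z.2 < 16] U.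
Hypothesis heat_ge0 : forall x t, enorm x < 4 -> 0 < t < 16 -> 0 <= heat_op u (x, t).

Let measurable_hk2 (p : R) : measurable_fun setT (fun q : (line * X R n) * (line * X R n) =>
  powR (heat_kernel (vec q.1.2 - vec q.2.2) ((q.1.1 : R) - (q.2.1 : R))) p).
Proof.
apply: (measurableT_comp (measurable_powR _)); apply: measurable_heat_kernel => [i|].
  rewrite (_ : (fun q => _) = (fun q : (line * X R n) * (line * X R n) =>
     vec q.1.2 ord0 i - vec q.2.2 ord0 i)); last by apply/funext => q; rewrite !mxE.
  apply: measurable_funB.
    exact: (measurableT_comp (measurableT_comp (measurable_vec_coord i) measurable_snd) measurable_fst).
  exact: (measurableT_comp (measurableT_comp (measurable_vec_coord i) measurable_snd) measurable_snd).
apply: measurable_funB.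
  exact: (measurableT_comp measurable_fst measurable_fst).
exact: (measurableT_comp measurable_fst measurable_snd).
Qed.

Let measurable_hk1 (p t0 : R) : measurable_fun setT (fun q : (line * X R n) * X R n =>
  powR (heat_kernel (vec q.1.2 - vec q.2) ((q.1.1 : R) - t0)) p).
Proof.
have m : measurable_fun setT (fun q : (line * X R n) * X R n => (q.1, (t0 : line, q.2))).
  apply: measurable_fun_pair; first exact: measurable_fst.
  exact: (measurableT_comp (pair1_measurable (t0 : line)) measurable_snd).
exact: (measurableT_comp (measurable_hk2 p) m).
Qed.

Definition initial_powR (p t0 : R) (q : line * X R n) :=
  (\int[mu R n]_z (powR (heat_kernel (vec q.2 - vec z) ((q.1 : R) - t0)) p * uin u t0 z)%:E)%E.
Definition source_powR (p t0 : R) (q : line * X R n) :=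
  (\int[nu R n]_z (powR (heat_kernel (vec q.2 - vec z.2) ((q.1 : R) - (z.1 : R))) p * fin_from u t0 z)%:E)%E.

(* The threshold A = v / D is chosen so that the terms A * mass can be absorbed
   in the left-hand side v = u(x,t). *)
Lemma powR_representation (p : R) : 1 <= p -> exists C : R, 0 <= C /\
  forall (q : line * X R n) (t0 : R), sqnorm (vec q.2) <= 9 -> 0 < t0 -> t0 < (q.1 : R) -> (q.1 : R) <= 1 ->
  ((powR (ubar u q) p)%:E <= C%:E * (1 + initial_powR p t0 q + source_powR p t0 q))%E.
Proof.
move=> p1.
have [CR [CR0 HR]] := representation n_gt0 u_ge0 u_C21 heat_ge0.
have [CA [CA0 [HU HF]]] := mass_bound u_ge0 u_C21 heat_ge0.
pose m0 := 2 * CA + 1.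
have m00 : 0 < m0 by rewrite /m0; lra.
have p0 : 0 <= p by lra.
(* The two mass terms contribute 2 CR A CA; with A = v / D and m0 > 2 CA this is at most v/4. The
   summand 1 in [m0] keeps D positive. *)
pose D := 4 * CR * m0.
have D0 : 0 < D by rewrite !mulr_gt0.
pose C := powR (4 * CR) p + 2 * CR * powR D (p - 1).
have C0 : 0 <= C by rewrite addr_ge0 ?powR_ge0// !mulr_ge0 ?powR_ge0 ?(ltW CR0).
exists C; split => // q t0 q9 t00 t0q q1.
have q16 : 0 < (q.1 : R) < 16 by rewrite (lt_trans t00 t0q) (le_lt_trans q1)//; lra.
have j10 : (0 <= initial_powR p t0 q)%E.
  by apply: integral_ge0 => z _; rewrite lee_fin mulr_ge0 ?powR_ge0 ?uin_ge0.
have j20 : (0 <= source_powR p t0 q)%E.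
  by apply: integral_ge0 => z _; rewrite lee_fin mulr_ge0 ?powR_ge0 ?fin_from_ge0.
have := HR (vec q.2) (q.1 : R) t0 q9 t00 t0q q1.
rewrite /ubar /tcut q16; set v := u (vec q.2) (q.1 : R).
have v0 : 0 <= v by exact: u_ge0.
have one : (1 <= 1 + initial_powR p t0 q + source_powR p t0 q)%E by rewrite -addeA leeDl// adde_ge0.
(* A small value is covered by the 1 on the right; a large one also absorbs the constant term CR <
   v/4, so half of v remains on the left. *)
have [v4|v4] := leP v (4 * CR).
  move=> _; apply: (@le_trans _ _ (C%:E * 1)%E); last by rewrite lee_wpmul2l.
  rewrite mule1 lee_fin (@le_trans _ _ (powR (4 * CR) p))//.
    by apply: ge0_ler_powR; rewrite ?nnegrE ?mulr_ge0 ?(ltW CR0).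
  by rewrite lerDl !mulr_ge0 ?powR_ge0 ?(ltW CR0).
have vg : 0 < v by apply: lt_trans v4; rewrite mulr_gt0.
pose A := v / D.
have A0 : 0 < A by rewrite divr_gt0.
have split_int d (T : measurableType d) (m : {measure set T -> \bar R}) (k g : T -> R) :
    measurable_fun setT k -> measurable_fun setT g -> (forall z, 0 <= k z) -> (forall z, 0 <= g z) ->
    (\int[m]_z (g z)%:E <= CA%:E)%E ->
    (\int[m]_z (k z * g z)%:E <= (A * CA)%:E + (powR A (1 - p))%:E * \int[m]_z (powR (k z) p * g z)%:E)%E.
  move=> mk mg k0 g0 gA.
  have mkp : measurable_fun setT (fun z => powR (k z) p * g z).
    by apply: measurable_funM => //; exact: (measurableT_comp (measurable_powR _) mk).
  apply: (@le_trans _ _ (\int[m]_z ((A%:E * (g z)%:E) + ((powR A (1 - p))%:E * (powR (k z) p * g z)%:E)))%E).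
    apply: ge0_le_integral => //.
    - by move=> z _; rewrite lee_fin mulr_ge0.
    - by apply/measurable_EFinP; exact: measurable_funM.
    - under eq_fun do rewrite -!EFinM -EFinD; apply/measurable_EFinP.
      by apply: measurable_funD; exact: measurable_funM.
    - move=> z _; rewrite -!EFinM -EFinD lee_fin mulrA -mulrDl ler_wpM2r//.
      exact: le_split_powR.
  rewrite ge0_integralD//; last 4 first.
  - by move=> z _; rewrite -EFinM lee_fin mulr_ge0// ltW.
  - by under eq_fun do rewrite -EFinM; apply/measurable_EFinP; exact: measurable_funM.
  - by move=> z _; rewrite -EFinM lee_fin !mulr_ge0 ?powR_ge0.
  - by under eq_fun do rewrite -EFinM; apply/measurable_EFinP; exact: measurable_funM.
  have e1 : (\int[m]_z (A%:E * (g z)%:E) = A%:E * \int[m]_z (g z)%:E)%E.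
    by apply: ge0_integralZl => //; solve [exact/measurable_EFinP | by rewrite lee_fin ltW | by move=> z _; rewrite lee_fin].
  have e2 : (\int[m]_z ((powR A (1 - p))%:E * (powR (k z) p * g z)%:E) =
     (powR A (1 - p))%:E * \int[m]_z (powR (k z) p * g z)%:E)%E.
    apply: ge0_integralZl => //; solve [exact/measurable_EFinP | by rewrite lee_fin powR_ge0 |
      by move=> z _; rewrite lee_fin mulr_ge0 ?powR_ge0].
  rewrite e1 e2; apply: leeD => //; rewrite [leRHS]EFinM; apply: lee_wpmul2l => //.
  by rewrite lee_fin ltW.
have s1 := split_int _ _ (mu R n) (fun y => heat_kernel (vec q.2 - vec y) ((q.1 : R) - t0)) (uin u t0).
have s2 := split_int _ _ (nu R n) (fun z => heat_kernel (vec q.2 - vec z.2) ((q.1 : R) - (z.1 : R))) (fin_from u t0).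
have {}s1 := s1 (measurable_heat_kernel (measurable_vec_sub _) (measurable_cst _)) (measurable_uin u_C21 t0)
   (fun y => heat_kernel_ge0 _ _) (uin_ge0 u_ge0 t0).
have {}s2 := s2 (measurable_heat_left _ _) (measurable_fin_from u_C21 t0)
   (fun y => heat_kernel_ge0 _ _) (fin_from_ge0 heat_ge0 t0).
have t08 : 0 < t0 <= 8 by rewrite t00 (le_trans (ltW t0q))// (le_trans q1)//; lra.
have {}s1 := s1 (HU t0 t08); have {}s2 := s2 (HF t0 t00).
rewrite -/(initial_powR p t0 q) in s1; rewrite -/(source_powR p t0 q) in s2.
move=> H; have {}H := le_trans H (lee_wpmul2l _ (leeD (leeD2l 1 s1) s2)).
have {H} : (v%:E <= CR%:E * (1 + ((A * CA)%:E + (A `^ (1 - p))%:E * initial_powR p t0 q) +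
   ((A * CA)%:E + (A `^ (1 - p))%:E * source_powR p t0 q)))%E by apply: H; rewrite lee_fin ltW.
have C2 : 2 * CR * powR D (p - 1) <= C by rewrite lerDr powR_ge0.
have AD : powR A (1 - p) = powR D (p - 1) / powR v (p - 1).
  rewrite /A powRM ?invr_ge0 ?(ltW D0)// powRV ?(ltW D0)// -[1 - p]opprB !powRN invrK mulrC.
  by [].
have Cgt0 : 0 < C by rewrite (lt_le_trans _ C2)// !mulr_gt0// powR_gt0.
move: (initial_powR p t0 q) (source_powR p t0 q) j10 j20 {s1 s2 one} => [j1| |] [j2| |] // j10 j20; last 3 first.
- by move=> _; rewrite addey// gt0_muley ?leey ?lte_fin.
- by move=> _; rewrite addey// addye// gt0_muley ?leey ?lte_fin.
- by move=> _; rewrite !addey// gt0_muley ?leey ?lte_fin.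
rewrite !lee_fin in j10 j20; rewrite -!EFinM !lee_fin => H.
have ACA : 2 * CR * (A * CA) <= v / 4.
  rewrite (_ : v / 4 = A * (CR * m0)); last first.
    by rewrite /A /D; field; rewrite !gt_eqF.
  rewrite (_ : 2 * CR * (A * CA) = A * (CR * (2 * CA))); last by ring.
  by rewrite ler_wpM2l ?(ltW A0)// ler_wpM2l ?(ltW CR0)// /m0 lerDl.
set w := powR A (1 - p) in H AD.
have H1 : v <= v / 4 + v / 4 + CR * w * (j1 + j2).
  have e : CR * (1 + (A * CA + w * j1) + (A * CA + w * j2)) = CR + 2 * CR * (A * CA) + CR * w * (j1 + j2) by ring.
  by rewrite e in H; lra.
have H2 : v <= 2 * (CR * w * (j1 + j2)) by lra.
have vp0 : 0 < powR v (p - 1) by exact: powR_gt0.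
have vE : powR v p = v * powR v (p - 1).
  rewrite -[X in X * _](powRr1 v0) -powRD; last by rewrite (gt_eqF vg) implybT.
  by congr (powR _ _); ring.
rewrite vE (le_trans (ler_wpM2r (ltW vp0) H2))// AD.
have vpn : powR v (p - 1) != 0 by rewrite gt_eqF.
rewrite [leLHS](_ : _ = 2 * CR * powR D (p - 1) * (j1 + j2)); last by field.
apply: (@le_trans _ _ (C * (j1 + j2))); first by rewrite ler_wpM2r// addr_ge0.
by rewrite ler_wpM2l// -addrA lerDr.
Qed.

Lemma measurable_initial_powR (p t0 : R) : measurable_fun setT (initial_powR p t0).
Proof.
have := @measurable_fun_fubini_tonelli_F _ _ _ _ R (mu R n) (fun q : (line * X R n) * X R n =>
   (powR (heat_kernel (vec q.1.2 - vec q.2) ((q.1.1 : R) - t0)) p * uin u t0 q.2)%:E).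
apply.
- apply/measurable_EFinP/measurable_funM; first exact: measurable_hk1.
  exact: (measurableT_comp (measurable_uin u_C21 t0) measurable_snd).
- by move=> q; rewrite lee_fin mulr_ge0 ?powR_ge0 ?uin_ge0.
Qed.

Lemma measurable_source_powR (p t0 : R) : measurable_fun setT (source_powR p t0).
Proof.
have := @measurable_fun_fubini_tonelli_F _ _ _ _ R (nu R n) (fun q : (line * X R n) * (line * X R n) =>
   (powR (heat_kernel (vec q.1.2 - vec q.2.2) ((q.1.1 : R) - (q.2.1 : R))) p * fin_from u t0 q.2)%:E).
apply.
- apply/measurable_EFinP/measurable_funM; first exact: measurable_hk2.
  exact: (measurableT_comp (measurable_fin_from u_C21 t0) measurable_snd).
- by move=> q; rewrite lee_fin mulr_ge0 ?powR_ge0 ?fin_from_ge0.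
Qed.

(** The restriction |y|^2 <= 9 is the region in which u is represented. *)
Definition heat_weighted (g p : R) (x : 'rV[R]_n) (t : R) (q : line * X R n) : R :=
  if sqnorm (vec q.2) <= 9 then
    powR (heat_kernel (x - vec q.2) (t - (q.1 : R))) g * powR (ubar u q) p else 0.

Lemma heat_weighted_ge0 g p x t q : 0 <= heat_weighted g p x t q.
Proof. by rewrite /heat_weighted; case: ifP => // _; rewrite mulr_ge0 ?powR_ge0. Qed.

Lemma measurable_heat_weighted g p x t : measurable_fun setT (heat_weighted g p x t).
Proof.
apply: measurable_if_sqnorm; apply: measurable_funM.
  exact: (measurableT_comp (measurable_powR _) (measurable_heat_left _ _)).
exact: (measurableT_comp (measurable_powR _) (measurable_ubar u_C21)).
Qed.

Let heat_left_le x (t p a : R) : 0 < p -> n%:R / 2 * (p - 1) < 1 -> a < t -> t - a <= 1 ->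
  (\int[nu R n]_q (if (a < q.1 < t)%R then
       powR (heat_kernel (x - vec q.2) (t - q.1)) p else 0)%:E <= (heat_const n p)%:E)%E.
Proof.
move=> p0 h ta ta1; apply: (le_trans (integral_heat_left x p0 h ta)).
by rewrite lee_fin ler_piMr ?heat_const_ge0// powR_itv_le1//; lra.
Qed.

Let heat_right_le x (t p a : R) : 0 < p -> n%:R / 2 * (p - 1) < 1 -> t - a <= 1 ->
  (\int[nu R n]_q (if (a < q.1 < t)%R then
       powR (heat_kernel (vec q.2 - x) (q.1 - a)) p else 0)%:E <= (heat_const n p)%:E)%E.
Proof.
move=> p0 h ta1; have [ta|ta] := ltP a t; last first.
  rewrite integral0_eq ?lee_fin ?heat_const_ge0// => q _; case: ifPn => // /andP[q1 q2].
  by move: (lt_trans q1 q2); rewrite ltNge ta.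
apply: (le_trans (integral_heat_right x p0 h ta)).
by rewrite lee_fin ler_piMr ?heat_const_ge0// powR_itv_le1//; lra.
Qed.

(** After u^p is replaced by its representation and the order of integration is exchanged, the inner
    integral carries Phi^g with pole at (x, t) and Phi^p with pole at the source point. [powR_young]
    bounds it by two integrals of Phi^(g+p), finite since g + p < 1 + 2/n, and the masses remain. *)
Lemma heat_weighted_bound_ge1 (p g : R) : 1 <= p -> 0 < g -> n%:R / 2 * (g + p - 1) < 1 ->
  exists C : R, 0 <= C /\ forall x t, 0 < t <= 1 ->
  (\int[nu R n]_q (heat_weighted g p x t q)%:E <= C%:E)%E.
Proof.
move=> p1 g0 hgp.
have n0 : 0 < n%:R / 2 :> R by rewrite divr_gt0// ltr0n.
have hg : n%:R / 2 * (g - 1) < 1.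
  by apply: le_lt_trans hgp; rewrite ler_wpM2l ?(ltW n0)//; lra.
have gp0 : 0 < g + p by lra.
have [C2 [C20 HC2]] := powR_representation p1.
have [CA [CA0 [HU HF]]] := mass_bound u_ge0 u_C21 heat_ge0.
pose K := heat_const n (g + p) + heat_const n (g + p).
have K0 : 0 <= K by rewrite addr_ge0 ?heat_const_ge0.
pose C := C2 * (heat_const n g + K * CA + K * CA).
have C0 : 0 <= C.
  have h1 := heat_const_ge0 hg; have h2 : 0 <= K * CA by exact: mulr_ge0.
  by apply: mulr_ge0 => //; apply: addr_ge0 => //; exact: addr_ge0.
exists C; split => // x t /andP[t0 t1].
have hk0 v s : 0 <= heat_kernel v s :> R by exact: heat_kernel_ge0.
pose k1 (a : R) (q : line * X R n) : R := if a < (q.1 : R) < t then powR (heat_kernel (x - vec q.2) (t - (q.1 : R))) g else 0.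
have k10 a q : 0 <= k1 a q by rewrite /k1; case: ifP => // _; exact: powR_ge0.
have mk1 a : measurable_fun setT (k1 a).
  apply: measurable_if_time_oo.
  exact: (measurableT_comp (measurable_powR _) (measurable_heat_left _ _)).
have mL a : measurable_fun setT (fun q : line * X R n => (if a < (q.1 : R) < t then
   powR (heat_kernel (x - vec q.2) (t - (q.1 : R))) (g + p) else 0)).
  apply: measurable_if_time_oo.
  exact: (measurableT_comp (measurable_powR _) (measurable_heat_left _ _)).
have mR a z : measurable_fun setT (fun q : line * X R n => (if a < (q.1 : R) < t then
   powR (heat_kernel (vec q.2 - z) ((q.1 : R) - a)) (g + p) else 0)).
  apply: measurable_if_time_oo.
  exact: (measurableT_comp (measurable_powR _) (measurable_heat_right _ _)).
(* Here a is the initial time and b the time of the source point, which is not earlier; before b the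
   second kernel is zero. *)
have inner (a b : R) z : 0 < a -> a < t -> a <= b ->
   (\int[nu R n]_q (k1 a q * powR (heat_kernel (vec q.2 - z) ((q.1 : R) - b)) p)%:E <= K%:E)%E.
  move=> a0 at_ ab.
  apply: (@le_trans _ _ (\int[nu R n]_q ((if (a < q.1 < t)%R then
       powR (heat_kernel (x - vec q.2) (t - q.1)) (g + p) else 0)%:E +
       (if (b < q.1 < t)%R then powR (heat_kernel (vec q.2 - z) (q.1 - b)) (g + p) else 0)%:E))%E).
    apply: ge0_le_integral => //.
    - by move=> q _; rewrite lee_fin mulr_ge0 ?powR_ge0.
    - apply/measurable_EFinP; apply: measurable_funM => //.
      exact: (measurableT_comp (measurable_powR _) (measurable_heat_right _ _)).
    - by apply: emeasurable_funD; apply/measurable_EFinP; [exact: mL|exact: mR].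
    - move=> q _.
      rewrite -EFinD.
      rewrite lee_fin.
      rewrite /k1.
      have [/andP[q1 q2]|_] := boolP (a < (q.1 : R) < t); last first.
        by rewrite mul0r add0r; case: ifP => // _; exact: powR_ge0.
      rewrite q2 andbT; case: ifPn => [bq|]; first by apply: powR_young => //; lra.
      rewrite -leNgt => qb; rewrite [heat_kernel _ (_ - b)]/heat_kernel subr_gt0 ltNge qb /=.
      by rewrite powR0 ?mulr0 ?addr0 ?powR_ge0//; apply/eqP; lra.
  rewrite ge0_integralD//; last 4 first.
  - by move=> q _; rewrite lee_fin; case: ifP => // _; exact: powR_ge0.
  - by apply/measurable_EFinP; exact: mL.
  - by move=> q _; rewrite lee_fin; case: ifP => // _; exact: powR_ge0.
  - by apply/measurable_EFinP; exact: mR.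
  rewrite EFinD; apply: leeD; first by apply: heat_left_le => //; lra.
  by apply: heat_right_le => //; lra.
have main a : 0 < a -> a < t ->
    (\int[nu R n]_q (if (a < q.1)%R then heat_weighted g p x t q else 0)%:E <= C%:E)%E.
  move=> a0 at_.
  have J10 q : (0 <= initial_powR p a q)%E.
    by apply: integral_ge0 => z _; rewrite lee_fin mulr_ge0 ?powR_ge0 ?uin_ge0.
  have J20 q : (0 <= source_powR p a q)%E.
    by apply: integral_ge0 => z _; rewrite lee_fin mulr_ge0 ?powR_ge0 ?fin_from_ge0.
  have mJ1 := measurable_initial_powR p a; have mJ2 := measurable_source_powR p a.
  have mk1E : measurable_fun setT (fun q => (k1 a q)%:E) by exact/measurable_EFinP.
  apply: (@le_trans _ _ (\int[nu R n]_q (C2%:E * ((k1 a q)%:E + (k1 a q)%:E * initial_powR p a q + (k1 a q)%:E * source_powR p a q)))%E).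
    apply: ge0_le_integral => //.
    - by move=> q _; rewrite lee_fin; case: ifP => // _; exact: heat_weighted_ge0.
    - apply/measurable_EFinP; apply: measurable_fun_ifT => //; last exact: measurable_heat_weighted.
      by apply: measurable_fun_ltr => //; exact: measurable_fst.
    - apply: emeasurable_funM => //; apply: emeasurable_funD; last exact: emeasurable_funM.
      by apply: emeasurable_funD => //; exact: emeasurable_funM.
    - move=> q _; case: ifPn => [aq|_]; last first.
        by rewrite mule_ge0 ?lee_fin// !adde_ge0 ?mule_ge0 ?lee_fin.
      rewrite /heat_weighted; case: ifPn => [q9|_]; last first.
        by rewrite mule_ge0 ?lee_fin// !adde_ge0 ?mule_ge0 ?lee_fin.
      have [tq|qt] := leP t (q.1 : R).
        rewrite [heat_kernel _ _]/heat_kernel subr_gt0 ltNge tq /= powR0 ?mul0r ?gt_eqF//.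
        by rewrite mule_ge0 ?lee_fin// !adde_ge0 ?mule_ge0 ?lee_fin.
      rewrite /k1 aq qt/=; set f := powR (heat_kernel _ _) g.
      have f0 : 0 <= f by exact: powR_ge0.
      have := HC2 q a q9 a0 aq (le_trans (ltW qt) t1).
      rewrite EFinM => H; apply: (le_trans (lee_wpmul2l _ H)); first by rewrite lee_fin.
      rewrite muleCA; apply: lee_wpmul2l; first by rewrite lee_fin.
      rewrite [leLHS](ge0_muleDr f%:E (adde_ge0 lee01 (J10 q)) (J20 q)).
      by rewrite (ge0_muleDr f%:E lee01 (J10 q)) mule1.
  pose h q := ((k1 a q)%:E + (k1 a q)%:E * initial_powR p a q + (k1 a q)%:E * source_powR p a q)%E.
  have mh : measurable_fun setT h.
    apply: emeasurable_funD; last exact: emeasurable_funM.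
    by apply: emeasurable_funD => //; exact: emeasurable_funM.
  have h0 q : (0 <= h q)%E by rewrite !adde_ge0 ?mule_ge0 ?lee_fin.
  have C2E : (0 <= C2%:E)%E by rewrite lee_fin.
  rewrite [leLHS](@ge0_integralZl _ _ _ (nu R n) setT measurableT h mh C2%:E (fun q _ => h0 q) C2E).
  rewrite /C EFinM; apply: lee_wpmul2l => //.
  have p0 q : (0 <= (k1 a q)%:E)%E by rewrite lee_fin.
  have p1' q : (0 <= (k1 a q)%:E * initial_powR p a q)%E by rewrite mule_ge0.
  have p2 q : (0 <= (k1 a q)%:E * source_powR p a q)%E by rewrite mule_ge0.
  have p3 q : (0 <= (k1 a q)%:E + (k1 a q)%:E * initial_powR p a q)%E by rewrite adde_ge0.
  have q1' : measurable_fun setT (fun q => (k1 a q)%:E * initial_powR p a q)%E by exact: emeasurable_funM.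
  have q2 : measurable_fun setT (fun q => (k1 a q)%:E * source_powR p a q)%E by exact: emeasurable_funM.
  have q3 : measurable_fun setT (fun q => (k1 a q)%:E + (k1 a q)%:E * initial_powR p a q)%E by exact: emeasurable_funD.
  rewrite [leLHS](@ge0_integralD _ _ _ (nu R n) setT measurableT _ _ (fun q _ => p3 q) q3 (fun q _ => p2 q) q2).
  rewrite (@ge0_integralD _ _ _ (nu R n) setT measurableT _ _ (fun q _ => p0 q) mk1E (fun q _ => p1' q) q1').
  rewrite !EFinD; apply: leeD; first apply: leeD.
  - by apply: heat_left_le => //; lra.
  - apply: (@le_trans _ _ (K%:E * \int[mu R n]_z (uin u a z)%:E)%E).
      apply: (@kernel_tonelli R _ _ _ _ (nu R n) (mu R n) (k1 a) (fun q : (line * X R n) * X R n =>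
         powR (heat_kernel (vec q.1.2 - vec q.2) ((q.1.1 : R) - a)) p)) => //.
      - exact: measurable_uin.
      - by move=> q; exact: powR_ge0.
      - exact: uin_ge0.
      - by move=> z _; exact: (inner a a (vec z) a0 at_ (lexx a)).
    rewrite EFinM lee_wpmul2l ?lee_fin//; apply: HU; rewrite a0/=; lra.
  - apply: (@le_trans _ _ (K%:E * \int[nu R n]_z (fin_from u a z)%:E)%E).
      apply: (@kernel_tonelli R _ _ _ _ (nu R n) (nu R n) (k1 a) (fun q : (line * X R n) * (line * X R n) =>
         powR (heat_kernel (vec q.1.2 - vec q.2.2) ((q.1.1 : R) - (q.2.1 : R))) p)) => //.
      - exact: measurable_fin_from.
      - by move=> q; exact: powR_ge0.
      - exact: fin_from_ge0.
      - move=> z gz; apply: (inner a (z.1 : R) (vec z.2) a0 at_); move: gz; rewrite /fin_from.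
        by case: ifPn => [/andP[]//|_]; rewrite eqxx.
    by rewrite EFinM lee_wpmul2l ?lee_fin//; apply: HF.
(* The representation needs a positive initial time. [main] bounds the integral over s > a by a
   constant independent of a, and monotone convergence with a = 1/(k+1) reaches time 0. *)
pose F (k : nat) : set (line * X R n) := [set q | k.+1%:R^-1 < (q.1 : R)].
have mF k : measurable (F k).
  rewrite (_ : F k = setT `&` (fun q : line * X R n => (k.+1%:R^-1 < (q.1 : R))) @^-1` [set true]); last first.
    by rewrite setTI; apply/seteqP; split.
  by apply: measurable_fun_ltr => //; exact: measurable_fst.
have ndF : nondecreasing_seq F.
  move=> k l kl; rewrite subsetEset => q; apply: le_lt_trans.
  by rewrite lef_pV2 ?posrE// ler_nat ltnS.
have mw : measurable_fun setT (fun q => (heat_weighted g p x t q)%:E) by apply/measurable_EFinP; exact: measurable_heat_weighted.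
have cvF : (\int[nu R n]_(q in F k) (heat_weighted g p x t q)%:E @[k --> \oo] -->
   \int[nu R n]_(q in \bigcup_k F k) (heat_weighted g p x t q)%:E)%E.
  apply: ge0_nondecreasing_set_cvg_integral => //.
  - by move=> k; apply: measurable_funTS.
  - by move=> k q _; rewrite lee_fin; exact: heat_weighted_ge0.
have -> : (\int[nu R n]_q (heat_weighted g p x t q)%:E = \int[nu R n]_(q in \bigcup_k F k) (heat_weighted g p x t q)%:E)%E.
  rewrite [RHS]integral_mkcond; apply: eq_integral => q _; rewrite patchE.
  case: ifPn => //; rewrite notin_setE => Fq.
  have q0 : (q.1 : R) <= 0.
    rewrite leNgt; apply/negP => q0; apply: Fq.
    have [k] := near_infty_natSinv_lt (PosNum q0) => _ /(_ _ (leqnn k)) /= H.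
    by exists k.
  rewrite /heat_weighted /ubar /tcut ltNge q0 /= powR0 ?mulr0 ?if_same//; apply/eqP; lra.
rewrite -(cvg_lim _ cvF)//; apply: lime_le; first by apply/cvg_ex; eexists; exact: cvF.
apply: nearW => k.
have -> : (\int[nu R n]_(q in F k) (heat_weighted g p x t q)%:E = \int[nu R n]_q (if (k.+1%:R^-1 < q.1)%R then heat_weighted g p x t q else 0)%:E)%E.
  rewrite [LHS]integral_mkcond; apply: eq_integral => q _.
  have E : (q \in F k) = (k.+1%:R^-1 < (q.1 : R)) by apply/idP/idP; rewrite inE.
  by rewrite patchE E; case: ifP.
have [kt|kt] := ltP k.+1%:R^-1 t; first by apply: main.
rewrite integral0_eq ?lee_fin// => q _; case: ifPn => // kq.
rewrite /heat_weighted [heat_kernel _ _]/heat_kernel subr_gt0 ltNge (le_trans kt (ltW kq))/=.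
by rewrite powR0 ?gt_eqF// mul0r if_same.
Qed.

End integrability.

(** * The nonlinear potential *)

Section potential.
Variables (R : realType) (n : nat).
Hypothesis n_gt0 : (0 < n)%N.
Local Notation line := (measurableTypeR R).
Local Notation V := ('rV[R]_n * R)%type.
Variable u : 'rV[R]_n -> R -> R.
Let U (z : V) := u z.1 z.2.
Hypothesis u_ge0 : forall x t, 0 < t < 16 -> 0 <= u x t.
Hypothesis u_C21 : C21_on [set z | 0 < z.2 < 16] U.
Hypothesis heat_ge0 : forall x t, enorm x < 4 -> 0 < t < 16 -> 0 <= heat_op u (x, t).

Let n0 : 0 < n%:R / 2 :> R.
Proof. by rewrite divr_gt0// ltr0n. Qed.

Lemma heat_kernel_gt0 (v : 'rV[R]_n) (t : R) : 0 < t -> 0 < heat_kernel v t.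
Proof.
move=> t0; rewrite /heat_kernel t0 mulr_gt0 ?expR_gt0// powR_gt0//.
by rewrite mulr_gt0// mulr_gt0 ?pi_gt0.
Qed.

Lemma heat_kernel_le0 (v : 'rV[R]_n) (t : R) : t <= 0 -> heat_kernel v t = 0.
Proof. by move=> t0; rewrite /heat_kernel ltNge t0. Qed.

Lemma ubar_le0 (q : line * X R n) : (q.1 : R) <= 0 -> ubar u q = 0.
Proof. by move=> q0; rewrite /ubar /tcut ltNge q0. Qed.

(* For lambda < 1, use u^lambda <= Phi^(lambda-1) u where u >= Phi, and
   u^lambda <= Phi^lambda elsewhere. *)
Lemma heat_weighted_bound (lam g : R) : 0 < lam -> 0 < g -> 1 - lam < g ->
  n%:R / 2 * (g + lam - 1) < 1 ->
  exists C : R, 0 <= C /\ forall x t, 0 < t <= 1 ->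
  (\int[nu R n]_q (heat_weighted u g lam x t q)%:E <= C%:E)%E.
Proof.
move=> lam0 g0 lg hg; have [lam1|lam1] := leP 1 lam.
  exact: heat_weighted_bound_ge1.
(* Trading u^lambda for Phi^(lambda-1) u keeps the sum of the exponents at g + lambda, hence the
   integrability condition. *)
have hg1 : n%:R / 2 * (g + lam - 1 + 1 - 1) < 1 by rewrite addrK.
have g1 : 0 < g + lam - 1 by lra.
have [C [C0 HC]] := heat_weighted_bound_ge1 n_gt0 u_ge0 u_C21 heat_ge0 (lexx 1) g1 hg1.
exists (C + heat_const n (g + lam)); split; first by rewrite addr_ge0 ?heat_const_ge0.
move=> x t t01; have /andP[t0 t1] := t01.
pose w2 (q : line * X R n) := if 0 < (q.1 : R) < t then
  powR (heat_kernel (x - vec q.2) (t - (q.1 : R))) (g + lam) else 0.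
have mw2 : measurable_fun setT w2.
  apply: measurable_if_time_oo.
  exact: (measurableT_comp (measurable_powR _) (measurable_heat_left _ _)).
have w20 q : 0 <= w2 q by rewrite /w2; case: ifP => // _; exact: powR_ge0.
have mw1 := measurable_heat_weighted u_C21 (g + lam - 1) 1 x t.
have w10 q := heat_weighted_ge0 u (g + lam - 1) 1 x t q.
apply: (@le_trans _ _ (\int[nu R n]_q ((heat_weighted u (g + lam - 1) 1 x t q)%:E + (w2 q)%:E))%E).
  apply: ge0_le_integral => //.
  - by move=> q _; rewrite lee_fin; exact: heat_weighted_ge0.
  - by apply/measurable_EFinP; exact: measurable_heat_weighted.
  - by apply: emeasurable_funD; exact/measurable_EFinP.
  - move=> q _; rewrite -EFinD lee_fin.
    have [q0|q0] := leP (q.1 : R) 0.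
      rewrite [X in X <= _]/heat_weighted ubar_le0// powR0 ?gt_eqF// mulr0 if_same.
      by rewrite addr_ge0.
    have [tq|qt] := leP t (q.1 : R).
      rewrite [X in X <= _]/heat_weighted heat_kernel_le0 ?subr_le0// powR0 ?gt_eqF// mul0r if_same.
      by rewrite addr_ge0.
    rewrite /w2 q0 qt/= /heat_weighted; case: ifPn => [_|_]; last by rewrite add0r powR_ge0.
    have : 0 < t - (q.1 : R) by rewrite subr_gt0.
    move=> /(heat_kernel_gt0 (x - vec q.2)); set h := heat_kernel _ _ => h0.
    have := ubar_ge0 u_ge0 q; set v := ubar u q => v0.
    rewrite powRr1//; have [hv|vh] := leP h v.
      rewrite ler_wpDr ?powR_ge0//.
      have v0' : 0 < v := lt_le_trans h0 hv.
      have -> : powR v lam = powR v (lam - 1) * v.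
        rewrite -[X in _ * X](powRr1 v0) -powRD ?subrK//.
        by rewrite (gt_eqF v0') implybT.
      rewrite mulrA ler_wpM2r//.
      rewrite -addrA (powRD _ (s := lam - 1)); last by rewrite (gt_eqF h0) implybT.
      rewrite ler_wpM2l ?powR_ge0// -[lam - 1]opprB.
      by apply: powR_le_neg => //; rewrite subr_ge0 ltW.
    rewrite ler_wpDl ?mulr_ge0 ?powR_ge0//.
    rewrite powRD; last by rewrite (gt_eqF h0) implybT.
    rewrite ler_wpM2l ?powR_ge0//.
    by apply: (ge0_ler_powR (ltW lam0)); rewrite ?nnegrE ?(ltW h0) ?(ltW vh).
have m1E : measurable_fun setT (fun q => (heat_weighted u (g + lam - 1) 1 x t q)%:E) by exact/measurable_EFinP.
have m2E : measurable_fun setT (fun q => (w2 q)%:E) by exact/measurable_EFinP.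
have p1 q : (0 <= (heat_weighted u (g + lam - 1) 1 x t q)%:E)%E by rewrite lee_fin.
have p2 q : (0 <= (w2 q)%:E)%E by rewrite lee_fin.
rewrite [leLHS](@ge0_integralD _ _ _ (nu R n) setT measurableT _ _ (fun q _ => p1 q) m1E (fun q _ => p2 q) m2E).
rewrite EFinD; apply: leeD; first exact: HC.
have gl : 0 < g + lam by rewrite addr_gt0.
apply: (le_trans (integral_heat_left x gl hg t0)).
rewrite lee_fin ler_piMr ?heat_const_ge0// subr0.
by apply: powR_itv_le1; rewrite ?subr_ge0 ?(ltW hg) ?(ltW t0).
Qed.

(** Three regions. In the cylinder of size w, u <= M and Phi^a is integrable ([f2]). Outside it but
    with |y|^2 <= 9, Phi^a = Phi^(a-g) Phi^g and the first factor is at most (K w^(-n/2))^(a-g)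
    ([f3]). For |y|^2 > 9 the points x and y are at squared distance at least 1/2, so Phi^a is
    bounded and the L^lambda norm suffices ([f1]). *)
Lemma potential_bound (lam a g I : R) : 0 < lam -> 0 < g -> 1 - lam < g -> g <= a ->
  n%:R / 2 * (g + lam - 1) < 1 -> n%:R / 2 * (a - 1) < 1 -> 0 <= I ->
  (\int[nu R n]_q (powR (ubar u q) lam)%:E <= I%:E)%E ->
  exists C : R, 0 <= C /\ forall x t w M, sqnorm x <= 4 -> 0 < t <= 1 -> 0 < w -> 0 <= M ->
  (forall y s, sqnorm (x - y) < w -> t - w < s -> s < t -> 0 < s -> u y s <= M) ->
  (\int[nu R n]_q (powR (heat_kernel (x - vec q.2) (t - (q.1 : R))) a * powR (ubar u q) lam)%:E <=
   (C * (1 + powR M lam * powR w (1 - n%:R / 2 * (a - 1)) + powR w (- (n%:R / 2 * (a - g)))))%:E)%E.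
Proof.
move=> lam0 g0 lg ga hgl ha I0 HI.
have a0 : 0 < a := lt_le_trans g0 ga.
have [CW [CW0 HW]] := heat_weighted_bound lam0 g0 lg hgl.
have [K [K0 HK]] := @heat_kernel_bound R n n_gt0.
pose k9 := powR (K * powR 2^-1 (- (n%:R / 2))) a.
have k90 : 0 <= k9 by exact: powR_ge0.
pose hc := heat_const n a.
have hc0 : 0 <= hc by exact: heat_const_ge0.
pose C := k9 * I + hc + powR K (a - g) * CW.
have C0 : 0 <= C.
  apply: addr_ge0; first by apply: addr_ge0 => //; exact: mulr_ge0.
  by rewrite mulr_ge0 ?powR_ge0.
exists C; split => // x t w M x4 t01 w0 M0 uM; have /andP[t0 t1] := t01.
pose f1 (q : line * X R n) := k9 * powR (ubar u q) lam.
pose f2 (q : line * X R n) := powR M lam * (if t - w < (q.1 : R) < t then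
   powR (heat_kernel (x - vec q.2) (t - (q.1 : R))) a else 0).
pose k3 := powR (K * powR w (- (n%:R / 2))) (a - g).
have k30 : 0 <= k3 by exact: powR_ge0.
pose f3 (q : line * X R n) := k3 * heat_weighted u g lam x t q.
have f10 q : 0 <= f1 q by rewrite mulr_ge0 ?powR_ge0.
have f20 q : 0 <= f2 q by rewrite mulr_ge0 ?powR_ge0//; case: ifP => // _; exact: powR_ge0.
have f30 q : 0 <= f3 q by rewrite mulr_ge0 ?heat_weighted_ge0.
have mu_ : measurable_fun setT (fun q => powR (ubar u q) lam).
  exact: (measurableT_comp (measurable_powR _) (measurable_ubar u_C21)).
have mh : measurable_fun setT (fun q : line * X R n => powR (heat_kernel (x - vec q.2) (t - (q.1 : R))) a).
  exact: (measurableT_comp (measurable_powR _) (measurable_heat_left _ _)).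
have mh2 : measurable_fun setT (fun q : line * X R n => if t - w < (q.1 : R) < t then
   powR (heat_kernel (x - vec q.2) (t - (q.1 : R))) a else 0) by exact: measurable_if_time_oo.
have mw := measurable_heat_weighted u_C21 g lam x t.
have mf1 : measurable_fun setT (fun q => (f1 q)%:E) by apply/measurable_EFinP; exact: measurable_funM.
have mf2 : measurable_fun setT (fun q => (f2 q)%:E) by apply/measurable_EFinP; exact: measurable_funM.
have mf3 : measurable_fun setT (fun q => (f3 q)%:E) by apply/measurable_EFinP; exact: measurable_funM.
have pw q : powR (heat_kernel (x - vec q.2) (t - (q.1 : R))) a * powR (ubar u q) lam <= f1 q + f2 q + f3 q.
  have s0 : 0 <= f1 q + f2 q + f3 q by rewrite !addr_ge0.
  have [q0|q0] := leP (q.1 : R) 0; first by rewrite ubar_le0// powR0 ?gt_eqF// mulr0.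
  have [tq|qt] := leP t (q.1 : R).
    by rewrite heat_kernel_le0 ?subr_le0// powR0 ?gt_eqF// mul0r.
  have u0 := ubar_ge0 u_ge0 q.
  have h0 := heat_kernel_ge0 (x - vec q.2) (t - (q.1 : R)).
  have [/andP[near1 near2]|far] := boolP ((sqnorm (x - vec q.2) < w) && (t - w < (q.1 : R))).
    apply: (@le_trans _ _ (f2 q)); last by rewrite -addrA addrCA lerDl addr_ge0.
    rewrite /f2 near2 qt/= mulrC ler_wpM2r ?powR_ge0//.
    apply: (ge0_ler_powR (ltW lam0)); rewrite ?nnegrE//.
    by rewrite /ubar /tcut; case: ifP => // _; exact: uM.
  have wfar : w <= t - (q.1 : R) \/ w <= sqnorm (x - vec q.2).
    move: far; rewrite negb_and -!leNgt => /orP[|h]; [by right|left].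
    by rewrite lerBrDr addrC -lerBrDr.
  have [y9|y9] := leP (sqnorm (vec q.2)) 9.
    apply: (@le_trans _ _ (f3 q)); last by rewrite lerDr addr_ge0.
    rewrite /f3 /heat_weighted y9 mulrA; apply: ler_wpM2r; first exact: powR_ge0.
    rewrite -[X in powR _ X <= _](subrK g) powRD; last first.
      by rewrite subrK (gt_eqF a0).
    apply: ler_wpM2r; first exact: powR_ge0.
    apply: ge0_ler_powR; [by rewrite subr_ge0|by []| |exact: HK].
    by rewrite nnegrE mulr_ge0 ?powR_ge0 ?(ltW K0).
  apply: (@le_trans _ _ (f1 q)); last by rewrite -addrA lerDl addr_ge0.
  rewrite /f1; apply: ler_wpM2r; first exact: powR_ge0.
  apply: (ge0_ler_powR (ltW a0)); [by []|by rewrite nnegrE mulr_ge0 ?powR_ge0 ?(ltW K0)|].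
  apply: HK; first by rewrite invr_gt0.
  right.
  have : sqnorm (vec q.2) <= \sum_(i < n) (2 * x ord0 i ^+ 2 + 2 * (x - vec q.2) ord0 i ^+ 2).
    apply: ler_sum => i _; rewrite [in leRHS]mxE [in leRHS]mxE.
    move: (x ord0 i) (vec q.2 ord0 i) => b c.
    by have := sqr_ge0 (2 * b - c); nra.
  rewrite big_split/= -!mulr_sumr -/(sqnorm x) -/(sqnorm (x - vec q.2)).
  move: (sqnorm x) (sqnorm (vec q.2)) (sqnorm (x - vec q.2)) x4 y9 => b c d b4 c9 H.
  by lra.
have p1 q : (0 <= (f1 q)%:E)%E by rewrite lee_fin.
have p2 q : (0 <= (f2 q)%:E)%E by rewrite lee_fin.
have p3 q : (0 <= (f3 q)%:E)%E by rewrite lee_fin.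
have p12 q : (0 <= (f1 q)%:E + (f2 q)%:E)%E by rewrite adde_ge0.
have m12 : measurable_fun setT (fun q => (f1 q)%:E + (f2 q)%:E)%E by exact: emeasurable_funD.
apply: (@le_trans _ _ (\int[nu R n]_q ((f1 q)%:E + (f2 q)%:E + (f3 q)%:E))%E).
  apply: ge0_le_integral => //.
  - by move=> q _; rewrite lee_fin mulr_ge0 ?powR_ge0.
  - by apply/measurable_EFinP; exact: measurable_funM.
  - exact: emeasurable_funD.
  - by move=> q _; rewrite -!EFinD lee_fin.
rewrite [leLHS](@ge0_integralD _ _ _ (nu R n) setT measurableT _ _ (fun q _ => p12 q) m12 (fun q _ => p3 q) mf3).
rewrite (@ge0_integralD _ _ _ (nu R n) setT measurableT _ _ (fun q _ => p1 q) mf1 (fun q _ => p2 q) mf2).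
have zl (k : R) (f : line * X R n -> R) (B : R) : 0 <= k -> measurable_fun setT f -> (forall q, 0 <= f q) ->
    (\int[nu R n]_q (f q)%:E <= B%:E)%E -> (\int[nu R n]_q (k * f q)%:E <= (k * B)%:E)%E.
  move=> k0 mf ff HB.
  have mfE : measurable_fun setT (fun q => (f q)%:E) by exact/measurable_EFinP.
  have ffE q : (0 <= (f q)%:E)%E by rewrite lee_fin.
  have kE : (0 <= k%:E)%E by rewrite lee_fin.
  rewrite [leLHS](@ge0_integralZl _ _ _ (nu R n) setT measurableT _ mfE k%:E (fun q _ => ffE q) kE).
  by rewrite EFinM lee_wpmul2l.
have b1 := zl k9 _ I k90 mu_ (fun q => powR_ge0 _ _) HI.
have b3 := zl k3 _ CW k30 mw (heat_weighted_ge0 u g lam x t) (HW x t t01).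
have tw : t - w < t by lra.
have b2' := integral_heat_left x a0 ha tw.
have nn (q : line * X R n) : 0 <= (if t - w < (q.1 : R) < t then
   powR (heat_kernel (x - vec q.2) (t - (q.1 : R))) a else 0).
  by case: ifP => // _; exact: powR_ge0.
have b2 := zl (powR M lam) _ _ (powR_ge0 _ _) mh2 nn b2'.
apply: (le_trans (leeD (leeD b1 b2) b3)); rewrite -!EFinD lee_fin.
have -> : t - (t - w) = w by ring.
have -> : k3 = powR K (a - g) * powR w (- (n%:R / 2 * (a - g))).
  by rewrite /k3 powRM ?powR_ge0 ?(ltW K0)// -powRrM mulNr.
rewrite -/hc /C.
move: (powR M lam) (powR w (1 - _)) (powR w (- _)) (powR K (a - g)) (powR_ge0 M lam) (powR_ge0 w (1 - n%:R / 2 * (a - 1)))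
  (powR_ge0 w (- (n%:R / 2 * (a - g)))) (powR_ge0 K (a - g)) => m w1 w2 kk m0' w10 w20 kk0.
have e1 := mulr_ge0 k90 I0; have e2 := mulr_ge0 kk0 CW0; have e3 := mulr_ge0 m0' w10.
rewrite (_ : m * (hc * w1) = hc * (m * w1)); last by ring.
rewrite (_ : kk * w2 * CW = kk * CW * w2); last by ring.
move: (k9 * I) (kk * CW) (m * w1) e1 e2 e3 => A B D A0 B0 D0.
have h1 := mulr_ge0 A0 D0; have h2 := mulr_ge0 A0 w20; have h3 := mulr_ge0 hc0 w20; have h4 := mulr_ge0 B0 D0.
rewrite -subr_ge0 (_ : _ - _ = A * D + A * w2 + hc * w2 + B * D + hc + B); last by ring.
by rewrite !addr_ge0.
Qed.

End potential.

(** * Local estimate and maximum principle argument *)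

Section max_argument.
Variables (R : realType) (n : nat).
Hypothesis n_gt0 : (0 < n)%N.
Local Notation line := (measurableTypeR R).
Local Notation V := ('rV[R]_n * R)%type.
Variable u : 'rV[R]_n -> R -> R.
Let U (z : V) := u z.1 z.2.
Hypothesis u_ge0 : forall x t, 0 < t < 16 -> 0 <= u x t.
Hypothesis u_C21 : C21_on [set z | 0 < z.2 < 16] U.
Hypothesis heat_ge0 : forall x t, enorm x < 4 -> 0 < t < 16 -> 0 <= heat_op u (x, t).

(** The representation is started at t - w. There, and outside the cylinder, Phi is at most K
    w^(-n/2) and multiplies a bounded mass; inside, the source is at most F and the integral of Phi
    is proportional to w. *)
Lemma local_estimate : exists C : R, 0 < C /\ forall x t w F,
  sqnorm x <= 9 -> 0 < w -> w < t -> t <= 1 -> 0 <= F ->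
  (forall y s, sqnorm (x - y) < w -> t - w < s -> s < t -> heat_op u (y, s) <= F) ->
  u x t <= C * (1 + powR w (- (n%:R / 2)) + F * w).
Proof.
have [CR [CR0 HR]] := representation n_gt0 u_ge0 u_C21 heat_ge0.
have [CA [CA0 [HU HF]]] := mass_bound u_ge0 u_C21 heat_ge0.
have [K [K0 HK]] := @heat_kernel_bound R n n_gt0.
have h1 : n%:R / 2 * (1 - 1) < 1 :> R by rewrite subrr mulr0.
pose hc : R := heat_const n 1.
have hc0 : 0 <= hc by exact: heat_const_ge0.
have KCA : 0 <= K * CA by rewrite mulr_ge0 ?(ltW K0).
pose C := CR * (1 + 2 * (K * CA) + hc).
exists C; split; first by rewrite mulr_gt0// -addrA ltr_wpDr// addr_ge0// mulr_ge0.
move=> x t w F x9 w0 wt t1 F0 fF.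
pose t0 := t - w.
have t00 : 0 < t0 by rewrite /t0 subr_gt0.
have t0t : t0 < t by rewrite /t0; lra.
set W := powR w (- (n%:R / 2)).
have W0 : 0 <= W by exact: powR_ge0.
have t0E : t - t0 = w by rewrite /t0; ring.
have t08 : 0 < t0 <= 8 by rewrite t00/=; lra.
have zl d (T : measurableType d) (m : {measure set T -> \bar R}) (k : R) (f : T -> R) (B : R) :
    0 <= k -> measurable_fun setT f -> (forall q, 0 <= f q) ->
    (\int[m]_q (f q)%:E <= B%:E)%E -> (\int[m]_q (k * f q)%:E <= (k * B)%:E)%E.
  move=> k0 mf ff HB.
  have mfE : measurable_fun setT (fun q => (f q)%:E) by exact/measurable_EFinP.
  have ffE q : (0 <= (f q)%:E)%E by rewrite lee_fin.
  have kE : (0 <= k%:E)%E by rewrite lee_fin.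
  rewrite [leLHS](@ge0_integralZl _ _ _ m setT measurableT _ mfE k%:E (fun q _ => ffE q) kE).
  by rewrite EFinM lee_wpmul2l.
have mfin := measurable_fin_from u_C21 t0; have fin0 := fin_from_ge0 heat_ge0 t0.
have muin := measurable_uin u_C21 t0; have uin0 := uin_ge0 u_ge0 t0.
have KW0 : 0 <= K * W by rewrite mulr_ge0 ?(ltW K0).
have bA : (\int[mu R n]_y (heat_kernel (x - vec y) (t - t0) * uin u t0 y)%:E <= (K * W * CA)%:E)%E.
  apply: le_trans (zl _ _ (mu R n) (K * W) (uin u t0) CA KW0 muin uin0 (HU t0 t08)).
  apply: ge0_le_integral => //.
  - by move=> y _; rewrite lee_fin mulr_ge0// heat_kernel_ge0.
  - apply/measurable_EFinP; apply: measurable_funM => //.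
    by apply: measurable_heat_kernel => // i; exact: measurable_vec_sub.
  - by apply/measurable_EFinP; exact: measurable_funM.
  - move=> y _; rewrite lee_fin ler_wpM2r//; apply: HK => //.
    by left; rewrite t0E.
pose k1 (q : line * X R n) := if t - w < (q.1 : R) < t then
   powR (heat_kernel (x - vec q.2) (t - (q.1 : R))) 1 else 0.
have k10 q : 0 <= k1 q by rewrite /k1; case: ifP => // _; exact: powR_ge0.
have mk1 : measurable_fun setT k1.
  apply: measurable_if_time_oo.
  exact: (measurableT_comp (measurable_powR _) (measurable_heat_left _ _)).
have ik1 : (\int[nu R n]_q (k1 q)%:E <= (hc * w)%:E)%E.
  apply: (le_trans (integral_heat_left x ltr01 h1 t0t)).
  by rewrite t0E subrr mulr0 subr0 powRr1// ltW.
have bF := zl _ _ (nu R n) (K * W) (fin_from u t0) CA KW0 mfin fin0 (HF t0 t00).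
have bk := zl _ _ (nu R n) F k1 _ F0 mk1 k10 ik1.
have bB : (\int[nu R n]_q (heat_kernel (x - vec q.2) (t - q.1) * fin_from u t0 q)%:E <=
    (K * W * CA + F * (hc * w))%:E)%E.
  apply: (@le_trans _ _ (\int[nu R n]_q ((K * W * fin_from u t0 q)%:E + (F * k1 q)%:E))%E).
    apply: ge0_le_integral => //.
    - by move=> q _; rewrite lee_fin mulr_ge0// heat_kernel_ge0.
    - by apply/measurable_EFinP; apply: measurable_funM => //; exact: measurable_heat_left.
    - by apply: emeasurable_funD; apply/measurable_EFinP; exact: measurable_funM.
    - move=> q _; rewrite -EFinD lee_fin.
      have [tq|qt] := leP t (q.1 : R).
        rewrite heat_kernel_le0 ?subr_le0// mul0r.
        by apply: addr_ge0; apply: mulr_ge0.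
      have [/andP[near1 near2]|far] := boolP ((sqnorm (x - vec q.2) < w) && (t - w < (q.1 : R))).
        apply: (@le_trans _ _ (F * k1 q)); last by rewrite lerDr mulr_ge0.
        rewrite /k1 near2 qt/= powRr1 ?heat_kernel_ge0// mulrC.
        apply: ler_wpM2r; first exact: heat_kernel_ge0.
        rewrite /fin_from /fbar /tcut; case: ifP => // _; case: ifP => // _; case: ifP => // _.
        exact: fF.
      apply: (@le_trans _ _ (K * W * fin_from u t0 q)); last by rewrite lerDl mulr_ge0.
      apply: ler_wpM2r => //; apply: HK => //.
      move: far; rewrite negb_and -!leNgt => /orP[|h]; [by right|left].
      by rewrite lerBrDr addrC -lerBrDr.
  have m1 : measurable_fun setT (fun q => (K * W * fin_from u t0 q)%:E).
    by apply/measurable_EFinP; exact: measurable_funM.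
  have m2 : measurable_fun setT (fun q => (F * k1 q)%:E).
    by apply/measurable_EFinP; exact: measurable_funM.
  have p1 q : (0 <= (K * W * fin_from u t0 q)%:E)%E by rewrite lee_fin mulr_ge0.
  have p2 q : (0 <= (F * k1 q)%:E)%E by rewrite lee_fin mulr_ge0.
  rewrite [leLHS](@ge0_integralD _ _ _ (nu R n) setT measurableT _ _ (fun q _ => p1 q) m1 (fun q _ => p2 q) m2).
  by rewrite EFinD; apply: leeD.
have := HR x t t0 x9 t00 t0t t1.
have CRE : (0 <= CR%:E)%E by rewrite lee_fin ltW.
move=> /le_trans /(_ (lee_wpmul2l CRE (leeD (leeD2l 1%E bA) bB))).
rewrite -[1%E]/(1%:E) -!EFinD -EFinM lee_fin => /le_trans; apply.
rewrite /C -[leRHS]mulrA; apply: ler_wpM2l; first exact: ltW.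
have Fw : 0 <= F * w by rewrite mulr_ge0 ?(ltW w0).
rewrite (_ : K * W * CA = K * CA * W); last by ring.
rewrite (_ : F * (hc * w) = hc * (F * w)); last by ring.
move: (K * CA) (F * w) KCA Fw => A B A0 B0.
have e1 := mulr_ge0 A0 W0; have e2 := mulr_ge0 A0 B0; have e3 := mulr_ge0 hc0 W0; have e4 := mulr_ge0 hc0 B0.
rewrite -subr_ge0 (_ : _ - _ = 2 * A + hc + W + B + 2 * (A * B) + hc * W); last by ring.
by rewrite !addr_ge0// mulr_ge0.
Qed.

(* Truncated parabolic distance to the boundary of {|x| < 2} x {t > t1}: the
   factor 6 makes it at most halve on cylinders of size depth^2 / 4. *)
Definition depth (t1 : R) (z : V) : R :=
  Num.min (Num.sqrt (z.2 - t1)) (Num.max 0 ((4 - sqnorm z.1) / 6)).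

Lemma depth_ge0 t1 z : 0 <= depth t1 z.
Proof. by rewrite le_min sqrtr_ge0 le_max lexx. Qed.

(** For d <= 1, |y|^2 <= (1 + d/2) |x|^2 + (1 + 2/d) |x - y|^2 <= |x|^2 + 3d, so division by 6 costs
    at most d/2. In time, s - t1 >= d^2 - d^2/4 exceeds (d/2)^2. *)
Lemma depth_near t1 (x y : 'rV[R]_n) (t s : R) : 0 < depth t1 (x, t) -> depth t1 (x, t) <= 1 ->
  sqnorm (x - y) < depth t1 (x, t) ^+ 2 / 4 -> t - depth t1 (x, t) ^+ 2 / 4 < s ->
  [/\ t1 < s, sqnorm y < 4 & depth t1 (x, t) / 2 <= depth t1 (y, s)].
Proof.
set d := depth t1 (x, t) => d0 d1 xy ts.
have dt : d ^+ 2 <= t - t1.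
  have : d <= Num.sqrt (t - t1) by rewrite /d /depth ge_min lexx.
  move=> h; have tt : 0 < t - t1 by rewrite -sqrtr_gt0 (lt_le_trans d0 h).
  by rewrite -[leRHS](sqr_sqrtr (ltW tt)) ler_pXn2r ?nnegrE ?(ltW d0) ?sqrtr_ge0.
have dx : d <= (4 - sqnorm x) / 6.
  have : d <= Num.max 0 ((4 - sqnorm x) / 6) by rewrite /d /depth ge_min lexx orbT.
  by rewrite le_max => /orP[|//]; rewrite leNgt d0.
have d20 : 0 < d ^+ 2 by rewrite exprn_gt0.
have sy : sqnorm y <= sqnorm x + 3 * d.
  have x4 : sqnorm x <= 4 by lra.
  have : sqnorm y <= \sum_(i < n) ((1 + d / 2) * x ord0 i ^+ 2 + (1 + 2 / d) * (x - y) ord0 i ^+ 2).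
    apply: ler_sum => i _; rewrite [in leRHS]mxE [in leRHS]mxE.
    move: (x ord0 i) (y ord0 i) => p q.
    rewrite -subr_ge0.
    have -> : (1 + d / 2) * p ^+ 2 + (1 + 2 / d) * (p - q) ^+ 2 - q ^+ 2 =
      2 / d * (d / 2 * p + (p - q)) ^+ 2.
      by field; rewrite gt_eqF.
    by rewrite mulr_ge0 ?sqr_ge0// divr_ge0// ltW.
  rewrite big_split/= -!mulr_sumr -/(sqnorm x) -/(sqnorm (x - y)) => h; apply: (le_trans h).
  have h2 : (1 + 2 / d) * sqnorm (x - y) <= (1 + 2 / d) * (d ^+ 2 / 4).
    by rewrite ler_wpM2l ?(ltW xy)// addr_ge0// divr_ge0// ltW.
  have h3 : (1 + 2 / d) * (d ^+ 2 / 4) = d ^+ 2 / 4 + d / 2 by field; rewrite gt_eqF.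
  have h4 : d ^+ 2 <= d by rewrite expr2 ler_piMl// ltW.
  have h5 : d / 2 * sqnorm x <= d / 2 * 4 by rewrite ler_wpM2l// divr_ge0// ltW.
  by rewrite mulrDl mul1r; lra.
split; [lra|lra|].
rewrite /depth le_min; apply/andP; split => /=.
  rewrite -[leLHS]ger0_norm ?divr_ge0 ?(ltW d0)// -sqrtr_sqr ler_wsqrtr//.
  rewrite expr_div_n (_ : 2 ^+ 2 = 4); last by rewrite -natrX.
  by lra.
by rewrite le_max; apply/orP; right; lra.
Qed.

Lemma depth_cont t1 z : {for z, continuous (depth t1)}.
Proof.
apply: continuous_min.
  apply: (@continuous_comp _ R R (fun z : V => z.2 - t1) Num.sqrt); last exact: sqrt_continuous.
  by apply: cvgB; [exact: cvg_snd|exact: cvg_cst].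
apply: continuous_max; first exact: cvg_cst.
apply: cvgM; last exact: cvg_cst.
by apply: cvgB; [exact: cvg_cst|exact: continuous_sqnorm].
Qed.

Section blowup.
Variables (lam sigma a g CS : R).
Hypotheses (CS0 : 0 <= CS) (ga : g <= a).
Hypothesis glam : g + lam <= 1 + 2 / n%:R.
Hypothesis sub : a - g + sigma - 2 / n%:R < 1.
Hypothesis source_bound : forall x t w M, sqnorm x <= 4 -> 0 < t <= 1 -> 0 < w -> 0 <= M ->
  (forall y s, sqnorm (x - y) < w -> t - w < s -> s < t -> 0 < s -> u y s <= M) -> u x t <= M ->
  heat_op u (x, t) <= CS * (1 + powR M lam * powR w (1 - n%:R / 2 * (a - 1)) +
     powR w (- (n%:R / 2 * (a - g)))) * powR M sigma.

Lemma depth_bound : exists Lam : R, forall t1 x t, 0 < t1 -> t1 < t -> t <= 1 ->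
  sqnorm x <= 4 -> depth t1 (x, t) ^+ n * u x t <= Lam.
Proof.
have [C1 [C10 HC1]] := local_estimate.
have nR : 0 < n%:R :> R by rewrite ltr0n.
have nn : n%:R != 0 :> R by rewrite gt_eqF.
(* Since kap^(n/2) = 4 C1 + 1, the term C1 w^(-n/2) with w = kap M^(-2/n) is at most M/4. *)
pose kap := powR (4 * C1 + 1) (2 / n%:R).
have kap0 : 0 < kap by rewrite powR_gt0; lra.
have kapn : C1 * powR kap (- (n%:R / 2)) <= 1 / 4.
  rewrite powRN /kap -powRrM (_ : 2 / n%:R * (n%:R / 2) = 1); last by field.
  rewrite powRr1; last by lra.
  by rewrite ler_pdivrMr; lra.
pose N : R := 2 ^+ n.
have N0 : 0 < N by rewrite exprn_gt0.
pose e := 1 - n%:R / 2 * (a - 1).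
(* Exponents of M at scale w: the near part M^lam w^e of the potential does not exceed the order
   M^(a-g) of the far part, by g + lam <= 1 + 2/n. *)
have elam : lam + - (2 / n%:R) * e <= a - g.
  have -> : - (2 / n%:R) * e = a - 1 - 2 / n%:R by rewrite /e; field.
  by move: glam; lra.
pose f := n%:R / 2 * (a - g).
pose C4 := 1 + powR N lam * powR kap e + powR kap (- f).
have C40 : 0 <= C4.
  apply: addr_ge0; last exact: powR_ge0.
  by apply: addr_ge0; [exact: ler01|apply: mulr_ge0; exact: powR_ge0].
pose C5 := CS * C4 * powR N sigma * kap.
have C50 : 0 <= C5 by rewrite !mulr_ge0 ?powR_ge0 ?(ltW kap0).
pose eta := a - g + sigma - 2 / n%:R.
have eta1 : 0 < 1 - eta by rewrite subr_gt0.
(* One summand per requirement on a large maximum: C1 < M/4, C1 C5 M^eta <= M/4, and 16 w <= d^2. *)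
pose Lam := 1 + 4 * C1 + powR (4 * C1 * C5) (1 - eta)^-1 + powR (16 * kap) (n%:R / 2).
have L1 : 1 + 4 * C1 <= Lam by rewrite /Lam -addrA lerDl addr_ge0 ?powR_ge0.
have L2 : powR (4 * C1 * C5) (1 - eta)^-1 <= Lam.
  by rewrite /Lam -[X in _ <= X]addrA addrCA lerDl addr_ge0 ?powR_ge0//; lra.
have L3 : powR (16 * kap) (n%:R / 2) <= Lam.
  by rewrite /Lam lerDr addr_ge0 ?powR_ge0//; lra.
exists Lam => t1 x0 tt0 t10 t1t tt1 x04.
pose Psi (z : V) := depth t1 z ^+ n * U z.
(* A compact cube containing the ball |x| <= 2. The depth is 0 where |x| >= 2 and at time t1, so a
   maximum above Lam is not there. It may lie at time 1, since the cylinders extend backwards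
   only. *)
pose K : set V := [set v : 'rV[R]_n | forall i, `[(-2), 2]%classic (v ord0 i)] `*` `[t1, 1]%classic.
have inK z : sqnorm z.1 <= 4 -> t1 <= z.2 <= 1 -> K z.
  move=> z4 z1; split => /=; last by rewrite in_itv.
  move=> i; rewrite /= in_itv/= -ler_norml -(@ler_pXn2r _ 2)// ?nnegrE//.
  by rewrite real_normK ?num_real// (le_trans (coord_le_sqnorm _ _))// -natrX.
have K16 z : K z -> 0 < z.2 < 16.
  by move=> [_ /=]; rewrite in_itv/= => /andP[h1 h2]; rewrite (lt_le_trans t10 h1) (le_lt_trans h2)//; lra.
have cK : compact K.
  apply: compact_setX; last exact: segment_compact.
  have := @rV_compact R n (fun=> `[(-2), 2]%classic) (fun=> @segment_compact R (-2) 2).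
  by [].
have K0 : K !=set0 by exists (x0, tt0); apply: inK => //=; rewrite (ltW t1t).
have cPsi : {within K, continuous Psi}.
  apply: continuous_in_subspaceT => z; rewrite inE => /K16 z16.
  apply: cvgM; last exact: (continuous_U u_C21).
  apply: (@continuous_comp _ R R (depth t1) (fun r => r ^+ n)); first exact: depth_cont.
  exact: exprn_continuous.
have [P PK Pmax] := compact_EVT_max K0 cK cPsi.
rewrite inE in PK.
apply: (@le_trans _ _ (Psi P)).
  by apply: (Pmax (x0, tt0)); rewrite inE; apply: inK => //=; rewrite (ltW t1t).
rewrite leNgt; apply/negP => PsiL.
case: P PK Pmax PsiL => x t PK Pmax PsiL.
have t16 := K16 _ PK; have t1' : t <= 1 by case: PK => _ /=; rewrite in_itv/= => /andP[].
pose d := depth t1 (x, t); pose M := u x t.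
have M0 : 0 <= M by exact: u_ge0.
have d0 : 0 <= d by exact: depth_ge0.
have PsiE : Psi (x, t) = d ^+ n * M by [].
rewrite PsiE in PsiL.
have d1 : d <= 1.
  rewrite /d /depth ge_min/=; apply/orP; left.
  have -> : 1 = Num.sqrt 1 :> R by rewrite sqrtr1.
  by rewrite ler_wsqrtr//; lra.
have dg : 0 < d.
  rewrite lt_neqAle d0 andbT; apply/eqP => d00.
  by move: PsiL; rewrite -d00 expr0n gtn_eqF//= mul0r ltNge; lra.
have ML : Lam < M.
  by rewrite (lt_le_trans PsiL)// ler_piMl// exprn_ile1.
have M1 : 1 <= M by lra.
have CM : 4 * C1 < M by lra.
have Mg : 0 < M by lra.
have near y s : sqnorm (x - y) < d ^+ 2 / 4 -> t - d ^+ 2 / 4 < s -> s < t ->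
    [/\ t1 < s, sqnorm y < 4 & u y s <= N * M].
  move=> xy ts st; have [ts1 y4 dd] := depth_near dg d1 xy ts; split => //.
  have yK : K (y, s).
    by apply: inK => /=; [exact: ltW|rewrite (ltW ts1) (le_trans (ltW st))].
  have := Pmax (y, s); rewrite inE PsiE => /(_ yK); rewrite /Psi => H.
  have dy : 0 < depth t1 (y, s) by apply: lt_le_trans dd; rewrite divr_gt0.
  have uy : 0 <= u y s by apply: u_ge0; exact: (K16 _ yK).
  rewrite -(@ler_pM2l _ (depth t1 (y, s) ^+ n)) ?exprn_gt0//; apply: (le_trans H).
  rewrite mulrA ler_wpM2r// /N -exprMn ler_pXn2r ?nnegrE ?mulr_ge0 ?(ltW dy)//.
  by rewrite -ler_pdivrMr.
pose w := kap * powR M (- (2 / n%:R)).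
have w0 : 0 < w by rewrite mulr_gt0// powR_gt0.
(* Two successive displacements of squared length below w add up to less than 4w, which must be at
   most d^2/4: the source is bounded at points of a w-cylinder by means of u on w-cylinders around
   those points. *)
have w4 : 16 * w <= d ^+ 2.
  have : powR (16 * kap) (n%:R / 2) <= d ^+ n * M by apply: (le_trans L3); exact: ltW.
  have n2 : 0 <= 2 / n%:R :> R by rewrite divr_ge0// ltW.
  move=> /(ge0_ler_powR n2); rewrite !nnegrE powR_ge0 mulr_ge0 ?exprn_ge0// => /(_ isT isT).
  rewrite -powRrM (_ : n%:R / 2 * (2 / n%:R) = 1); last by field.
  rewrite powRr1 ?mulr_ge0 ?(ltW kap0)// powRM ?exprn_ge0//.
  rewrite -powR_mulrn// -powRrM (_ : n%:R * (2 / n%:R) = 2%:R); last by field.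
  rewrite powR_mulrn// => H.
  by rewrite /w mulrA powRN ler_pdivrMr// powR_gt0.
have wE r : powR w r = powR kap r * powR M (- (2 / n%:R) * r).
  by rewrite /w powRM ?powR_ge0 ?(ltW kap0)// -powRrM.
have MD r s : powR M r * powR M s = powR M (r + s).
  by rewrite powRD// (gt_eqF Mg) implybT.
have NM0 : 0 <= N * M by rewrite mulr_ge0 ?(ltW N0).
pose F := CS * (1 + powR (N * M) lam * powR w e + powR w (- f)) * powR (N * M) sigma.
have F0 : 0 <= F.
  apply: mulr_ge0; last exact: powR_ge0.
  apply: (mulr_ge0 CS0).
  apply: addr_ge0; last exact: powR_ge0.
  by apply: addr_ge0; [exact: ler01|apply: mulr_ge0; exact: powR_ge0].
have wd : w < d ^+ 2 / 4 by lra.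
have dt : d ^+ 2 <= t - t1.
  have : d <= Num.sqrt (t - t1) by rewrite /d /depth ge_min lexx.
  move=> h; have tt : 0 < t - t1 by rewrite -sqrtr_gt0 (lt_le_trans dg h).
  by rewrite -[leRHS](sqr_sqrtr (ltW tt)) ler_pXn2r ?nnegrE ?sqrtr_ge0.
have sF y s : sqnorm (x - y) < w -> t - w < s -> s < t -> heat_op u (y, s) <= F.
  move=> xy ts st.
  have [s1 y4 uy] := near y s (lt_trans xy wd) ltac:(lra) st.
  apply: source_bound => //; first exact: ltW.
    by rewrite (lt_trans t10 s1) (le_trans (ltW st)).
  move=> y' s' yy ss s's s'0.
  have [|||_ _ //] := near y' s'; [|lra|lra].
  have : sqnorm (x - y') <= \sum_(i < n) (2 * (x - y) ord0 i ^+ 2 + 2 * (y - y') ord0 i ^+ 2).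
    apply: ler_sum => i _; rewrite !mxE.
    move: (x ord0 i) (y ord0 i) (y' ord0 i) => p q r.
    by have := sqr_ge0 (p - q - (q - r)); nra.
  rewrite big_split/= -!mulr_sumr -/(sqnorm (x - y)) -/(sqnorm (y - y')) => h.
  by apply: (le_lt_trans h); lra.
have x4 : sqnorm x <= 4.
  have : 0 < Num.max 0 ((4 - sqnorm x) / 6).
    by apply: lt_le_trans dg _; rewrite /d /depth ge_min lexx orbT.
  by rewrite lt_max ltxx/= => h; lra.
have := HC1 x t w F ltac:(lra) w0 ltac:(lra) t1' F0 sF.
rewrite -/M => HM.
have Wn : powR w (- (n%:R / 2)) = powR kap (- (n%:R / 2)) * M.
  rewrite wE (_ : - (2 / n%:R) * - (n%:R / 2) = 1); last by field.
  by rewrite powRr1.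
have Fw : F * w <= C5 * powR M eta.
  have MM r s : r <= s -> powR M r <= powR M s by move=> rs; exact: ler_powR.
  have b1 : 1 <= powR M (a - g) by rewrite -(powRr0 M) MM// subr_ge0.
  have b2 : powR (N * M) lam * powR w e <= powR N lam * powR kap e * powR M (a - g).
    by rewrite wE powRM ?(ltW N0)// mulrACA MD ler_wpM2l ?mulr_ge0 ?powR_ge0// MM.
  have b3 : powR w (- f) = powR kap (- f) * powR M (a - g).
    by rewrite wE; congr (_ * powR _ _); rewrite /f; field.
  have b4 : 1 + powR (N * M) lam * powR w e + powR w (- f) <= C4 * powR M (a - g).
    by rewrite b3 /C4 [leRHS]mulrDl [(1 + _) * _]mulrDl mul1r; exact: lerD (lerD b1 b2) (lexx _).
  have b5 : F * w = (1 + powR (N * M) lam * powR w e + powR w (- f)) *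
      (CS * powR N sigma * kap * powR M (sigma - 2 / n%:R)).
    by rewrite /F [powR (N * M) sigma]powRM ?(ltW N0)// -MD /w; ring.
  rewrite b5; apply: (le_trans (ler_wpM2r _ b4)).
    by rewrite !mulr_ge0 ?powR_ge0// ltW.
  rewrite (_ : eta = a - g + (sigma - 2 / n%:R)); last by rewrite /eta; ring.
  by rewrite -(MD (a - g)) /C5 le_eqVlt; apply/orP; left; apply/eqP; ring.
have Meta : C1 * (C5 * powR M eta) <= M / 4.
  have h : 4 * C1 * C5 <= powR M (1 - eta).
    have p0 : 0 <= 4 * C1 * C5 by apply: mulr_ge0 C50; rewrite mulr_ge0 ?(ltW C10).
    have h0 : powR (4 * C1 * C5) (1 - eta)^-1 <= M by apply: (le_trans L2); exact: ltW.
    have := @ge0_ler_powR _ (1 - eta) (ltW eta1) _ _ (powR_ge0 _ _) M0 h0.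
    by rewrite -powRrM mulVf ?gt_eqF// powRr1.
  have ME : M = powR M (1 - eta) * powR M eta by rewrite MD subrK powRr1.
  have := ler_wpM2r (powR_ge0 M eta) h; rewrite -ME => h'.
  by rewrite ler_pdivlMr//; apply: le_trans h'; rewrite le_eqVlt; apply/orP; left; apply/eqP; ring.
(* It remains that M <= C1 + M/4 + M/4 with C1 < M/4, a contradiction. *)
rewrite Wn in HM.
have h1 : C1 * (powR kap (- (n%:R / 2)) * M) <= M / 4.
  by rewrite mulrA (le_trans (ler_wpM2r M0 kapn))// mul1r mulrC.
have h2 : C1 * (F * w) <= M / 4 by apply: le_trans Meta; rewrite ler_wpM2l ?(ltW C10).
rewrite !mulrDr mulr1 in HM.
clear -HM h1 h2 CM Mg.
by lra.
Qed.

End blowup.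

End max_argument.

(** * From the integrals of the statement to the space-time measure *)

Section weighted_integral.
Variables (R : realType) (n : nat).
Local Notation line := (measurableTypeR R).
Local Notation V := ('rV[R]_n * R)%type.
Variable u : 'rV[R]_n -> R -> R.
Let U (z : V) := u z.1 z.2.
Hypothesis u_C21 : C21_on [set z | 0 < z.2 < 16] U.

(** Positivity of [lam] matters: [powR 0 0] is 1, whereas the zero extension of u has to contribute
    nothing outside (0, 16). *)
Lemma int_Rn_time_ubar (lam : R) (k : 'rV[R]_n -> R -> R) : 0 < lam ->
  (forall y s, 0 <= k y s) ->
  measurable_fun setT (fun q : line * X R n => k (vec q.2) (q.1 : R)) ->
  int_Rn_time 0 16 (fun y s => (k y s * powR (u y s) lam)%:E) =
  (\int[nu R n]_q (k (vec q.2) (q.1 : R) * powR (ubar u q) lam)%:E)%E.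
Proof.
move=> lam0 k0 mk; apply: int_Rn_timeE.
- apply/measurable_EFinP; apply: measurable_funM mk _.
  exact: (measurableT_comp (measurable_powR _) (measurable_ubar u_C21)).
- by move=> p; rewrite lee_fin mulr_ge0 ?powR_ge0.
- by move=> s x _; rewrite lee_fin mulr_ge0 ?powR_ge0.
- by move=> s x s16; rewrite /ubar /tcut /= s16.
- by move=> s x s16; rewrite /ubar /tcut /= (negbTE s16) powR0 ?gt_eqF// mulr0.
Qed.

End weighted_integral.

(** * Choice of the auxiliary exponent g and conclusion *)

Theorem theorem4p1 (R : realType) (n : nat) (alpha lambda sigma : R)
  (u : 'rV[R]_n -> R -> R) :
  (1 <= n)%N ->
  0 < alpha -> alpha < n%:R + 2 ->
  (n%:R + 2 - alpha) / n%:R <= lambda -> lambda < (n%:R + 2) / n%:R ->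
  0 <= sigma -> sigma < (2 * (n%:R + 2) - alpha) / n%:R - lambda ->
  (forall x t, 0 < t < 16 -> 0 <= u x t) ->
  C21_on [set z | 0 < z.2 < 16] (fun z => u z.1 z.2) ->
  (int_Rn_time 0 16 (fun y s => (powR (u y s) lambda)%:E) < +oo)%E ->
  (forall x t, enorm x < 4 -> 0 < t < 16 ->
     let U := fun z : 'rV[R]_n * R => u z.1 z.2 in
     0 <= 'D_(tdir R n) U (x, t) - laplacian U (x, t) /\
     (('D_(tdir R n) U (x, t) - laplacian U (x, t))%:E <=
       int_Rn_time 0 16
         (fun y s => (powR (heat_kernel (x - y) (t - s)) (alpha / n%:R)
                      * powR (u y s) lambda)%:E)
       * (powR (u x t) sigma)%:E)%E) ->
  exists C : R, exists delta : R, 0 < delta /\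
    forall t, 0 < t < delta -> forall x, enorm x <= 1 ->
      u x t <= C * powR t (- (n%:R / 2)).
Proof.
move=> n1 al0 al1 lam1 lam2 sg0 sg1 u_ge0 u_C21 uint hyp.
have nR : 0 < n%:R :> R by rewrite ltr0n.
have nn : n%:R != 0 :> R by rewrite gt_eqF.
have heat_ge0 x t : enorm x < 4 -> 0 < t < 16 -> 0 <= heat_op u (x, t).
  by move=> x4 t16; have [] := hyp x t x4 t16.
pose a := alpha / n%:R.
pose b : R := 2 / n%:R.
have b0 : 0 < b by rewrite divr_gt0.
have a0 : 0 < a by rewrite divr_gt0.
have aq : a < 1 + b.
  by rewrite ltr_pdivrMr// mulrDl mul1r divfK.
have lamq : 1 + b - a <= lambda.
  by move: lam1; rewrite mulrBl mulrDl divff.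
have lamQ : lambda < 1 + b.
  by move: lam2; rewrite mulrDl divff.
have sgQ : sigma < 2 * (1 + b) - a - lambda.
  by move: sg1; rewrite mulrBl -[_ * _ / _]mulrA [(n%:R + 2) / _]mulrDl divff.
have lam0 : 0 < lambda by lra.
(* Lower constraints on g: positivity, 1 - lambda < g for the case lambda < 1, and sigma + a - (1 +
   b) < g for the absorption at the maximum. Integrability asks g < 1 + b - lambda; g is the
   midpoint. *)
pose lo := Num.max 0 (Num.max (1 - lambda) (sigma + a - (1 + b))).
have loq : lo < 1 + b - lambda.
  by rewrite !gt_max; apply/and3P; split; lra.
pose g := (lo + (1 + b - lambda)) / 2.
have glo : lo < g by rewrite /g; lra.
have ghi : g < 1 + b - lambda by rewrite /g; lra.
have /and3P[g0 g1 g2] : [&& 0 < g, 1 - lambda < g & sigma + a - (1 + b) < g].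
  by rewrite -!gt_max.
have ga : g <= a by lra.
have nb : n%:R / 2 * b = 1 by rewrite /b; field.
have n20 : 0 < n%:R / 2 :> R by rewrite divr_gt0.
have hgl : n%:R / 2 * (g + lambda - 1) < 1 by rewrite -[ltRHS]nb ltr_pM2l//; lra.
have ha : n%:R / 2 * (a - 1) < 1 by rewrite -[ltRHS]nb ltr_pM2l//; lra.
have uE := @int_Rn_time_ubar R n u u_C21 lambda (fun _ _ => 1) lam0 (fun _ _ => ler01) (measurable_cst _).
pose J := (\int[nu R n]_q (powR (ubar u q) lambda)%:E)%E.
have J0 : (0 <= J)%E by apply: integral_ge0 => q _; rewrite lee_fin powR_ge0.
have Joo : (J < +oo)%E.
  move: uE; under eq_integral do rewrite mul1r.
  rewrite -/J => <-; apply: le_lt_trans uint.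
  rewrite le_eqVlt; apply/orP; left; apply/eqP; congr (int_Rn_time 0 16 _).
  by apply/funext => y; apply/funext => s; rewrite mul1r.
have JI : (J <= (fine J)%:E)%E by rewrite fineK// ge0_fin_numE.
have I0 : 0 <= fine J by exact: fine_ge0.
have [CS [CS0 HCS]] := potential_bound n1 u_ge0 u_C21 heat_ge0 lam0 g0 g1 ga hgl ha I0 JI.
have source_bound x t w M : sqnorm x <= 4 -> 0 < t <= 1 -> 0 < w -> 0 <= M ->
  (forall y s, sqnorm (x - y) < w -> t - w < s -> s < t -> 0 < s -> u y s <= M) -> u x t <= M ->
  heat_op u (x, t) <= CS * (1 + powR M lambda * powR w (1 - n%:R / 2 * (a - 1)) +
     powR w (- (n%:R / 2 * (a - g)))) * powR M sigma.
  move=> x4 t01 w0 M0 uM uxM; have /andP[t0 t1] := t01.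
  have t16 : 0 < t < 16 by rewrite t0/=; lra.
  have x4' : enorm x < 4.
    have -> : 4 = Num.sqrt (4 ^+ 2) :> R by rewrite sqrtr_sqr ger0_norm.
    by rewrite /enorm ltr_sqrt ?exprn_gt0//; apply: (le_lt_trans x4); rewrite expr2; lra.
  have [_ ] := hyp x t x4' t16.
  rewrite -/(heat_op u (x, t)) -/a.
  have mk : measurable_fun setT (fun q : measurableTypeR R * X R n =>
      powR (heat_kernel (x - vec q.2) (t - (q.1 : R))) a).
    exact: (measurableT_comp (measurable_powR _) (measurable_heat_left _ _)).
  rewrite (@int_Rn_time_ubar R n u u_C21 lambda (fun y s => powR (heat_kernel (x - y) (t - s)) a) lam0 (fun _ _ => powR_ge0 _ _) mk) => H.
  rewrite -lee_fin; apply: (le_trans H); rewrite EFinM.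
  apply: lee_pmul.
  - by apply: integral_ge0 => q _; rewrite lee_fin mulr_ge0 ?powR_ge0.
  - by rewrite lee_fin powR_ge0.
  - exact: HCS.
  - by rewrite lee_fin; apply: (ge0_ler_powR sg0) => //; rewrite nnegrE u_ge0.
have glam : g + lambda <= 1 + 2 / n%:R by rewrite -/b; lra.
have sub : a - g + sigma - 2 / n%:R < 1 by rewrite -/b; lra.
have [Lam HL] := depth_bound n1 u_ge0 u_C21 heat_ge0 CS0 ga glam sub source_bound.
(* With initial time t/2 and |x| <= 1 the depth at (x, t) is at least sqrt(t/2)/2: its time part is
   sqrt(t/2) and its space part at least 1/2. The n-th power of this bound gives t^(-n/2) and the
   constant. *)
exists (Lam * 2 ^+ n * powR 2^-1 (- (n%:R / 2))), 1; split => // t /andP[t0 t1] x x1.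
have x1' : sqnorm x <= 1.
  have -> : sqnorm x = enorm x ^+ 2 by rewrite sqr_sqrtr ?sqnorm_ge0.
  by rewrite expr_le1 // sqrtr_ge0.
have ht : 0 < t / 2 by rewrite divr_gt0.
have := HL (t / 2) x t ht ltac:(lra) (ltW t1) ltac:(lra).
set d := depth _ _ => Hd.
have u0 : 0 <= u x t by rewrite u_ge0// t0/=; lra.
have sd : Num.sqrt (t / 2) / 2 <= d.
  have s1 : Num.sqrt (t / 2) <= 1 by rewrite -[leRHS]sqrtr1 ler_wsqrtr//; lra.
  have s0 := sqrtr_ge0 (t / 2).
  rewrite /d /depth le_min/=; apply/andP; split.
    by rewrite (_ : t - t / 2 = t / 2); [lra|field].
  by rewrite le_max; apply/orP; right; lra.
have sn : (Num.sqrt (t / 2) / 2) ^+ n * u x t <= Lam.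
  by apply: le_trans Hd; rewrite ler_wpM2r// ler_pXn2r ?nnegrE ?depth_ge0 ?divr_ge0 ?sqrtr_ge0.
have sE : (Num.sqrt (t / 2) / 2) ^+ n = (2 ^+ n * powR (t / 2) (- (n%:R / 2)))^-1.
  rewrite expr_div_n powRN invfM invrK mulrC; congr (_ * _).
  by rewrite -powR12_sqrt ?(ltW ht)// -powR_mulrn ?powR_ge0// -powRrM [_^-1 * n%:R]mulrC.
move: sn; rewrite sE mulrC ler_pdivrMr; last by rewrite mulr_gt0 ?exprn_gt0 ?powR_gt0.
by rewrite (powRM _ (ltW t0))// [powR t _ * _]mulrC !mulrA.
Qed.
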